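(* Let $A$ be a Hopf algebra, $B$ a braided Hopf algebra in the category $\mathcal M^A_A$ of right $A$-crossed modules, $\Omega(A)$ a strongly bicovariant exterior algebra on $A$ and $\Omega(B)$ a braided strongly bicovariant exterior algebra in $\mathcal M^{\Omega(A)}_{\Omega(A)}$. Then the super bosonisation $\Omega(A\rtimes B):=\Omega(A)\rtimes\Omega(B)$ is a strongly bicovariant exterior algebra on the biproduct Hopf algebra $A\rtimes B$ with differential $$d(\omega\otimes\eta)=d_A\omega\otimes\eta+(-1)^{|\omega|}\omega\otimes d_B\eta$$ for all $\omega\in\Omega(A)$, $\eta\in\Omega(B)$.
   Context: Work over a field $k$; Hopf algebras $A$ have invertible antipode. An exterior algebra on an algebra $A$ is a differential graded algebra $\Omega(A)=\oplus_{n\ge0}\Omega^n(A)$ with $\Omega^0=A$, generated by $A$ and $\Omega^1=\mathrm{span}\{a\,db\}$, with $d^2=0$ and graded Leibniz rule. The super tensor product $\underline\otimes$ has product $(a\otimes b)(c\otimes d)=(-1)^{|b||c|}ac\otimes bd$ and differential $d\otimes\mathrm{id}+(-1)^{|\ |}\mathrm{id}\otimes d$. $\Omega(A)$ is strongly bicovariant if it is a super-Hopf algebra (grade = form degree mod 2) with coproduct $\Delta_*$ preserving total degree, restricting to $\Delta$ on $A$, and obeying the super-coderivation property $\Delta_*d\omega=(d\otimes\mathrm{id}+(-1)^{|\ |}\mathrm{id}\otimes d)\Delta_*\omega$. For a super-Hopf algebra $K$ (an ordinary Hopf algebra being the case concentrated in degree 0), a super right $K$-crossed module is a super right $K$-module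 and comodule $V$ (coaction $\Delta_Rv=v^{(0)}\otimes v^{(1)}$) with $$\Delta_R(v\triangleleft a)=(-1)^{|v^{(1)}|(|a_{(1)}|+|a_{(2)}|)+|a_{(1)}||a_{(2)}|}v^{(0)}\triangleleft a_{(2)}\otimes(Sa_{(1)})v^{(1)}a_{(3)}.$$ These form the category $\mathcal M^K_K$ with braiding $\Psi(v\otimes w)=(-1)^{|v||w^{(0)}|}w^{(0)}\otimes(v\triangleleft w^{(1)})$. A (super) braided Hopf algebra $B$ in this category is an algebra (a super $K$-module algebra and $K$-comodule algebra) with a coproduct $\underline\Delta b=b_{\underline{(1)}}\otimes b_{\underline{(2)}}$, counit and antipode which are morphisms, satisfying the Hopf algebra axioms with $\underline\Delta(bc)=b_{\underline{(1)}}\Psi(b_{\underline{(2)}}\otimes c_{\underline{(1)}})c_{\underline{(2)}}$. $\Omega(B)$ (an exterior algebra on $B$) is braided strongly bicovariant if: the coaction of $A$ on $B$ is differentiable, i.e. extends to a total-degree-preserving DGA map $\Delta_{R*}:\Omega(B)\to\Omega(B)\underline\otimes\Omega(A)$, denoted $\eta\mapsto\eta^{(0)}\otimes\eta^{(1)}$; $A$ acts on $\Omega(B)$ making it an algebra in $\mathcal M^A_A$, and this action extends differentiably, i.e. to a degree-preserving $\triangleleft:\Omega(B)\underline\otimes\Omega(A)\to\Omega(B)$ making $\Omega(B)$ a super $\Omega(A)$-module algebra with $d_B(\eta\triangleleft\omega)=(d_B\eta)\triangleleft\omega+(-1)^{|\eta|}\eta\triangleleft d_A\omega$; $B$ is a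 braided Hopf algebra in $\mathcal M^A_A$; and $\underline\Delta$ extends to a degree-preserving super braided coproduct $\underline\Delta_*$ making $\Omega(B)$ a super braided-Hopf algebra in $\mathcal M^{\Omega(A)}_{\Omega(A)}$ with $\underline\Delta_*d_B=(d_B\otimes\mathrm{id}+(-1)^{|\ |}\mathrm{id}\otimes d_B)\underline\Delta_*$. The biproduct (bosonisation) $A\rtimes B$ is $A\otimes B$ with $(a\otimes b)(c\otimes d)=ac_{(1)}\otimes(b\triangleleft c_{(2)})d$ and $\Delta(a\otimes b)=a_{(1)}\otimes b_{\underline{(1)}}^{(0)}\otimes a_{(2)}b_{\underline{(1)}}^{(1)}\otimes b_{\underline{(2)}}$. The super bosonisation $\Omega(A)\rtimes\Omega(B)$ is $\Omega(A)\otimes\Omega(B)$ with $$(\omega\otimes\eta)(\tau\otimes\xi)=(-1)^{|\eta||\tau_{(1)}|}\omega\tau_{(1)}\otimes(\eta\triangleleft\tau_{(2)})\xi,\qquad\Delta_*(\omega\otimes\eta)=(-1)^{|\omega_{(2)}||\eta_{\underline{(1)}}^{(0)}|}\omega_{(1)}\otimes\eta_{\underline{(1)}}^{(0)}\otimes\omega_{(2)}\eta_{\underline{(1)}}^{(1)}\otimes\eta_{\underline{(2)}}.$$ *)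

(* Defs.v *)
From HB Require Import structures.
From mathcomp Require Import all_boot all_order all_algebra.
From mathcomp Require Import boolp.

Set Implicit Arguments.
Unset Strict Implicit.
Unset Printing Implicit Defensive.

Import GRing.Theory.
Local Open Scope ring_scope.
Local Open Scope quotient_scope.

(* Tensor product of two k-vector spaces: formal sums of pairs, two of them
   being identified when every bilinear map takes the same value on both. *)

Section Tensor.
Variables (k : fieldType) (V W : lmodType k).

Definition bilin (U : lmodType k) (f : V -> W -> U) : Prop :=
  (forall w, linear (f^~ w)) /\ (forall v, linear (f v)).

Definition tensor_eval (U : lmodType k) (f : V -> W -> U) (s : seq (V * W)) : U :=
  \sum_(x <- s) f x.1 x.2.

Definition tensor_rel (s t : seq (V * W)) : bool :=
  `[< forall (U : lmodType k) (f : V -> W -> U),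
        bilin f -> tensor_eval f s = tensor_eval f t >].

Lemma tensor_rel_refl : reflexive tensor_rel.
Proof. by move=> s; apply/asboolP. Qed.

Lemma tensor_rel_sym : symmetric tensor_rel.
Proof.
by move=> s t; apply/asboolP/asboolP => h U f bf; rewrite (h U f bf).
Qed.

Lemma tensor_rel_trans : transitive tensor_rel.
Proof.
move=> t s u /asboolP h1 /asboolP h2; apply/asboolP => U f bf.
by rewrite h1 // h2.
Qed.

Canonical tensor_equiv :=
  EquivRel tensor_rel tensor_rel_refl tensor_rel_sym tensor_rel_trans.

Definition tensor := {eq_quot tensor_rel}.
HB.instance Definition _ : EqQuotient _ tensor_rel tensor := EqQuotient.on tensor.
HB.instance Definition _ := Choice.on tensor.

(* [tlift f] is the linear map induced by a bilinear [f]; it is total, and only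
   meaningful when [f] is bilinear. *)
Definition tlift (U : lmodType k) (f : V -> W -> U) (t : tensor) : U :=
  tensor_eval f (repr t).

Lemma tlift_pi (U : lmodType k) (f : V -> W -> U) s :
  bilin f -> tlift f (\pi_tensor s) = tensor_eval f s.
Proof.
move=> bf; have : repr (\pi_tensor s) = s %[mod tensor] by rewrite reprK.
by move/eqmodP/asboolP; apply.
Qed.

Lemma tensor_eq (x y : tensor) :
  (forall (U : lmodType k) (f : V -> W -> U), bilin f -> tlift f x = tlift f y) ->
  x = y.
Proof.
move=> h; rewrite -[x]reprK -[y]reprK; apply/eqmodP/asboolP => U f bf.
exact: h.
Qed.

Lemma bilin_eval_scale (U : lmodType k) (f : V -> W -> U) a s : bilin f ->
  tensor_eval f [seq (a *: x.1, x.2) | x <- s] = a *: tensor_eval f s.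
Proof.
move=> [fl _]; rewrite /tensor_eval big_map scaler_sumr; apply: eq_bigr => x _ /=.
have f0 : f 0 x.2 = 0.
  by have := fl x.2 (-1) 0 0; rewrite scaler0 addr0 scaleN1r addNr.
by have := fl x.2 a x.1 0; rewrite !addr0 f0 addr0.
Qed.

Definition tensor_zero : tensor := \pi_tensor [::].
Definition tensor_add (x y : tensor) : tensor := \pi_tensor (repr x ++ repr y).
Definition tensor_scale (a : k) (x : tensor) : tensor :=
  \pi_tensor [seq (a *: v.1, v.2) | v <- repr x].
Definition tensor_opp (x : tensor) : tensor := tensor_scale (-1) x.

Lemma tlift0 (U : lmodType k) (f : V -> W -> U) :
  bilin f -> tlift f tensor_zero = 0.
Proof. by move=> bf; rewrite tlift_pi // /tensor_eval big_nil. Qed.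

Lemma tliftD (U : lmodType k) (f : V -> W -> U) x y :
  bilin f -> tlift f (tensor_add x y) = tlift f x + tlift f y.
Proof. by move=> bf; rewrite tlift_pi // /tensor_eval big_cat. Qed.

Lemma tliftZ (U : lmodType k) (f : V -> W -> U) a x :
  bilin f -> tlift f (tensor_scale a x) = a *: tlift f x.
Proof. by move=> bf; rewrite tlift_pi // bilin_eval_scale. Qed.

Lemma tensor_addA : associative tensor_add.
Proof. by move=> x y z; apply: tensor_eq => U f bf; rewrite !tliftD // addrA. Qed.

Lemma tensor_addC : commutative tensor_add.
Proof. by move=> x y; apply: tensor_eq => U f bf; rewrite !tliftD // addrC. Qed.

Lemma tensor_add0 : left_id tensor_zero tensor_add.
Proof. by move=> x; apply: tensor_eq => U f bf; rewrite tliftD // tlift0 // add0r. Qed.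

Lemma tensor_addN : left_inverse tensor_zero tensor_opp tensor_add.
Proof.
move=> x; apply: tensor_eq => U f bf.
by rewrite tliftD // tliftZ // tlift0 // scaleN1r addNr.
Qed.

HB.instance Definition _ :=
  GRing.isZmodule.Build tensor tensor_addA tensor_addC tensor_add0 tensor_addN.

Lemma tensor_scaleA a b x :
  tensor_scale a (tensor_scale b x) = tensor_scale (a * b) x.
Proof. by apply: tensor_eq => U f bf; rewrite !tliftZ // scalerA. Qed.

Lemma tensor_scale1 : left_id 1 tensor_scale.
Proof. by move=> x; apply: tensor_eq => U f bf; rewrite tliftZ // scale1r. Qed.

Lemma tensor_scaleDr : right_distributive tensor_scale +%R.
Proof.
by move=> a x y; apply: tensor_eq => U f bf; rewrite !(tliftZ, tliftD) // scalerDr.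
Qed.

Lemma tensor_scaleDl x : {morph tensor_scale^~ x : a b / a + b}.
Proof.
by move=> a b; apply: tensor_eq => U f bf; rewrite !(tliftZ, tliftD) // scalerDl.
Qed.

HB.instance Definition _ := GRing.Zmodule_isLmodule.Build k tensor
  tensor_scaleA tensor_scale1 tensor_scaleDr tensor_scaleDl.

Definition tens (v : V) (w : W) : tensor := \pi_tensor [:: (v, w)].

Lemma tliftE (U : lmodType k) (f : V -> W -> U) v w :
  bilin f -> tlift f (tens v w) = f v w.
Proof. by move=> bf; rewrite tlift_pi // /tensor_eval big_seq1. Qed.

Lemma tlift_linear (U : lmodType k) (f : V -> W -> U) : bilin f -> linear (tlift f).
Proof.
move=> bf a x y; rewrite -[a *: x]/(tensor_scale a x).
by rewrite -[_ + _]/(tensor_add (tensor_scale a x) y) tliftD // tliftZ.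
Qed.

Lemma tens_bilin : bilin tens.
Proof.
by split=> [w|v] a x y; apply: tensor_eq => U f bf;
  rewrite tlift_linear // !tliftE //; case: bf => fl fr; [apply: fl|apply: fr].
Qed.

Lemma tensor_sum (t : tensor) :
  exists s : seq (V * W), t = \sum_(x <- s) tens x.1 x.2.
Proof.
exists (repr t); apply: tensor_eq => U f bf.
rewrite {1}/tlift /tensor_eval; elim: (repr t) => [|x s IH].
  by rewrite !big_nil -[0 : tensor]/tensor_zero tlift0.
by rewrite !big_cons IH -[tens _ _ + _]/(tensor_add _ _) tliftD // tliftE.
Qed.

End Tensor.

Notation "v ⊗ w" := (tens v w) (at level 36, right associativity) : ring_scope.

(* Sweedler notation: the value at t of the map sending x ⊗ y to F. *)
Notation "'Sw' ( x , y ) <- t ; F" := (tlift (fun x y => F) t)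
  (at level 200, x name, y name, t at level 100, F at level 200,
   format "'Sw'  ( x ,  y )  <-  t ;  '/' F").

Definition tmap (k : fieldType) (V V' W W' : lmodType k) (f : V -> V') (g : W -> W')
    (t : tensor V W) : tensor V' W' :=
  Sw (v, w) <- t; f v ⊗ g w.

(* Super vector spaces: [part false] and [part true] are the projections onto
   the even and the odd subspace. *)

Record superspace (k : fieldType) := SuperSpace {
  scarrier :> lmodType k;
  part : bool -> scarrier -> scarrier
}.

Section Super.
Variable k : fieldType.
Implicit Types U V W : superspace k.

Definition homog V (p : bool) (v : V) : Prop := part p v = v.

Definition super_space V : Prop :=
  [/\ forall p, linear (@part k V p),
      forall p q (v : V), part p (part q v) = if p == q then part q v else 0 &
      forall v : V, v = part false v + part true v].

Definition super_map V W (f : V -> W) : Prop :=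
  linear f /\ forall p v, homog p v -> homog p (f v).

Definition super_bimap U V W (f : U -> V -> W) : Prop :=
  bilin f /\
  forall p q u v, homog p u -> homog q v -> homog (p (+) q) (f u v).

Definition purely_even (V : lmodType k) : superspace k :=
  @SuperSpace k V (fun p v => if p then 0 else v).

Definition superk : superspace k := purely_even (k^o : lmodType k).

(* [stlift F] is the linear map sending v ⊗ w, for v and w homogeneous of
   parities p and q, to F p v q w. *)
Definition stlift V W (U : lmodType k) (F : bool -> V -> bool -> W -> U)
    (t : tensor V W) : U :=
  tlift (fun v w => \sum_(p : bool) \sum_(q : bool) F p (part p v) q (part q w)) t.

Lemma stliftE V W (U : lmodType k) (F : bool -> V -> bool -> W -> U) p q v w :
  super_space V -> super_space W ->
  (forall p' q', bilin (fun v w => F p' v q' w)) ->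
  homog p v -> homog q w -> stlift F (v ⊗ w) = F p v q w.
Proof.
move=> [linV ppV _] [linW ppW _] bF hv hw.
have F0l p' q' y : F p' 0 q' y = 0.
  have [fl _] := bF p' q'.
  by have := fl y (-1) 0 0; rewrite scaler0 addr0 /= scaleN1r addNr.
have F0r p' q' x : F p' x q' 0 = 0.
  have [_ fr] := bF p' q'.
  by have := fr x (-1) 0 0; rewrite scaler0 addr0 /= scaleN1r addNr.
rewrite /stlift tliftE; last first.
  split=> [y a x x'|x a y y'] /=.
    rewrite scaler_sumr -big_split; apply: eq_bigr => p' _ /=.
    rewrite scaler_sumr -big_split; apply: eq_bigr => q' _ /=.
    by rewrite linV (bF p' q').1.
  rewrite scaler_sumr -big_split; apply: eq_bigr => p' _ /=.
  rewrite scaler_sumr -big_split; apply: eq_bigr => q' _ /=.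
  by rewrite linW (bF p' q').2.
rewrite (bigD1 p) //= (bigD1 q) //= hv hw !big1 ?addr0 // => i ni.
  rewrite big1 // => j _.
  by rewrite -hv ppV (negbTE ni) F0l.
by rewrite -{1}hw ppW (negbTE ni) F0r.
Qed.

End Super.

(* Sweedler notation with signs: x and y run over homogeneous elements, whose
   parities are p and q. *)
Notation "'SSw' ( x : p , y : q ) <- t ; F" := (stlift (fun p x q y => F) t)
  (at level 200, x name, y name, p name, q name, t at level 100, F at level 200,
   format "'SSw'  ( x  :  p ,  y  :  q )  <-  t ;  '/' F").

Definition stensor (k : fieldType) (V W : superspace k) : superspace k :=
  @SuperSpace k (tensor V W)
    (fun p t => Sw (v, w) <- t; \sum_(q : bool) part q v ⊗ part (p (+) q) w).

(* Raw structure maps. The axioms are separate predicates, so that the maps of a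
   bosonisation can be written down before the axioms are known to hold. *)

Record alg (k : fieldType) (V : lmodType k) := Alg {
  mul : V -> V -> V;
  one : V
}.

Record hopf (k : fieldType) (V : lmodType k) := Hopf {
  hopf_alg :> alg V;
  cop : V -> tensor V V;
  eps : V -> k;
  ant : V -> V
}.

Record crossed (k : fieldType) (V K : lmodType k) := Crossed {
  act : V -> K -> V;
  coact : V -> tensor V K
}.

Definition alg_map (k : fieldType) (V W : lmodType k) (aV : alg V) (aW : alg W)
    (f : V -> W) : Prop :=
  (forall x y, f (mul aV x y) = mul aW (f x) (f y)) /\ f (one aV) = one aW.

Section SuperHopf.
Variable k : fieldType.
Implicit Types V W : superspace k.

Definition super_algebra V (aV : alg V) : Prop :=
  [/\ super_space V,
      super_bimap (mul aV),
      homog false (one aV),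
      associative (mul aV) &
      left_id (one aV) (mul aV) /\ right_id (one aV) (mul aV)].

Definition stensor_alg V W (aV : alg V) (aW : alg W) : alg (stensor V W) :=
  @Alg k (stensor V W)
    (fun s t => SSw (a : _, b : q) <- s; SSw (c : r, d : _) <- t;
       (-1) ^+ (q * r) *: (mul aV a c ⊗ mul aW b d))
    (one aV ⊗ one aW).

Definition super_coalgebra V (H : hopf V) : Prop :=
  [/\ super_map (cop H : V -> stensor V V),
      super_map (eps H : V -> superk k),
      forall v, (Sw (x, y) <- cop H v; Sw (x1, x2) <- cop H x; x1 ⊗ x2 ⊗ y) =
                (Sw (x, y) <- cop H v; Sw (y1, y2) <- cop H y; x ⊗ y1 ⊗ y2),
      forall v, (Sw (x, y) <- cop H v; eps H x *: y) = v &
      forall v, (Sw (x, y) <- cop H v; eps H y *: x) = v].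

Definition is_antipode V (H : hopf V) : Prop :=
  [/\ super_map (ant H : V -> V),
      forall v, (Sw (x, y) <- cop H v; mul H (ant H x) y) = eps H v *: one H &
      forall v, (Sw (x, y) <- cop H v; mul H x (ant H y)) = eps H v *: one H].

Definition eps_alg_map V (H : hopf V) : Prop :=
  (forall x y, eps H (mul H x y) = eps H x * eps H y) /\ eps H (one H) = 1.

Definition super_hopf V (H : hopf V) : Prop :=
  [/\ super_algebra H,
      super_coalgebra H,
      alg_map H (stensor_alg H H) (cop H),
      eps_alg_map H &
      is_antipode H].

Definition hopf_algebra (A : lmodType k) (H : hopf A) : Prop :=
  @super_hopf (purely_even A) H.

End SuperHopf.

Section CrossedModules.
Variables (k : fieldType) (K : superspace k) (HK : hopf K).
Implicit Types V W : superspace k.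

Definition crossed_module V (cV : crossed V K) : Prop :=
  [/\ super_space V,
   [/\ super_bimap (act cV : V -> K -> V),
       forall v a b, act cV (act cV v a) b = act cV v (mul HK a b) &
       forall v, act cV v (one HK) = v],
   [/\ super_map (coact cV : V -> stensor V K),
       forall v, (Sw (v0, v1) <- coact cV v; Sw (v00, v01) <- coact cV v0;
                    v00 ⊗ v01 ⊗ v1) =
                 (Sw (v0, v1) <- coact cV v; Sw (x, y) <- cop HK v1; v0 ⊗ x ⊗ y) &
       forall v, (Sw (v0, v1) <- coact cV v; eps HK v1 *: v0) = v] &
   forall v a,
     coact cV (act cV v a) =
     SSw (v0 : _, v1 : q) <- coact cV v;
     SSw (a1 : p1, a' : _) <- cop HK a; SSw (a2 : p2, a3 : _) <- cop HK a';
       (-1) ^+ (q * (p1 + p2) + p1 * p2) *: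
         (act cV v0 a2 ⊗ mul HK (mul HK (ant HK a1) v1) a3)].

Definition crossed_map V W (cV : crossed V K) (cW : crossed W K) (f : V -> W) : Prop :=
  [/\ super_map f,
      forall v a, f (act cV v a) = act cW (f v) a &
      forall v, coact cW (f v) = tmap f id (coact cV v)].

Definition crossed_unit : crossed (superk k) K :=
  @Crossed k (superk k) K (fun x a => eps HK a *: x) (fun x => x ⊗ one HK).

Definition crossed_tensor V W (cV : crossed V K) (cW : crossed W K) :
    crossed (stensor V W) K :=
  @Crossed k (stensor V W) K
    (fun t a => SSw (v : _, w : q) <- t; SSw (a1 : p1, a2 : _) <- cop HK a;
       (-1) ^+ (q * p1) *: (act cV v a1 ⊗ act cW w a2))
    (fun t => SSw (v : _, w : _) <- t;
       SSw (v0 : _, v1 : r) <- coact cV v; SSw (w0 : s, w1 : _) <- coact cW w;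
       (-1) ^+ (r * s) *: ((v0 ⊗ w0) ⊗ mul HK v1 w1)).

Definition braiding V W (cV : crossed V K) (cW : crossed W K) (t : tensor V W) :
    tensor W V :=
  SSw (v : p, w : _) <- t; SSw (w0 : r, w1 : _) <- coact cW w;
    (-1) ^+ (p * r) *: (w0 ⊗ act cV v w1).

Definition crossed_algebra V (aV : alg V) (cV : crossed V K) : Prop :=
  [/\ crossed_module cV,
      super_algebra aV,
      (forall q b c a, homog q c ->
         act cV (mul aV b c) a =
         SSw (a1 : p1, a2 : _) <- cop HK a;
           (-1) ^+ (q * p1) *: mul aV (act cV b a1) (act cV c a2)),
      (forall a, act cV (one aV) a = eps HK a *: one aV) &
      alg_map aV (stensor_alg aV HK) (coact cV)].

Definition braided_hopf V (HV : hopf V) (cV : crossed V K) : Prop :=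
  [/\ crossed_algebra HV cV,
      super_coalgebra HV,
   [/\ crossed_map cV (crossed_tensor cV cV) (cop HV : V -> stensor V V),
       crossed_map cV crossed_unit (eps HV : V -> superk k) &
       crossed_map cV cV (ant HV)],
   [/\ forall b c,
         cop HV (mul HV b c) =
         Sw (b1, b2) <- cop HV b; Sw (c1, c2) <- cop HV c;
         Sw (x, y) <- braiding cV cV (b2 ⊗ c1); mul HV b1 x ⊗ mul HV y c2,
       cop HV (one HV) = one HV ⊗ one HV &
       eps_alg_map HV] &
      is_antipode HV].

End CrossedModules.

Definition braided_hopf_algebra (k : fieldType) (A B : lmodType k) (HA : hopf A)
    (HB : hopf B) (cB : crossed B A) : Prop :=
  @braided_hopf k (purely_even A) HA (purely_even B) HB cB.

(* N-graded spaces, the parity being the degree mod 2; [gpart n] is the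
   projection onto the degree n subspace. *)

Record graded (k : fieldType) := Graded {
  gsuper :> superspace k;
  gpart : nat -> gsuper -> gsuper
}.

Section Graded.
Variable k : fieldType.
Implicit Types V W U : graded k.

Definition hdeg V (n : nat) (v : V) : Prop := gpart n v = v.

Definition graded_space V : Prop :=
  [/\ super_space V,
      forall n, linear (@gpart k V n),
      forall m n (v : V), gpart m (gpart n v) = if m == n then gpart n v else 0,
      forall v : V, exists N, v = \sum_(n < N) gpart n v &
      forall n (v : V), hdeg n v -> homog (odd n) v].

Definition gr_map V W (f : V -> W) : Prop := forall n v, hdeg n v -> hdeg n (f v).

Definition gr_bimap U V W (f : U -> V -> W) : Prop :=
  forall m n u v, hdeg m u -> hdeg n v -> hdeg (m + n) (f u v).

Definition gtensor V W : graded k :=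
  @Graded k (stensor V W)
    (fun n t => Sw (v, w) <- t; \sum_(i < n.+1) gpart i v ⊗ gpart (n - i) w).

(* d ⊗ id + (-1)^{| |} id ⊗ d *)
Definition tdiff V W (dV : V -> V) (dW : W -> W) (t : tensor V W) : tensor V W :=
  SSw (v : p, w : _) <- t; dV v ⊗ w + (-1) ^+ p *: (v ⊗ dW w).

Definition dga V (aV : alg V) (d : V -> V) : Prop :=
  [/\ graded_space V,
   [/\ super_algebra aV, gr_bimap (mul aV) & hdeg 0 (one aV)],
   [/\ linear d, forall n v, hdeg n v -> hdeg n.+1 (d v) & forall v, d (d v) = 0] &
      forall n v w, hdeg n v ->
        d (mul aV v w) = mul aV (d v) w + (-1) ^+ n *: mul aV v (d w)].

Definition dga_map V W (aV : alg V) (dV : V -> V) (aW : alg W) (dW : W -> W)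
    (f : V -> W) : Prop :=
  [/\ linear f, gr_map f, alg_map aV aW f & forall v, f (dV v) = dW (f v)].

(* An exterior algebra on A, with A identified with the degree 0 part of O by
   means of [emb].  Scalars in the span defining degree 1 are absorbed in a. *)
Definition exterior_algebra (A : lmodType k) (aA : alg A) (O : graded k) (aO : alg O)
    (d : O -> O) (emb : A -> O) : Prop :=
  [/\ dga aO d,
   [/\ linear emb, injective emb, alg_map aA aO emb &
       forall w, hdeg 0 w <-> exists a, w = emb a],
      forall w, hdeg 1 w <->
        exists s : seq (A * A), w = \sum_(x <- s) mul aO (emb x.1) (d (emb x.2)) &
      forall P : O -> Prop,
        P (one aO) ->
        (forall c u v, P u -> P v -> P (c *: u + v)) ->
        (forall u v, P u -> P v -> P (mul aO u v)) ->
        (forall w, hdeg 0 w -> P w) ->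
        (forall w, hdeg 1 w -> P w) ->
        forall w, P w].

Definition strongly_bicovariant (A : lmodType k) (HA : hopf A) (O : graded k)
    (HO : hopf O) (d : O -> O) (emb : A -> O) : Prop :=
  [/\ exterior_algebra HA HO d emb,
      super_hopf HO,
      gr_map (cop HO : O -> gtensor O O),
      forall a, cop HO (emb a) = tmap emb emb (cop HA a) &
      forall w, cop HO (d w) = tdiff d d (cop HO w)].

(* In the third clause the action of A on OB is the restriction of the action of
   OA, and the coaction [delta] of A on OB is the component of the coaction of OA
   in OB ⊗ OA^0. *)
Definition braided_strongly_bicovariant
    (A : lmodType k) (HA : hopf A) (OA : graded k) (HOA : hopf OA)
    (dA : OA -> OA) (embA : A -> OA)
    (B : lmodType k) (HB : hopf B) (cB : crossed B A)
    (OB : graded k) (HOB : hopf OB) (cOB : crossed OB OA)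
    (dB : OB -> OB) (embB : B -> OB) : Prop :=
  [/\ exterior_algebra HB HOB dB embB,
   (forall b, coact cOB (embB b) = tmap embB embA (coact cB b)) /\
   @dga_map OB (gtensor OB OA) HOB dB (stensor_alg HOB HOA) (tdiff dB dA) (coact cOB),
   (exists delta : OB -> tensor OB A,
      (forall h, tmap id embA (delta h) = tmap id (gpart 0) (coact cOB h)) /\
      @crossed_algebra k (purely_even A) HA OB HOB
        (Crossed (fun h a => act cOB h (embA a)) delta)),
   [/\ forall b a, act cOB (embB b) (embA a) = embB (act cB b a),
       gr_bimap (act cOB : OB -> OA -> OB) &
       forall n h w, hdeg n h ->
         dB (act cOB h w) = act cOB (dB h) w + (-1) ^+ n *: act cOB h (dA w)] &
   [/\ braided_hopf_algebra HA HB cB,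
       forall b, cop HOB (embB b) = tmap embB embB (cop HB b),
       gr_map (cop HOB : OB -> gtensor OB OB),
       braided_hopf HOA HOB cOB &
       forall h, cop HOB (dB h) = tdiff dB dB (cop HOB h)]].

End Graded.

(* The antipode of a bosonisation is determined by the remaining structure and
   is passed as a parameter. *)

Definition biproduct (k : fieldType) (A B : lmodType k) (HA : hopf A) (HB : hopf B)
    (cB : crossed B A) (S : tensor A B -> tensor A B) : hopf (tensor A B) :=
  Hopf
    (Alg
      (fun x y => Sw (a, b) <- x; Sw (c, d) <- y; Sw (c1, c2) <- cop HA c;
         mul HA a c1 ⊗ mul HB (act cB b c2) d)
      (one HA ⊗ one HB))
    (fun x => Sw (a, b) <- x; Sw (a1, a2) <- cop HA a; Sw (b1, b2) <- cop HB b;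
       Sw (b10, b11) <- coact cB b1;
       (a1 ⊗ b10) ⊗ (mul HA a2 b11 ⊗ b2))
    (fun x => Sw (a, b) <- x; (eps HA a * eps HB b : k^o))
    S.

Definition super_bosonisation (k : fieldType) (K V : superspace k) (HK : hopf K)
    (HV : hopf V) (cV : crossed V K) (S : tensor K V -> tensor K V) :
    hopf (stensor K V) :=
  @Hopf k (stensor K V)
    (@Alg k (stensor K V)
      (fun x y => SSw (w : _, h : p) <- x; SSw (t : _, g : _) <- y;
         SSw (t1 : q, t2 : _) <- cop HK t;
         (-1) ^+ (p * q) *: (mul HK w t1 ⊗ mul HV (act cV h t2) g))
      (one HK ⊗ one HV))
    (fun x => SSw (w : _, h : _) <- x; SSw (w1 : _, w2 : p) <- cop HK w;
       SSw (h1 : _, h2 : _) <- cop HV h; SSw (h10 : q, h11 : _) <- coact cV h1;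
       (-1) ^+ (p * q) *: ((w1 ⊗ h10) ⊗ (mul HK w2 h11 ⊗ h2)))
    (fun x => Sw (w, h) <- x; (eps HK w * eps HV h : k^o))
    S.

(* Main.v *)
From HB Require Import structures.
From mathcomp Require Import all_boot all_order all_algebra.
From mathcomp Require Import boolp.
Require Import Defs.

Set Implicit Arguments.
Unset Strict Implicit.
Unset Printing Implicit Defensive.

Import GRing.Theory.
Local Open Scope ring_scope.

(** The two factors of a bosonisation of [V] by [K] meet in two maps only.  The
    product moves an element of [V] to the right past an element of [K],
    [h t = ± t_(1) (h ◁ t_(2))], which is [act_twist]; the coproduct moves an
    element of [K] to the right past an element of [V],
    [a ⊗ b |-> ± b^(0) ⊗ a b^(1)], which is [coact_twist].  These two maps
    absorb every sign of the formulas.  The first is compatible with the two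
    products ([act_twist_mulK], [act_twist_mulV]), the second with the two
    coproducts ([coact_twist_copK], [coact_twist_copV]), and both with units and
    counits.  From these hexagons the associativity, the coassociativity and the
    antipode axioms follow by Sweedler computations in which no sign appears.
    The antipode is the composite of [coact_twist], the two antipodes and
    [act_twist].

    That the coproduct is multiplicative is the only place where the whole
    structure is used.  In the tensor square of the bosonisation the coproduct
    of [w ⊗ h] is the product of those of [w] and [h], so one has to multiply
    the coproducts of two elements of [V] and to move the coproduct of an
    element of [V] past that of an element of [K].  The coproduct of [h] is the
    coaction of [h_(1)] times [1 ⊗ h_(2)], and the two factors move one at a
    time: [1 ⊗ h] past a coaction by the braiding ([jV_braids_coact]), [1 ⊗ h]
    past a coproduct of [K] ([jV_passes_cop]), and a coaction past a coproduct
    of [K] ([coact_passes_cop]).  The last of these is the crossed module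
    condition, freed of the antipode in [right_mult_coact].

    Signs are handled by the operator [ksign p], which multiplies odd elements
    by [(-1)^p]: a factor [(-1)^(|x| |y|)] with [x] homogeneous of parity [p] is
    written by applying [ksign p] to [y].  As [ksign p] commutes with all even
    maps, the parities of Sweedler components never have to be named.

    The ordinary biproduct is the same construction on purely even spaces.  Its
    antipode is bijective because both twists are inverted by means of the
    inverse antipode of [A].

    The differential is an odd derivation because it is one for the twisted
    product ([diff_act_twist]).  The super-coderivation property compares two
    derivations along the coproduct, so it is enough to check it on the two
    factors.  Finally the bosonisation is an exterior algebra because its degree
    one part is [Omega^1(A) ⊗ B + A ⊗ Omega^1(B)], where [a (db) ⊗ c] is
    [a d(b ⊗ c) - a b d(1 ⊗ c)], while [a ⊗ b (dc)] is [(a ⊗ b) d(1 ⊗ c)]. *)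

(** * Linear and multilinear maps *)

Create HintDb lin.

Section Linearity.
Variable k : fieldType.
Implicit Types U V W X Y : lmodType k.

Lemma linear_0 V W (f : V -> W) : linear f -> f 0 = 0.
Proof. by move=> lf; have := lf (-1) 0 0; rewrite scaler0 addr0 scaleN1r addNr. Qed.

Lemma linear_D V W (f : V -> W) u v : linear f -> f (u + v) = f u + f v.
Proof. by move=> lf; have := lf 1 u v; rewrite !scale1r. Qed.

Lemma linear_Z V W (f : V -> W) a u : linear f -> f (a *: u) = a *: f u.
Proof. by move=> lf; have := lf a u 0; rewrite (linear_0 lf) !addr0. Qed.

Lemma linear_sumE V W (f : V -> W) (I : Type) (r : seq I) (P : pred I) F : linear f ->
  f (\sum_(i <- r | P i) F i) = \sum_(i <- r | P i) f (F i).
Proof.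
move=> lf; elim/big_rec2: _ => [|i y1 y2 _ <-]; first exact: linear_0.
exact: linear_D.
Qed.

Lemma linear_id V : linear (fun x : V => x). Proof. by []. Qed.

Lemma linear_cst0 V W : linear (fun _ : V => 0 : W).
Proof. by move=> a x y; rewrite scaler0 addr0. Qed.

Lemma linear_comp V W X (f : W -> X) (g : V -> W) :
  linear f -> linear g -> linear (fun x => f (g x)).
Proof. by move=> lf lg a x y; rewrite lg lf. Qed.

Lemma linear_scale V W (c : k) (f : V -> W) :
  linear f -> linear (fun x => c *: f x).
Proof. by move=> lf a x y; rewrite lf scalerDr !scalerA mulrC. Qed.

Lemma linear_scalel V W (f : V -> k^o) (w : W) :
  linear f -> linear (fun x => (f x : k) *: w).
Proof. by move=> lf a x y; rewrite lf scalerDl -scalerA. Qed.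

Lemma linear_mulr V (f : V -> k^o) (c : k) :
  linear f -> linear (fun x => ((f x : k) * c : k^o)).
Proof. by move=> lf a x y; rewrite lf mulrDl -[a *: _ in LHS]/(a * _) -mulrA. Qed.

Lemma linear_mull V (f : V -> k^o) (c : k) :
  linear f -> linear (fun x => (c * (f x : k) : k^o)).
Proof.
by move=> lf a x y; rewrite lf mulrDr -[a *: _ in LHS]/(a * _) mulrCA.
Qed.

Lemma linear_add V W (f g : V -> W) :
  linear f -> linear g -> linear (fun x => f x + g x).
Proof. by move=> lf lg a x y; rewrite lf lg scalerDr addrACA. Qed.

Lemma linear_bigsum V W (I : Type) (r : seq I) (P : pred I) (F : V -> I -> W) :
  (forall i, linear (F^~ i)) -> linear (fun x => \sum_(i <- r | P i) F x i).
Proof.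
move=> lF a x y; rewrite scaler_sumr -big_split; apply: eq_bigr => i _.
exact: lF.
Qed.

Lemma bilin_linear_l V W X U (m : V -> W -> U) (f : X -> V) w :
  bilin m -> linear f -> linear (fun x => m (f x) w).
Proof. by move=> [ml _] lf a x y; rewrite lf (ml w a). Qed.

Lemma bilin_linear_r V W X U (m : V -> W -> U) (f : X -> W) v :
  bilin m -> linear f -> linear (fun x => m v (f x)).
Proof. by move=> [_ mr] lf a x y; rewrite lf (mr v a). Qed.

Lemma bilinDl V W U (m : V -> W -> U) u v w :
  bilin m -> m (u + v) w = m u w + m v w.
Proof. by move=> bm; apply: (linear_D _ _ (bm.1 w)). Qed.

Lemma bilinDr V W U (m : V -> W -> U) v u w :
  bilin m -> m v (u + w) = m v u + m v w.
Proof. by move=> bm; apply: (linear_D _ _ (bm.2 v)). Qed.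

Lemma bilinZl V W U (m : V -> W -> U) a v w : bilin m -> m (a *: v) w = a *: m v w.
Proof. by move=> bm; apply: (linear_Z _ _ (bm.1 w)). Qed.

Lemma bilinZr V W U (m : V -> W -> U) v a w : bilin m -> m v (a *: w) = a *: m v w.
Proof. by move=> bm; apply: (linear_Z _ _ (bm.2 v)). Qed.

Lemma bilin0l V W U (m : V -> W -> U) w : bilin m -> m 0 w = 0.
Proof. by move=> bm; apply: (linear_0 (bm.1 w)). Qed.

Lemma linear_tlift V W X U (F : V -> W -> U) (f : X -> tensor V W) :
  bilin F -> linear f -> linear (fun x => tlift F (f x)).
Proof. by move=> bF lf a x y; rewrite lf (tlift_linear bF). Qed.

Lemma linear_tlift_param V W X U (F : X -> V -> W -> U) (t : tensor V W) :
  (forall v w, linear (fun x => F x v w)) -> linear (fun x => tlift (F x) t).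
Proof. by move=> lF; apply: linear_bigsum => i; apply: lF. Qed.

Definition trilin V W X U (F : V -> W -> X -> U) : Prop :=
  [/\ forall w x, linear (fun v => F v w x), forall v x, linear (fun w => F v w x)
    & forall v w, linear (fun x => F v w x)].

Lemma trilin_linear1 V W X U Y (F : V -> W -> X -> U) (f : Y -> V) w x :
  trilin F -> linear f -> linear (fun y => F (f y) w x).
Proof. by move=> [h _ _] lf a y z; rewrite lf h. Qed.

Lemma trilin_linear2 V W X U Y (F : V -> W -> X -> U) (f : Y -> W) v x :
  trilin F -> linear f -> linear (fun y => F v (f y) x).
Proof. by move=> [_ h _] lf a y z; rewrite lf h. Qed.

Lemma trilin_linear3 V W X U Y (F : V -> W -> X -> U) (f : Y -> X) v w :
  trilin F -> linear f -> linear (fun y => F v w (f y)).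
Proof. by move=> [_ _ h] lf a y z; rewrite lf h. Qed.

End Linearity.

#[local] Hint Extern 1 (GRing.linear_for _ (fun x => x)) => exact: linear_id : lin.
#[local] Hint Extern 1 (GRing.linear_for _ id) => exact: linear_id : lin.
#[local] Hint Extern 1 (GRing.linear_for _ (fun _ => 0)) => exact: linear_cst0 : lin.
#[local] Hint Extern 1 (bilin (@tens _ _ _)) => exact: tens_bilin : lin.

(** [lin] proves linearity and multilinearity of Sweedler expressions by recursion
    on their shape.  The database [lin] holds the structure maps known to be
    linear or bilinear; the other leaves come from the context. *)
Ltac linb := solve [assumption | auto with lin].

Ltac lin :=
  cbv beta;
  match goal with
  | |- bilin _ => first [linb | split; intro; lin]
  | |- trilin _ => first [linb | split; intros ? ?; lin]
  | |- forall _, _ => intro; lin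
  | |- _ => first [linb | linstep]
  end
with linstep :=
  match goal with
  | |- GRing.linear_for _ (tlift ?F) => apply: tlift_linear; lin
  | |- GRing.linear_for _ (fun x => tlift (fun v w => @?F x v w) ?t) =>
      apply: linear_tlift_param; lin
  | |- GRing.linear_for _ (fun x => tlift ?F (@?E x)) =>
      apply: linear_tlift; [lin | lin]
  | |- GRing.linear_for _ (fun x => tlift (@?F x) ?t) =>
      apply: (@linear_tlift_param _ _ _ _ _ F t); lin
  | |- GRing.linear_for _ (fun x => ?c *: @?E x) => apply: linear_scale; lin
  | |- GRing.linear_for _ (fun x => (@?E x) *: ?v) => apply: linear_scalel; lin
  | |- GRing.linear_for _ (fun x => @?E x + @?G x) => apply: linear_add; lin
  | |- GRing.linear_for _ (fun x => \sum_(i <- ?r | @?P i) (@?F x i)) =>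
      apply: linear_bigsum; lin
  | |- GRing.linear_for _ (fun x => @GRing.mul _ (@?E x) ?w) => apply: linear_mulr; lin
  | |- GRing.linear_for _ (fun x => @GRing.mul _ ?w (@?E x)) => apply: linear_mull; lin
  | |- GRing.linear_for _ (fun x => ?m (@?E x) ?w) =>
      apply: (@bilin_linear_l _ _ _ _ _ m E w); [linb | lin]
  | |- GRing.linear_for _ (fun x => ?m ?w (@?E x)) =>
      apply: (@bilin_linear_r _ _ _ _ _ m E w); [linb | lin]
  | |- GRing.linear_for _ (fun x => ?m (@?E x) ?w ?z) =>
      apply: (@trilin_linear1 _ _ _ _ _ _ m E w z); [linb | lin]
  | |- GRing.linear_for _ (fun x => ?m ?w (@?E x) ?z) =>
      apply: (@trilin_linear2 _ _ _ _ _ _ m E w z); [linb | lin]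
  | |- GRing.linear_for _ (fun x => ?m ?w ?z (@?E x)) =>
      apply: (@trilin_linear3 _ _ _ _ _ _ m E w z); [linb | lin]
  | |- GRing.linear_for _ (fun x => ?f (@?E x)) =>
      apply: (@linear_comp _ _ _ _ f E); [linb | lin]
  | |- GRing.linear_for _ ( *:%R ?c) => apply: (linear_scale c); lin
  | |- GRing.linear_for _ (?m ?w) =>
      apply: (@bilin_linear_r _ _ _ _ _ m id w); [linb | lin]
  | |- GRing.linear_for _ (?m ?w ?z) =>
      apply: (@trilin_linear3 _ _ _ _ _ _ m id w z); [linb | lin]
  end.

(** * Sweedler sums *)

Section TensorCalculus.
Variable k : fieldType.
Implicit Types U V W X Y : lmodType k.

(** Extension principles are stated for closed predicates rather than for pairs of
    linear maps, since they also serve to propagate homogeneity and to build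
    witnesses of existential statements. *)
Definition lin_closed V (P : V -> Prop) : Prop :=
  P 0 /\ forall c u v, P u -> P v -> P (c *: u + v).

Lemma lin_closed_eq V W (f g : V -> W) :
  linear f -> linear g -> lin_closed (fun v => f v = g v).
Proof.
move=> lf lg; split; first by rewrite (linear_0 lf) (linear_0 lg).
by move=> c u v hu hv; rewrite lf lg hu hv.
Qed.

Lemma lin_closed_comp V W (P : W -> Prop) (f : V -> W) :
  lin_closed P -> linear f -> lin_closed (fun v => P (f v)).
Proof.
move=> [P0 PD] lf; split; first by rewrite (linear_0 lf).
by move=> c u v hu hv; rewrite lf; apply: PD.
Qed.

Lemma lin_closedD V (P : V -> Prop) u v : lin_closed P -> P u -> P v -> P (u + v).
Proof. by move=> [_ PD] hu hv; rewrite -[u]scale1r; apply: PD. Qed.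

Lemma lin_closed_sum V (P : V -> Prop) (I : Type) (r : seq I) (Q : pred I) F :
  lin_closed P -> (forall i, Q i -> P (F i)) -> P (\sum_(i <- r | Q i) F i).
Proof.
by move=> cP h; elim/big_ind: _ => //; [case: cP | move=> x y; apply: lin_closedD].
Qed.

Lemma tensor_ind V W (P : tensor V W -> Prop) :
  lin_closed P -> (forall v w, P (v ⊗ w)) -> forall t, P t.
Proof.
by move=> cP h t; have [s ->] := tensor_sum t; apply: lin_closed_sum.
Qed.

Lemma tensor_ext V W U (f g : tensor V W -> U) : linear f -> linear g ->
  (forall v w, f (v ⊗ w) = g (v ⊗ w)) -> forall t, f t = g t.
Proof. by move=> lf lg; apply: tensor_ind; apply: lin_closed_eq. Qed.

Lemma eq_tlift V W U (F G : V -> W -> U) t :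
  (forall v w, F v w = G v w) -> tlift F t = tlift G t.
Proof. by move=> h; apply: eq_bigr => i _; apply: h. Qed.

Lemma tlift_eq0 V W U (F : V -> W -> U) t :
  (forall v w, F v w = 0) -> tlift F t = 0.
Proof. by move=> h; apply: big1 => i _; apply: h. Qed.

(** No linearity is involved: both sides are double sums over the chosen
    representatives of the two tensors. *)
Lemma tlift_exch V W X Y U (F : V -> W -> X -> Y -> U) s t :
  (Sw (v, w) <- s; Sw (x, y) <- t; F v w x y) =
  (Sw (x, y) <- t; Sw (v, w) <- s; F v w x y).
Proof. exact: exchange_big. Qed.

Lemma linear_tliftE V W U X (f : U -> X) (G : V -> W -> U) t : linear f ->
  f (tlift G t) = Sw (v, w) <- t; f (G v w).
Proof. by move=> lf; apply: linear_sumE. Qed.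

Lemma tlift_tlift V W X Y U (F : X -> Y -> U) (G : V -> W -> tensor X Y) t :
  bilin F -> tlift F (tlift G t) = Sw (v, w) <- t; tlift F (G v w).
Proof. by move=> bF; apply: linear_tliftE; lin. Qed.

Lemma tlift_id V W (t : tensor V W) : (Sw (v, w) <- t; v ⊗ w) = t.
Proof.
move: t; apply: tensor_ext => [||v w]; [lin | lin |].
by rewrite tliftE; last by lin.
Qed.

Lemma tensZl V W a (v : V) (w : W) : (a *: v) ⊗ w = a *: (v ⊗ w).
Proof. exact: (linear_Z a v ((tens_bilin V W).1 w)). Qed.

Lemma tensZr V W a (v : V) (w : W) : v ⊗ (a *: w) = a *: (v ⊗ w).
Proof. exact: (linear_Z a w ((tens_bilin V W).2 v)). Qed.

Lemma tensDl V W (u v : V) (w : W) : (u + v) ⊗ w = u ⊗ w + v ⊗ w.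
Proof. exact: (linear_D u v ((tens_bilin V W).1 w)). Qed.

Lemma tensDr V W (v : V) (u w : W) : v ⊗ (u + w) = v ⊗ u + v ⊗ w.
Proof. exact: (linear_D u w ((tens_bilin V W).2 v)). Qed.

Lemma tens0l V W (w : W) : (0 : V) ⊗ w = 0.
Proof. exact: (linear_0 ((tens_bilin V W).1 w)). Qed.

Lemma tens0r V W (v : V) : v ⊗ (0 : W) = 0.
Proof. exact: (linear_0 ((tens_bilin V W).2 v)). Qed.

Lemma tmapE V V' W W' (f : V -> V') (g : W -> W') v w :
  linear f -> linear g -> tmap f g (v ⊗ w) = f v ⊗ g w.
Proof. by move=> lf lg; rewrite /tmap tliftE //; lin. Qed.

Lemma linear_tmap V V' W W' (f : V -> V') (g : W -> W') :
  linear f -> linear g -> linear (tmap f g).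
Proof. by move=> lf lg; rewrite /tmap; lin. Qed.

Lemma tlift_tmap V V' W W' U (f : V -> V') (g : W -> W') (F : V' -> W' -> U) t :
  linear f -> linear g -> bilin F ->
  tlift F (tmap f g t) = Sw (v, w) <- t; F (f v) (g w).
Proof.
move=> lf lg bF; rewrite /tmap tlift_tlift //; apply: eq_tlift => v w.
by rewrite tliftE.
Qed.

Lemma tlift_add V W U (F G : V -> W -> U) t :
  (Sw (v, w) <- t; F v w + G v w) = tlift F t + tlift G t.
Proof. exact: big_split. Qed.

Lemma can_linear V W (f : V -> W) (g : W -> V) :
  linear f -> cancel f g -> cancel g f -> linear g.
Proof. by move=> lf fK gK a x y; apply: (can_inj fK); rewrite lf !gK. Qed.

Lemma bijective_tmap V V' W W' (f : V -> V') (g : W -> W') :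
  linear f -> linear g -> bijective f -> bijective g -> bijective (tmap f g).
Proof.
move=> lf lg [f' fK f'K] [g' gK g'K].
have lf' := can_linear lf fK f'K; have lg' := can_linear lg gK g'K.
have lt := linear_tmap lf lg; have lt' := linear_tmap lf' lg'.
by exists (tmap f' g'); apply: tensor_ext; try (by lin); move=> v w;
  rewrite !tmapE // ?fK ?gK ?f'K ?g'K.
Qed.

(** This turns an identity in a threefold tensor product, such as
    coassociativity, into a rule for trilinear Sweedler sums. *)
Lemma tensor3_lift V W X U (F : V -> W -> X -> U) : trilin F ->
  {Phi : tensor V (tensor W X) -> U | linear Phi &
     forall v w x, Phi (v ⊗ w ⊗ x) = F v w x}.
Proof.
move=> tF; exists (tlift (fun v t => tlift (F v) t)); first by lin.
move=> v w x; rewrite tliftE; last by lin.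
by rewrite tliftE //; lin.
Qed.

End TensorCalculus.
#[local] Hint Extern 1 (GRing.linear_for _ (tmap _ _)) => apply: linear_tmap : lin.

(** * Koszul signs *)

(** The Koszul sign picked up by [v] when it crosses something of parity [p].  It
    is locked because its body is a sum, which rewriting by distributivity would
    otherwise unfold. *)
HB.lock Definition ksign (k : fieldType) (V : superspace k) (p : bool) (v : V) : V :=
  part false v + (-1) ^+ p *: part true v.

Section SuperSpaces.
Variable k : fieldType.
Implicit Types U V W : superspace k.

Lemma linear_part V p : super_space V -> linear (@part k V p).
Proof. by case. Qed.

Lemma homog_part V p (v : V) : super_space V -> homog p (part p v).
Proof. by case=> _ ppV _; rewrite /homog ppV eqxx. Qed.

Lemma part_homog V p q (v : V) :
  super_space V -> homog q v -> part p v = if p == q then v else 0.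
Proof. by case=> _ ppV _ hv; rewrite -hv ppV. Qed.

Lemma super_split V (v : V) : super_space V -> v = part false v + part true v.
Proof. by case. Qed.

Lemma linear_ksign V p : super_space V -> linear (@ksign k V p).
Proof.
move=> sV; rewrite ksign.unlock; apply: linear_add; first exact: linear_part.
by apply: linear_scale; apply: linear_part.
Qed.

Lemma lin_closed_homog V p : super_space V -> lin_closed (@homog k V p).
Proof. by move=> sV; apply: lin_closed_eq; [apply: linear_part|]. Qed.

Lemma homogD V p (u v : V) :
  super_space V -> homog p u -> homog p v -> homog p (u + v).
Proof.
move=> sV hu hv; rewrite -[u]scale1r.
by case: (lin_closed_homog p sV) => _; apply.
Qed.

Lemma homogZ V p c (v : V) : super_space V -> homog p v -> homog p (c *: v).
Proof.
move=> sV hv; rewrite -[_ *: _]addr0.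
by case: (lin_closed_homog p sV) => h0 h; apply: h.
Qed.

Lemma super_ind V (P : V -> Prop) : super_space V -> lin_closed P ->
  (forall p v, homog p v -> P v) -> forall v, P v.
Proof.
move=> sV [P0 PD] h v; rewrite (super_split v sV) -[part false v]scale1r.
by apply: PD; apply: h; apply: homog_part.
Qed.

Lemma ksign_homog V p q (v : V) :
  super_space V -> homog q v -> ksign p v = (-1) ^+ (p * q) *: v.
Proof.
move=> sV hv; rewrite ksign.unlock !(part_homog _ sV hv).
by case: q hv => hv /=; rewrite ?muln1 ?muln0 ?scaler0 ?addr0 ?add0r ?scale1r.
Qed.

Lemma homog_ksign V p q (v : V) : super_space V -> homog q v -> homog q (ksign p v).
Proof. by move=> sV hv; rewrite (ksign_homog _ sV hv); apply: homogZ. Qed.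

Lemma ksign0 V (v : V) : super_space V -> ksign false v = v.
Proof. by move=> sV; rewrite ksign.unlock scale1r -super_split. Qed.

Lemma ksignK V p q (v : V) : super_space V ->
  ksign p (ksign q v) = ksign (p (+) q) v.
Proof.
move=> sV; have lk r := linear_ksign r sV.
move: v; apply: (super_ind sV); first by apply: lin_closed_eq => //; apply: linear_comp.
move=> r v hv; rewrite !(ksign_homog _ sV (homog_ksign _ sV hv)) !(ksign_homog _ sV hv).
rewrite scalerA -exprD.
by case: p; case: q; case: r {hv}; rewrite //= ?expr0 ?expr1 // exprS expr1 mulrNN mulr1.
Qed.

(** An even map commutes with the projections on the two parts.  There is no
    converse: [ksign] is the identity in characteristic two. *)
Lemma super_map_ksign V W (f : V -> W) p v : super_space V -> super_space W ->
  super_map f -> f (ksign p v) = ksign p (f v).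
Proof.
move=> sV sW [lf hf]; rewrite ksign.unlock.
have fP q u : f (part q u) = part q (f u).
  rewrite {2}(super_split u sV) (linear_D _ _ lf) (linear_D _ _ (linear_part q sW)).
  have hq r := part_homog q sW (hf _ _ (homog_part r u sV)).
  by rewrite !hq; case: q {hq}; rewrite /= ?add0r ?addr0.
by rewrite (linear_D _ _ lf) (linear_Z _ _ lf) !fP.
Qed.

Lemma super_bimap_ksign U V W (m : U -> V -> W) p u v :
  super_space U -> super_space V -> super_space W -> super_bimap m ->
  m (ksign p u) (ksign p v) = ksign p (m u v).
Proof.
move=> sU sV sW [bm hm].
have lU := linear_ksign p sU; have lV := linear_ksign p sV.
have lW := linear_ksign p sW.
move: u; apply: (super_ind sU); first by apply: lin_closed_eq; lin.
move=> q u hu; move: v; apply: (super_ind sV); first by apply: lin_closed_eq; lin.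
move=> r v hv.
rewrite (ksign_homog _ sU hu) (ksign_homog _ sV hv).
rewrite (ksign_homog _ sW (hm _ _ _ _ hu hv)).
rewrite (linear_Z _ _ (bm.1 _)) (linear_Z _ _ (bm.2 _)) scalerA -exprD.
by case: p {lU lV lW}; case: q {hu}; case: r {hv};
  rewrite //= expr0 exprS expr1 mulrNN mulr1.
Qed.

End SuperSpaces.

#[local] Hint Extern 1 (GRing.linear_for _ (part _)) => apply: linear_part : lin.
#[local] Hint Extern 1 (GRing.linear_for _ (ksign _)) => apply: linear_ksign : lin.

(** * Tensor products of super spaces *)

Section SuperTensor.
Variable k : fieldType.
Implicit Types U V W : superspace k.

Lemma linear_stensor_part V W p : super_space V -> super_space W ->
  linear (@part k (stensor V W) p).
Proof. by move=> sV sW /=; lin. Qed.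

Lemma stensor_part_homog V W p q r (v : V) (w : W) : super_space V -> super_space W ->
  homog q v -> homog r w ->
  @part k (stensor V W) p (v ⊗ w) = if p == q (+) r then v ⊗ w else 0.
Proof.
move=> sV sW hv hw /=; rewrite tliftE; last by lin.
rewrite big_bool /= !(part_homog _ sV hv) !(part_homog _ sW hw).
by case: p; case: q {hv}; case: r {hw}; rewrite /= ?tens0l ?tens0r ?addr0 ?add0r.
Qed.

Lemma stensor_ind V W (P : tensor V W -> Prop) :
  super_space V -> super_space W -> lin_closed P ->
  (forall p q v w, homog p v -> homog q w -> P (v ⊗ w)) -> forall t, P t.
Proof.
move=> sV sW cP h; apply: tensor_ind => // v w.
rewrite (super_split v sV) (super_split w sW) !tensDl !tensDr.
by do !apply: lin_closedD => //; apply: h; apply: homog_part.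
Qed.

Lemma super_space_stensor V W :
  super_space V -> super_space W -> super_space (stensor V W).
Proof.
move=> sV sW; have lp p := linear_stensor_part p sV sW; split; [exact: lp | move=> p q | ].
  apply: (stensor_ind sV sW).
    apply: lin_closed_eq; first exact: linear_comp.
    by case: (p == q); [exact: lp | exact: linear_cst0].
  move=> r s v w hv hw; rewrite !(stensor_part_homog _ sV sW hv hw).
  case: (q =P _) => [->|_]; first by rewrite (stensor_part_homog _ sV sW hv hw).
  by rewrite (linear_0 (lp p)); case: ifP.
apply: (stensor_ind sV sW).
  by apply: lin_closed_eq; [exact: linear_id | apply: linear_add].
move=> r s v w hv hw; rewrite !(stensor_part_homog _ sV sW hv hw).
by case: (r (+) s); rewrite ?addr0 ?add0r.
Qed.

Lemma homog_tens V W p q (v : V) (w : W) : super_space V -> super_space W ->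
  homog p v -> homog q w -> @homog k (stensor V W) (p (+) q) (v ⊗ w).
Proof.
by move=> sV sW hv hw; rewrite /homog (stensor_part_homog _ sV sW hv hw) eqxx.
Qed.

Lemma homog_stensor_ind V W r (P : tensor V W -> Prop) :
  super_space V -> super_space W -> lin_closed P ->
  (forall p q v w, homog p v -> homog q w -> p (+) q = r -> P (v ⊗ w)) ->
  forall t : tensor V W, @homog k (stensor V W) r t -> P t.
Proof.
move=> sV sW cP h t <- /=; apply: lin_closed_sum => // i _.
apply: lin_closed_sum => // q _; apply: (h q (r (+) q)); try exact: homog_part.
by rewrite addbC addbK.
Qed.

Lemma homog_tlift V W U r s (F : V -> W -> U) (t : tensor V W) :
  super_space V -> super_space W -> super_space U -> bilin F ->
  @homog k (stensor V W) r t ->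
  (forall p q v w, homog p v -> homog q w -> p (+) q = r -> homog s (F v w)) ->
  homog s (tlift F t).
Proof.
move=> sV sW sU bF ht h.
apply: (homog_stensor_ind (P := fun t => homog s (tlift F t)) sV sW _ _ ht).
  by apply: lin_closed_eq; lin.
by move=> p q v w hv hw pq; rewrite tliftE //; apply: h pq.
Qed.

Lemma ksign_tens V W p (v : V) (w : W) : super_space V -> super_space W ->
  @ksign k (stensor V W) p (v ⊗ w) = ksign p v ⊗ ksign p w.
Proof.
move=> sV sW; have bt : super_bimap (@tens k V W : V -> W -> stensor V W).
  by split; [exact: tens_bilin | move=> *; exact: homog_tens].
by rewrite -(super_bimap_ksign _ _ _ _ _ _ bt) //; apply: super_space_stensor.
Qed.

Lemma super_map_tmap V V' W W' (f : V -> V') (g : W -> W') :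
  super_space V -> super_space V' -> super_space W -> super_space W' ->
  super_map f -> super_map g ->
  super_map (tmap f g : stensor V W -> stensor V' W').
Proof.
move=> sV sV' sW sW' [lf hf] [lg hg]; split=> [|p t ht]; first exact: linear_tmap.
apply: (@homog_tlift V W (stensor V' W') p p _ _ sV sW _ _ ht).
- exact: super_space_stensor.
- by lin.
- by move=> q r v w hv hw <-; apply: homog_tens => //; [apply: hf | apply: hg].
Qed.

End SuperTensor.
#[local] Hint Extern 1 (super_space (stensor _ _)) => apply: super_space_stensor : lin.

(** * Tensor products of super algebras and odd derivations *)

Section SuperAlgebras.
Variable k : fieldType.
Implicit Types U V W : superspace k.

Lemma super_algebra_space V (aV : alg V) : super_algebra aV -> super_space V.
Proof. by case. Qed.

Lemma super_algebra_bilin V (aV : alg V) : super_algebra aV -> bilin (mul aV).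
Proof. by case=> _ []. Qed.

Lemma ksign_mul V (aV : alg V) p u v : super_algebra aV ->
  ksign p (mul aV u v) = mul aV (ksign p u) (ksign p v).
Proof. by case=> sV bV _ _ _; rewrite -super_bimap_ksign. Qed.

Lemma ksign_one V (aV : alg V) p : super_algebra aV ->
  ksign p (one aV) = one aV :> V.
Proof. by case=> sV _ h1 _ _; rewrite (ksign_homog _ sV h1) muln0 scale1r. Qed.

Section TensorAlgebra.
Variables (V W : superspace k) (aV : alg V) (aW : alg W).
Hypotheses (hV : super_algebra aV) (hW : super_algebra aW).
Let sV := super_algebra_space hV.
Let sW := super_algebra_space hW.
Let bV := super_algebra_bilin hV.
Let bW := super_algebra_bilin hW.

Lemma bilin_stensor_mul : bilin (mul (stensor_alg aV aW)).
Proof. by split=> x /=; rewrite /stlift; lin. Qed.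
Let bVW := bilin_stensor_mul.

(** Only [b] crosses another factor, hence only its parity has to be known. *)
Lemma stensor_mulE q a b c d : homog q b ->
  mul (stensor_alg aV aW) (a ⊗ b) (c ⊗ d) = mul aV a (ksign q c) ⊗ mul aW b d.
Proof.
move=> hb.
move: a; apply: (super_ind sV); first by apply: lin_closed_eq; lin.
move=> p a ha; move: c; apply: (super_ind sV); first by apply: lin_closed_eq; lin.
move=> r c hc; move: d; apply: (super_ind sW); first by apply: lin_closed_eq; lin.
move=> s d hd /=; rewrite (stliftE sV sW _ ha hb); last first.
  by split=> x; rewrite /stlift; lin.
rewrite (stliftE sV sW _ hc hd); last by split=> x; lin.
by rewrite (ksign_homog _ sV hc) (linear_Z _ _ (bV.2 _)) tensZl.
Qed.

Lemma stensor_mul_tlift q a b t : homog q b ->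
  mul (stensor_alg aV aW) (a ⊗ b) t =
  Sw (c, d) <- t; mul aV a (ksign q c) ⊗ mul aW b d.
Proof.
move=> hb; move: t; apply: tensor_ext; [lin | lin | move=> c d].
by rewrite (stensor_mulE _ _ _ hb) tliftE //; lin.
Qed.

Lemma stensor_mul_onel a c d :
  mul (stensor_alg aV aW) (a ⊗ one aW) (c ⊗ d) = mul aV a c ⊗ d.
Proof.
by case: hW => _ _ h1 _ [l1 _]; rewrite (stensor_mulE _ _ _ h1) ksign0 // l1.
Qed.

Lemma stensor_mul_oner a b d :
  mul (stensor_alg aV aW) (a ⊗ b) (one aV ⊗ d) = a ⊗ mul aW b d.
Proof.
move: b; apply: (super_ind sW) => [|q b hb]; first by apply: lin_closed_eq; lin.
by rewrite (stensor_mulE _ _ _ hb) ksign_one //; case: hV => _ _ _ _ [_ ->].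
Qed.

Lemma stensor_alg_super : super_algebra (stensor_alg aV aW).
Proof.
have [_ [_ mhV] h1V asV [l1V r1V]] := hV; have [_ [_ mhW] h1W asW [l1W r1W]] := hW.
have s1 q : ksign q (one aV) = one aV by apply: ksign_one.
have sVW := super_space_stensor sV sW; split=> //.
- split=> // p q s t hs ht.
  move: s hs; apply: homog_stensor_ind => //.
    by apply: lin_closed_eq; lin.
  move=> p1 p2 a b ha hb <-; move: t ht; apply: homog_stensor_ind => //.
    by apply: lin_closed_eq; lin.
  move=> q1 q2 c d hc hd <-; rewrite (stensor_mulE _ _ _ hb) addbACA.
  by apply: homog_tens => //; [apply: mhV | apply: mhW] => //; apply: homog_ksign.
- by rewrite -[false]/(false (+) false); apply: homog_tens.
- move=> s t u.
  move: s; apply: (stensor_ind sV sW); first by apply: lin_closed_eq; lin.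
  move=> _ p a b _ hb.
  move: t; apply: (stensor_ind sV sW); first by apply: lin_closed_eq; lin.
  move=> _ q c d _ hd.
  move: u; apply: (stensor_ind sV sW); first by apply: lin_closed_eq; lin.
  move=> _ _ e f _ _.
  rewrite (stensor_mulE _ _ _ hd) !(stensor_mulE _ _ _ hb).
  rewrite (stensor_mulE _ _ _ (mhW _ _ _ _ hb hd)).
  by rewrite ksign_mul // ksignK // asV asW.
- split; apply: (stensor_ind sV sW); try by apply: lin_closed_eq; lin.
    by move=> p q v w hv hw; rewrite (stensor_mulE _ _ _ h1W) ksign0 // l1V l1W.
  by move=> p q v w hv hw; rewrite (stensor_mulE _ _ _ hw) s1 r1V r1W.
Qed.

End TensorAlgebra.

Lemma alg_map_tmap V V' W W' (aV : alg V) (aV' : alg V') (aW : alg W) (aW' : alg W')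
    (f : V -> V') (g : W -> W') :
  super_algebra aV -> super_algebra aV' -> super_algebra aW -> super_algebra aW' ->
  super_map f -> super_map g -> alg_map aV aV' f -> alg_map aW aW' g ->
  alg_map (stensor_alg aV aW) (stensor_alg aV' aW') (tmap f g).
Proof.
move=> hV hV' hW hW' sf sg [fM f1] [gM g1]; have [lf hf] := sf; have [lg hg] := sg.
have sV := super_algebra_space hV; have sW := super_algebra_space hW.
have sV' := super_algebra_space hV'.
have bVW := bilin_stensor_mul hV hW; have bVW' := bilin_stensor_mul hV' hW'.
split; last by rewrite tmapE // f1 g1.
move=> s t; move: s; apply: (stensor_ind sV sW); first by apply: lin_closed_eq; lin.
move=> _ q a b _ hb; move: t; apply: tensor_ext; [lin | lin | move=> c d].
rewrite (stensor_mulE hV hW _ _ _ hb) !tmapE // (stensor_mulE hV' hW' _ _ _ (hg _ _ hb)).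
by rewrite fM gM (super_map_ksign _ _ sV sV' sf).
Qed.

Definition odd_map V (d : V -> V) : Prop :=
  linear d /\ forall p v, homog p v -> homog (~~ p) (d v).

Definition odd_derivation V (aV : alg V) (d : V -> V) : Prop :=
  odd_map d /\ forall v w, d (mul aV v w) = mul aV (d v) w + mul aV (ksign true v) (d w).

(** An odd map commutes with [ksign p] up to the sign of crossing [p]. *)
Lemma odd_map_ksign V (d : V -> V) p v : super_space V -> odd_map d ->
  ksign p (d v) = (-1) ^+ p *: d (ksign p v).
Proof.
move=> sV [ld hd]; move: v; apply: (super_ind sV); first by apply: lin_closed_eq; lin.
move=> q v hv; rewrite (ksign_homog _ sV hv) (ksign_homog _ sV (hd _ _ hv)).
rewrite (linear_Z _ _ ld) scalerA -exprD.
by case: p; case: q {hv}; rewrite //= expr0 exprS expr1 mulrNN mulr1.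
Qed.

Section TensorDifferential.
Variables (V W : graded k) (dV : V -> V) (dW : W -> W).
Hypotheses (sV : super_space V) (sW : super_space W).
Hypotheses (oV : odd_map dV) (oW : odd_map dW).
Let lV := oV.1.
Let lW := oW.1.

Lemma tdiffE v w : tdiff dV dW (v ⊗ w) = dV v ⊗ w + ksign true v ⊗ dW w.
Proof.
move: v; apply: (super_ind sV).
  by apply: lin_closed_eq; rewrite /tdiff /stlift; lin.
move=> p v hv; move: w; apply: (super_ind sW).
  by apply: lin_closed_eq; rewrite /tdiff /stlift; lin.
move=> q w hw; rewrite /tdiff (stliftE sV sW _ hv hw); last by split=> x; lin.
by rewrite (ksign_homog _ sV hv) mul1n tensZl.
Qed.

Lemma linear_tdiff : linear (tdiff dV dW).
Proof. by rewrite /tdiff /stlift; lin. Qed.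

Lemma tdiff_tlift t :
  tdiff dV dW t = Sw (v, w) <- t; dV v ⊗ w + ksign true v ⊗ dW w.
Proof.
move: t; apply: tensor_ext; [exact: linear_tdiff | lin | move=> v w].
by rewrite tdiffE tliftE //; lin.
Qed.

Lemma odd_map_tdiff : odd_map (tdiff dV dW : stensor V W -> stensor V W).
Proof.
split=> [|p t ht]; first exact: linear_tdiff.
have sVW := super_space_stensor sV sW.
rewrite tdiff_tlift; apply: (homog_tlift (U := stensor V W) sV sW _ _ ht) => //.
  by lin.
move=> q r v w hv hw <-; apply: homogD => //.
  by rewrite -addNb; apply: homog_tens => //; apply: oV.2.
by rewrite -addbN; apply: homog_tens => //; [apply: homog_ksign | apply: oW.2].
Qed.

Lemma tdiff_tdiff :
  (forall v, dV (dV v) = 0) -> (forall w, dW (dW w) = 0) ->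
  forall t, tdiff dV dW (tdiff dV dW t) = 0.
Proof.
move=> dV0 dW0; have lt := linear_tdiff.
apply: tensor_ext; [exact: linear_comp | exact: linear_cst0 | move=> v w].
rewrite tdiffE (linear_D _ _ lt) !tdiffE dV0 dW0 tens0l tens0r add0r addr0.
by rewrite odd_map_ksign // tensZl expr1 scaleN1r addNr.
Qed.

End TensorDifferential.

Lemma odd_derivation_tdiff (V W : graded k) (aV : alg V) (aW : alg W) dV dW :
  super_algebra aV -> super_algebra aW ->
  odd_derivation aV dV -> odd_derivation aW dW ->
  @odd_derivation (stensor V W) (stensor_alg aV aW) (tdiff dV dW).
Proof.
move=> hV hW [oV DV] [oW DW].
have sV := super_algebra_space hV; have sW := super_algebra_space hW.
have bV := super_algebra_bilin hV; have bW := super_algebra_bilin hW.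
have bVW := bilin_stensor_mul hV hW; have [lV hdV] := oV; have [lW hdW] := oW.
have lt := linear_tdiff sV sW oV oW; split; first exact: odd_map_tdiff.
have lk := linear_ksign true (super_space_stensor sV sW).
move=> s t; move: s; apply: (stensor_ind sV sW); first by apply: lin_closed_eq; lin.
move=> _ q a b _ hb; move: t; apply: tensor_ext; [lin | lin | move=> c d].
rewrite (stensor_mulE hV hW _ _ _ hb) !tdiffE // ksign_tens //.
rewrite !(bilinDr _ _ _ bVW) !(bilinDl _ _ _ bVW).
rewrite !(stensor_mulE hV hW _ _ _ hb) !(stensor_mulE hV hW _ _ _ (hdW _ _ hb)).
rewrite !(stensor_mulE hV hW _ _ _ (homog_ksign true sW hb)).
rewrite DV DW !tensDl !tensDr ksign_mul //.
rewrite (ksign_homog true sW hb) (odd_map_ksign q c sV oV).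
rewrite !ksignK // mul1n !(bilinZl _ _ _ bW) !(bilinZr _ _ _ bV).
rewrite !tensZl !tensZr !scalerA -exprD addTb addbT.
have -> : (-1) ^+ (q + q)%N = 1 :> k by rewrite addnn -signr_odd odd_double.
by rewrite scale1r addrACA.
Qed.

End SuperAlgebras.
#[local] Hint Extern 1 (bilin (mul (stensor_alg _ _))) => apply: bilin_stensor_mul : lin.

(** * Sweedler sums with signs *)

(** Rewriting below binders: [lsw n tac] and [rsw n tac] run [tac] under the [n]
    outermost Sweedler sums of the left and of the right hand side. *)
Ltac into_sw := apply: eq_tlift; intros ? ?; cbv beta.
Tactic Notation "lsw" integer(n) tactic3(tac) :=
  etransitivity; [do n into_sw; tac; reflexivity | cbv beta].
Tactic Notation "rsw" integer(n) tactic3(tac) :=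
  symmetry; etransitivity; [do n into_sw; tac; reflexivity | cbv beta]; symmetry.

Section SweedlerRules.
Variable k : fieldType.

Section Signs.
Variables (V W : superspace k) (U : lmodType k).
Hypotheses (sV : super_space V) (sW : super_space W).

Lemma stlift_tlift (F : V -> W -> U) t : bilin F ->
  (SSw (x : _, y : _) <- t; F x y) = tlift F t.
Proof.
move=> bF; move: t; apply: (stensor_ind sV sW).
  by apply: lin_closed_eq; rewrite /stlift; lin.
by move=> p q v w hv hw; rewrite (stliftE sV sW _ hv hw) // tliftE.
Qed.

(** The bridge between the two ways to write signs: a sum over homogeneous
    components with an explicit sign is a plain sum with [ksign]. *)
Lemma stlift_ksignl (p : bool) (F : V -> W -> U) t : bilin F ->
  (SSw (x : q, y : _) <- t; (-1) ^+ (p * q) *: F x y) =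
  (Sw (x, y) <- t; F (ksign p x) y).
Proof.
move=> bF; move: t; apply: (stensor_ind sV sW).
  by apply: lin_closed_eq; rewrite /stlift; lin.
move=> q r v w hv hw; rewrite (stliftE sV sW _ hv hw); last by lin.
by rewrite tliftE; [rewrite (ksign_homog _ sV hv) bilinZl | lin].
Qed.

Lemma tlift_ksign p (F : V -> W -> U) t : bilin F ->
  tlift F (@ksign k (stensor V W) p t) = Sw (x, y) <- t; F (ksign p x) (ksign p y).
Proof.
move=> bF; have ls := linear_ksign p (super_space_stensor sV sW).
move: t; apply: tensor_ext; [lin | lin | move=> v w].
by rewrite ksign_tens // !tliftE //; lin.
Qed.

End Signs.

Lemma super_form_ksign (V : superspace k) (e : V -> k) p v :
  super_space V -> super_map (e : V -> superk k) -> e (ksign p v) = e v.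
Proof.
move=> sV [le he]; move: v; apply: (super_ind sV).
  apply: (lin_closed_eq (W := k^o)) => //.
  exact: (linear_comp (X := k^o) le (linear_ksign p sV)).
move=> q v hv; rewrite (ksign_homog _ sV hv) (linear_Z (W := k^o) _ _ le).
have := he _ _ hv; rewrite /homog /=; case: q {hv} => [<-|_]; first by rewrite scaler0.
by rewrite muln0 scale1r.
Qed.

Lemma sw_coassoc (V : superspace k) (H : hopf V) (U : lmodType k) (F : V -> V -> V -> U) v :
  super_coalgebra H -> trilin F ->
  (Sw (x, y) <- cop H v; Sw (x1, x2) <- cop H x; F x1 x2 y) =
  (Sw (x, y) <- cop H v; Sw (y1, y2) <- cop H y; F x y1 y2).
Proof.
case=> _ _ coas _ _ tF; have [Phi lPhi PhiE] := tensor3_lift tF.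
have := congr1 Phi (coas v); rewrite !linear_tliftE // => e.
lsw 2 (rewrite -PhiE); lsw 1 (rewrite -linear_tliftE //); rewrite e.
by apply: eq_tlift => x y; rewrite linear_tliftE //; apply: eq_tlift => *; rewrite PhiE.
Qed.

End SweedlerRules.

(** * The two twists of a bosonisation *)

Section Twists.
Variables (k : fieldType) (K V : superspace k) (HK : hopf K) (cV : crossed V K).

(** The map [h ⊗ t |-> (-1)^(|h| |t_(1)|) t_(1) ⊗ (h ◁ t_(2))]; the sum over [p]
    splits [h] into its homogeneous parts. *)
Definition act_twist (h : V) (t : K) : tensor K V :=
  \sum_(p : bool) Sw (t1, t2) <- cop HK t; ksign p t1 ⊗ act cV (part p h) t2.

(** The map [a ⊗ b |-> (-1)^(|a| |b^(0)|) b^(0) ⊗ a b^(1)]. *)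
Definition coact_twist (a : K) (b : V) : tensor V K :=
  \sum_(p : bool) Sw (b0, b1) <- coact cV b; ksign p b0 ⊗ mul HK (part p a) b1.

End Twists.

(** Sweedler form of [S(ab) = ± S(b) S(a)] for the products in the bosonisation,
    where [S(b) = S(b^(0)) S(b^(1))]. *)
Definition bosonisation_antipode (k : fieldType) (K V : superspace k)
    (HK : hopf K) (HV : hopf V) (cV : crossed V K) (x : tensor K V) : tensor K V :=
  Sw (a, b) <- x; Sw (b', a') <- coact_twist HK cV a b;
  act_twist HK cV (ant HV b') (ant HK a').

Section Bosonisation.
Variables (k : fieldType) (K V : superspace k).
Variables (HK : hopf K) (HV : hopf V) (cV : crossed V K).
Hypotheses (hK : super_hopf HK) (hV : braided_hopf HK HV cV).

Local Notation mK := (mul HK).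
Local Notation mV := (mul HV).
Local Notation "h ◁ t" := (act cV h t) (at level 34, right associativity).
Local Notation R := (act_twist HK cV).
Local Notation T := (coact_twist HK cV).

Lemma algK : super_algebra HK. Proof. by case: hK. Qed.
Lemma coalgK : super_coalgebra HK. Proof. by case: hK. Qed.
Lemma algV : super_algebra HV. Proof. by case: hV => -[]. Qed.
Lemma coalgV : super_coalgebra HV. Proof. by case: hV. Qed.
Lemma modV : crossed_module HK cV. Proof. by case: hV => -[]. Qed.
Let sK := super_algebra_space algK.
Let sV := super_algebra_space algV.
Let bmK := super_algebra_bilin algK.
Let bmV := super_algebra_bilin algV.
#[local] Hint Extern 1 (bilin (mul _)) => first [exact: bmK | exact: bmV] : lin.

Let sactV : super_bimap (act cV : V -> K -> V). Proof. by case: modV => _ []. Qed.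
Let bact : bilin (act cV). Proof. by case: sactV. Qed.
#[local] Hint Extern 1 (bilin (act _)) => exact: bact : lin.
Let actM v a b : (v ◁ a) ◁ b = v ◁ mK a b. Proof. by case: modV => _ []. Qed.
Let act1 v : v ◁ one HK = v. Proof. by case: modV => _ []. Qed.
Let scoact : super_map (coact cV : V -> stensor V K). Proof. by case: modV => _ _ []. Qed.
Let lcoact : linear (coact cV). Proof. by case: scoact. Qed.
Let scopK : super_map (cop HK : K -> stensor K K). Proof. by case: coalgK. Qed.
Let lcopK : linear (cop HK). Proof. by case: scopK. Qed.
Let scopV : super_map (cop HV : V -> stensor V V). Proof. by case: coalgV. Qed.
Let lcopV : linear (cop HV). Proof. by case: scopV. Qed.
#[local] Hint Extern 1 (GRing.linear_for _ (cop _)) =>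
  first [exact: lcopK | exact: lcopV] : lin.
#[local] Hint Extern 1 (GRing.linear_for _ (coact _)) => exact: lcoact : lin.
Let sepsK : super_map (eps HK : K -> superk k). Proof. by case: coalgK. Qed.
Let lepsK : linear (eps HK : K -> k^o). Proof. by case: sepsK. Qed.
Let sepsV : super_map (eps HV : V -> superk k). Proof. by case: coalgV. Qed.
Let lepsV : linear (eps HV : V -> k^o). Proof. by case: sepsV. Qed.
#[local] Hint Extern 1 (GRing.linear_for _ (eps _)) =>
  first [exact: lepsK | exact: lepsV] : lin.
Let mKA : associative mK. Proof. by case: algK. Qed.
Let mVA : associative mV. Proof. by case: algV. Qed.
Let mK1 : right_id (one HK) mK. Proof. by case: algK => _ _ _ _ []. Qed.
Let m1K : left_id (one HK) mK. Proof. by case: algK => _ _ _ _ []. Qed.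
Let mV1 : right_id (one HV) mV. Proof. by case: algV => _ _ _ _ []. Qed.
Let m1V : left_id (one HV) mV. Proof. by case: algV => _ _ _ _ []. Qed.

Let act_mul q h g a : homog q g ->
  mV h g ◁ a = Sw (a1, a2) <- cop HK a; mV (h ◁ ksign q a1) (g ◁ a2).
Proof.
case: hV => -[_ _ am _ _] _ _ _ _ hg; rewrite (am q) // stlift_ksignl //.
by lin.
Qed.

Let tlift_cop_ksign (U : lmodType k) q (F : K -> K -> U) t : bilin F ->
  tlift F (cop HK (ksign q t)) = Sw (x, y) <- cop HK t; F (ksign q x) (ksign q y).
Proof.
move=> bF; rewrite (super_map_ksign _ _ sK _ scopK); last exact: super_space_stensor.
exact: tlift_ksign.
Qed.

Let tlift_copV_ksign (U : lmodType k) q (F : V -> V -> U) t : bilin F ->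
  tlift F (cop HV (ksign q t)) = Sw (x, y) <- cop HV t; F (ksign q x) (ksign q y).
Proof.
move=> bF; rewrite (super_map_ksign _ _ sV _ scopV); last exact: super_space_stensor.
exact: tlift_ksign.
Qed.

Let tlift_coact_ksign (U : lmodType k) q (F : V -> K -> U) t : bilin F ->
  tlift F (coact cV (ksign q t)) = Sw (x, y) <- coact cV t; F (ksign q x) (ksign q y).
Proof.
move=> bF; rewrite (super_map_ksign _ _ sV _ scoact); last exact: super_space_stensor.
exact: tlift_ksign.
Qed.

Lemma sw_coact (U : lmodType k) (F : V -> K -> K -> U) v : trilin F ->
  (Sw (v0, v1) <- coact cV v; Sw (v00, v01) <- coact cV v0; F v00 v01 v1) =
  (Sw (v0, v1) <- coact cV v; Sw (x, y) <- cop HK v1; F v0 x y).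
Proof.
case: modV => _ _ [_ coas _] _ tF; have [Phi lPhi PhiE] := tensor3_lift tF.
have := congr1 Phi (coas v); rewrite !linear_tliftE // => e.
lsw 2 (rewrite -PhiE); lsw 1 (rewrite -linear_tliftE //); rewrite e.
by apply: eq_tlift => x y; rewrite linear_tliftE //; apply: eq_tlift => *; rewrite PhiE.
Qed.

Lemma act_twistE p h t : homog p h ->
  R h t = Sw (t1, t2) <- cop HK t; ksign p t1 ⊗ h ◁ t2.
Proof.
move=> hh; rewrite /act_twist (bigD1 p) //= big1 ?addr0 => [|q nq].
  by rewrite hh.
rewrite (part_homog q sV hh) (negbTE nq).
by apply: tlift_eq0 => x y; rewrite bilin0l // tens0r.
Qed.

Lemma coact_twistE p a b : homog p a ->
  T a b = Sw (b0, b1) <- coact cV b; ksign p b0 ⊗ mK a b1.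
Proof.
move=> ha; rewrite /coact_twist (bigD1 p) //= big1 ?addr0 => [|q nq].
  by rewrite ha.
rewrite (part_homog q sK ha) (negbTE nq).
by apply: tlift_eq0 => x y; rewrite bilin0l // tens0r.
Qed.

Lemma bilin_act_twist : bilin R.
Proof. by rewrite /act_twist; lin. Qed.

Lemma bilin_coact_twist : bilin T.
Proof. by rewrite /coact_twist; lin. Qed.
#[local] Hint Extern 1 (bilin (act_twist _ _)) => exact: bilin_act_twist : lin.
#[local] Hint Extern 1 (bilin (coact_twist _ _)) => exact: bilin_coact_twist : lin.

Lemma super_bimap_act_twist : super_bimap (R : V -> K -> stensor K V).
Proof.
split=> [|p q h t hh ht]; first exact: bilin_act_twist.
rewrite (act_twistE _ hh); have hc := scopK.2 _ _ ht.
apply: (homog_tlift (U := stensor K V) sK sK _ _ hc); [exact: super_space_stensor|lin|].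
move=> r s x y hx hy <-; rewrite addbCA; apply: homog_tens => //.
  exact: homog_ksign.
exact: sactV.2.
Qed.

Lemma super_bimap_coact_twist : super_bimap (T : K -> V -> stensor V K).
Proof.
split=> [|p q a b ha hb]; first exact: bilin_coact_twist.
rewrite (coact_twistE _ ha); have hc := scoact.2 _ _ hb.
apply: (homog_tlift (U := stensor V K) sV sK _ _ hc); [exact: super_space_stensor|lin|].
move=> r s x y hx hy <-; rewrite addbCA; apply: homog_tens => //.
  exact: homog_ksign.
by case: algK => _ [_ h] _ _ _; apply: h.
Qed.

(** Moving [h] past a product is moving it past the two factors in turn.  The
    signs match since [h ◁ t_(2)] has the parity of [h] plus that of [t_(2)]. *)
Lemma act_twist_mulK h t s :
  R h (mK t s) = Sw (t', h') <- R h t; Sw (s', h'') <- R h' s; mK t' s' ⊗ h''.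
Proof.
move: h; apply: (super_ind sV) => [|p h hh]; first by apply: lin_closed_eq; lin.
rewrite !(act_twistE _ hh) tlift_tlift; last by lin.
have [cM _] : alg_map HK (stensor_alg HK HK) (cop HK) by case: hK.
rewrite cM; have bm := bilin_stensor_mul algK algK.
rsw 1 (rewrite tliftE; [|lin]).
move: (cop HK t); apply: (stensor_ind sK sK) => [|_ q t1 t2 _ ht2].
  by apply: lin_closed_eq; lin.
rewrite (stensor_mul_tlift algK algK _ _ ht2) tlift_tlift; last by lin.
rewrite tliftE; last by lin.
rewrite (act_twistE _ (sactV.2 _ _ _ _ hh ht2)) tlift_tlift; last by lin.
apply: eq_tlift => s1 s2; rewrite !tliftE; try by lin.
by rewrite ksign_mul ?ksignK ?actM //; exact: algK.
Qed.

(** Module algebra axiom: to move a product [h g] past [s], move [g] first. *)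
Lemma act_twist_mulV h g s :
  R (mV h g) s = Sw (s', g') <- R g s; Sw (s'', h') <- R h s'; s'' ⊗ mV h' g'.
Proof.
move: h; apply: (super_ind sV) => [|p h hh]; first by apply: lin_closed_eq; lin.
move: g; apply: (super_ind sV) => [|q g hg]; first by apply: lin_closed_eq; lin.
have hhg : homog (p (+) q) (mV h g) by case: algV => _ [_ m] _ _ _; apply: m.
rewrite (act_twistE _ hg) (act_twistE _ hhg) tlift_tlift; last by lin.
lsw 1 (rewrite (act_mul _ _ hg) linear_tliftE; [|lin]).
rewrite -(sw_coassoc (F := fun x y z => ksign (p (+) q) x ⊗ mV (h ◁ ksign q y) (g ◁ z))).
- apply: eq_tlift => s1 s2; rewrite tliftE; last by lin.
  rewrite (act_twistE _ hh) tlift_tlift; last by lin.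
  rewrite tlift_cop_ksign; last by lin.
  by apply: eq_tlift => x y; rewrite tliftE ?ksignK //; lin.
- exact: coalgK.
- by lin.
Qed.

Lemma act_twist_1r h : R h (one HK) = one HK ⊗ h.
Proof.
move: h; apply: (super_ind sV) => [|p h hh]; first by apply: lin_closed_eq; lin.
have [_ c1] : alg_map HK (stensor_alg HK HK) (cop HK) by case: hK.
by rewrite (act_twistE _ hh) c1 tliftE ?act1 ?(ksign_one _ algK) //; lin.
Qed.

Lemma act_twist_1l t : R (one HV) t = t ⊗ one HV.
Proof.
have h1 : homog false (one HV) by case: algV.
rewrite (act_twistE _ h1); have [_ _ _ _ cu] := coalgK.
have a1 a : one HV ◁ a = eps HK a *: one HV by case: hV => -[].
rewrite -[X in _ = X ⊗ _]cu (linear_tliftE (f := fun z => z ⊗ one HV)); last by lin.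
by apply: eq_tlift => x y; rewrite a1 ksign0 // tensZr tensZl.
Qed.

Lemma coact_twist_mulK p a v b : homog p a ->
  T (mK a v) b = Sw (y, z) <- T v b; ksign p y ⊗ mK a z.
Proof.
move=> ha; move: v; apply: (super_ind sK) => [|q v hv].
  by apply: lin_closed_eq; lin.
have hav : homog (p (+) q) (mK a v) by case: algK => _ [_ m] _ _ _; apply: m.
rewrite (coact_twistE _ hav) (coact_twistE _ hv) tlift_tlift; last by lin.
by apply: eq_tlift => x y; rewrite tliftE ?ksignK -?mKA //; lin.
Qed.

(** The coproduct of [V] is a comodule map.  The sign in the coaction on [V ⊗ V] is
    the one of moving the first coaction leg past the second factor, that is, of
    [coact_twist]. *)
Lemma sw_coact_copV (U : lmodType k) (F : V -> V -> K -> U) b : trilin F ->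
  (Sw (b0, b1) <- coact cV b; Sw (x, y) <- cop HV b0; F x y b1) =
  (Sw (b1, b2) <- cop HV b; Sw (v0, v1) <- coact cV b1; Sw (y, z) <- T v1 b2; F v0 y z).
Proof.
move=> tF; have [_ _ [[_ _ cc] _ _] _ _] := hV.
have bF : bilin (fun t z => Sw (x, y) <- t; F x y z) by lin.
transitivity (tlift (fun t z => Sw (x, y) <- t; F x y z)
  (coact (crossed_tensor HK cV cV) (cop HV b))).
  by rewrite cc tlift_tmap //; lin.
rewrite /=; move: (cop HV b); apply: tensor_ext.
- apply: linear_comp; first by lin.
  by rewrite /stlift; lin.
- by lin.
move=> b1 b2; rewrite [in RHS]tliftE; last by lin.
rewrite stlift_tlift //; last by rewrite /stlift; lin.
rewrite tliftE; last by rewrite /stlift; lin.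
move: (coact cV b1); apply: (stensor_ind sV sK).
  by apply: lin_closed_eq; rewrite /stlift; lin.
move=> p q v0 v1 hv0 hv1; rewrite (stliftE sV sK _ hv0 hv1); last first.
  by rewrite /stlift; lin.
rewrite tliftE; last by lin.
rewrite (coact_twistE _ hv1) tlift_tlift; last by lin.
rewrite stlift_ksignl //; last by lin.
rewrite tlift_tlift //; apply: eq_tlift => y z.
by rewrite !tliftE //; lin.
Qed.

(** The twist past [b] is the twist past [b_(1)] and then past [b_(2)], because the
    coproduct of [V] is a comodule map. *)
Lemma coact_twist_copV (U : lmodType k) (F : V -> V -> K -> U) a b : trilin F ->
  (Sw (b', a') <- T a b; Sw (b1, b2) <- cop HV b'; F b1 b2 a') =
  (Sw (b1, b2) <- cop HV b; Sw (b1', a') <- T a b1; Sw (b2', a'') <- T a' b2;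
     F b1' b2' a'').
Proof.
move=> tF; move: a; apply: (super_ind sK) => [|p a ha]; first by apply: lin_closed_eq; lin.
rewrite (coact_twistE _ ha) tlift_tlift; last by lin.
lsw 1 (rewrite tliftE; [|lin]); lsw 1 (rewrite tlift_copV_ksign; [|lin]).
rewrite (sw_coact_copV (F := fun x y z => F (ksign p x) (ksign p y) (mK a z))); last by lin.
apply: eq_tlift => b1 b2; rewrite (coact_twistE _ ha) tlift_tlift; last by lin.
apply: eq_tlift => v0 v1; rewrite tliftE; last by lin.
rewrite (coact_twist_mulK _ _ ha) tlift_tlift; last by lin.
by apply: eq_tlift => y z; rewrite tliftE //; lin.
Qed.

(** Multiplicativity of the coproduct of [K] and coassociativity of the coaction:
    the components of [a] cross [b] one after the other, the last one first. *)
Lemma coact_twist_copK (U : lmodType k) (F : V -> K -> K -> U) a b : trilin F ->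
  (Sw (b', a') <- T a b; Sw (a1, a2) <- cop HK a'; F b' a1 a2) =
  (Sw (a1, a2) <- cop HK a; Sw (b', a2') <- T a2 b; Sw (b'', a1') <- T a1 b';
     F b'' a1' a2').
Proof.
move=> tF; move: a; apply: (super_ind sK) => [|p a ha]; first by apply: lin_closed_eq; lin.
have [cM _] : alg_map HK (stensor_alg HK HK) (cop HK) by case: hK.
have bm := bilin_stensor_mul algK algK.
rewrite (coact_twistE _ ha) tlift_tlift; last by lin.
lsw 1 (rewrite tliftE; [|lin]); lsw 1 (rewrite cM).
move: (cop HK a) (scopK.2 _ _ ha); apply: (homog_stensor_ind sK sK).
  by apply: lin_closed_eq; lin.
move=> q1 q2 a1 a2 h1 h2 <-; rewrite tliftE; last by lin.
lsw 1 (rewrite (stensor_mul_tlift algK algK _ _ h2) tlift_tlift; [|lin]).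
lsw 2 (rewrite tliftE; [|lin]).
rewrite (coact_twistE _ h2) tlift_tlift; last by lin.
rsw 1 (rewrite tliftE; [|lin]).
rsw 1 (rewrite (coact_twistE _ h1) tlift_tlift; [|lin]).
rsw 1 (rewrite tlift_coact_ksign; [|lin]).
rsw 2 (rewrite tliftE; [rewrite ksignK //|lin]).
by rewrite -(sw_coact (F := fun x y z => F (ksign (q1 (+) q2) x)
  (mK a1 (ksign q2 y)) (mK a2 z))) //; lin.
Qed.

(** An odd [a] has counit zero, so the sign carried by [b] disappears. *)
Lemma coact_twist_epsK a b : (Sw (b', a') <- T a b; eps HK a' *: b') = eps HK a *: b.
Proof.
move: a; apply: (super_ind sK) => [|p a ha].
  by apply: lin_closed_eq; lin.
have [_ _ [_ _ cu] _] := modV.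
have [eM _] : eps_alg_map HK by case: hK.
rewrite (coact_twistE _ ha) tlift_tlift; last by lin.
transitivity (eps HK a *: ksign p (Sw (b0, b1) <- coact cV b; eps HK b1 *: b0)).
  rewrite (linear_tliftE (f := fun z => eps HK a *: ksign p z)); last by lin.
  apply: eq_tlift => x y; rewrite tliftE; last by lin.
  by rewrite eM (linear_Z _ _ (linear_ksign p sV)) scalerA.
rewrite cu; have := sepsK.2 _ _ ha; rewrite /homog /=.
by case: p {ha} => [<-|_]; rewrite ?scale0r // ksign0.
Qed.

Lemma coact_twist_epsV a b : (Sw (b', a') <- T a b; eps HV b' *: a') = eps HV b *: a.
Proof.
move: a; apply: (super_ind sK) => [|p a ha].
  by apply: lin_closed_eq; lin.
have [_ _ [_ [_ _ ce] _] _ _] := hV.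
rewrite (coact_twistE _ ha) tlift_tlift; last by lin.
have := congr1 (tlift (fun (x : k^o) y => (x : k) *: mK a y)) (ce b).
rewrite /= tliftE; last by lin.
rewrite mK1 => ->; rewrite tlift_tmap; try by lin.
apply: eq_tlift => x y; rewrite tliftE; last by lin.
by rewrite (super_form_ksign _ _ sV sepsV).
Qed.

(** The coproduct of [V] is a module map. *)
Lemma act_twist_copV (U : lmodType k) (F : K -> V -> V -> U) b a : trilin F ->
  (Sw (a', b') <- R b a; Sw (b1, b2) <- cop HV b'; F a' b1 b2) =
  (Sw (b1, b2) <- cop HV b; Sw (a', b2') <- R b2 a; Sw (a'', b1') <- R b1 a';
     F a'' b1' b2').
Proof.
move=> tF; have [_ _ [[_ cact _] _ _] _ _] := hV.
move: b; apply: (super_ind sV) => [|p b hb]; first by apply: lin_closed_eq; lin.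
rewrite (act_twistE _ hb) tlift_tlift; last by lin.
lsw 1 (rewrite tliftE; [|lin]); lsw 1 (rewrite cact).
move: (cop HV b) (scopV.2 _ _ hb); apply: (homog_stensor_ind sV sV).
  by apply: lin_closed_eq; rewrite /= /stlift; lin.
move=> q1 q2 b1 b2 h1 h2 <-; rewrite [in RHS]tliftE; last by lin.
lsw 1 (rewrite /= (stliftE sV sV _ h1 h2); [|rewrite /stlift; lin]).
lsw 1 (rewrite stlift_ksignl ?tlift_tlift //; lin).
lsw 2 (rewrite tliftE; [|lin]).
rewrite (act_twistE _ h2) tlift_tlift; last by lin.
rsw 1 (rewrite tliftE; [|lin]).
rsw 1 (rewrite (act_twistE _ h1) tlift_tlift ?tlift_cop_ksign; [|lin..]).
rsw 2 (rewrite tliftE; [rewrite ksignK //|lin]).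
by rewrite -(sw_coassoc (F := fun x y z => F (ksign (q1 (+) q2) x)
  (b1 ◁ ksign q2 y) (b2 ◁ z))) //; [exact: coalgK | lin].
Qed.

Lemma act_twist_eps h t :
  (Sw (t', h') <- R h t; (eps HK t' * eps HV h' : k^o)) = eps HV h * eps HK t.
Proof.
move: h; apply: (super_ind sV) => [|p h hh].
  by apply: (lin_closed_eq (W := k^o)); lin.
have [_ _ [_ [_ ae _] _] _ _] := hV; have [_ _ _ cu _] := coalgK.
rewrite (act_twistE _ hh) tlift_tlift; last by lin.
rewrite -[in RHS](cu t) (linear_tliftE (f := fun x => (eps HV h * eps HK x : k^o))).
  apply: eq_tlift => x y; rewrite tliftE; last by lin.
  rewrite (super_form_ksign _ _ sK sepsK) ae (linear_Z (W := k^o) _ _ lepsK) /=.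
  change (eps HK x * (eps HK y * eps HV h) = eps HV h * (eps HK x * eps HK y)).
  by rewrite mulrA mulrC.
by lin.
Qed.

(** * The bosonisation as a super algebra and a super coalgebra *)

Local Notation H := (super_bosonisation HK HV cV (bosonisation_antipode HK HV cV)).

Lemma bilin_bosonisation_mul : bilin (mul H).
Proof. by rewrite /= /stlift; lin. Qed.
Let bmH := bilin_bosonisation_mul.
#[local] Hint Extern 1 (bilin (mul _)) => exact: bmH : lin.

Lemma bosonisation_mulE w h t g :
  mul H (w ⊗ h) (t ⊗ g) = Sw (t', h') <- R h t; mK w t' ⊗ mV h' g.
Proof.
move: h; apply: (super_ind sV) => [|p h hh]; first by apply: lin_closed_eq; lin.
move: w; apply: (super_ind sK) => [|q w hw]; first by apply: lin_closed_eq; lin.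
move: t; apply: (super_ind sK) => [|r t ht]; first by apply: lin_closed_eq; lin.
move: g; apply: (super_ind sV) => [|s g hg]; first by apply: lin_closed_eq; lin.
rewrite /= (stliftE sK sV _ hw hh); last by rewrite /stlift; lin.
rewrite (stliftE sK sV _ ht hg); last by rewrite /stlift; lin.
rewrite stlift_ksignl //; last by lin.
rewrite (act_twistE _ hh) tlift_tlift; last by lin.
by apply: eq_tlift => x y; rewrite tliftE //; lin.
Qed.

Let sH : super_space (stensor K V). Proof. exact: super_space_stensor. Qed.
Let sHH : super_space (stensor (stensor K V) (stensor K V)).
Proof. exact: super_space_stensor. Qed.

(** Both bracketings of a threefold product move the first element of [V] past two
    elements of [K] and the second one past one of them. *)
Lemma bosonisation_algebra : @super_algebra k (stensor K V) H.
Proof.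
have [_ [_ mhK] h1K _ _] := algK; have [_ [_ mhV] h1V _ _] := algV.
split=> //.
- split=> // p q x y hx hy; move: x hx; apply: (homog_stensor_ind sK sV).
    by apply: (@lin_closed_eq _ (tensor K V)); lin.
  move=> p1 p2 w h hw hh <-; move: y hy; apply: (homog_stensor_ind sK sV).
    by apply: (@lin_closed_eq _ (tensor K V)); lin.
  move=> q1 q2 t g ht hg <-; rewrite bosonisation_mulE.
  have hR := super_bimap_act_twist.2 _ _ _ _ hh ht.
  apply: (homog_tlift (U := stensor K V) sK sV sH _ hR); first by lin.
  move=> r1 r2 x y hx hy e.
  have -> : p1 (+) p2 (+) (q1 (+) q2) = (p1 (+) r1) (+) (r2 (+) q2).
    by rewrite addbA -(addbA p1) -e !addbA.
  by apply: homog_tens => //; [apply: mhK | apply: mhV].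
- by rewrite -[false]/(false (+) false); apply: homog_tens.
- move=> x y z.
  move: x; apply: tensor_ext; [lin | lin | move=> w h].
  move: y; apply: tensor_ext; [lin | lin | move=> t g].
  move: z; apply: tensor_ext; [lin | lin | move=> s f].
  rewrite !bosonisation_mulE (linear_tliftE (f := mul H (w ⊗ h))); last by lin.
  rewrite (linear_tliftE (f := fun u => mul H u (s ⊗ f))); last by lin.
  rsw 1 (rewrite bosonisation_mulE act_twist_mulV tlift_tlift; [|lin]).
  rewrite [RHS]tlift_exch; apply: eq_tlift => s' g'.
  rewrite bosonisation_mulE act_twist_mulK tlift_tlift; last by lin.
  apply: eq_tlift => t' h'; rewrite !tlift_tlift; try by lin.
  by apply: eq_tlift => s'' h''; rewrite !tliftE ?mKA ?mVA //; lin.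
- split; apply: tensor_ext; try by lin.
    move=> t g; rewrite bosonisation_mulE act_twist_1l tliftE; last by lin.
    by rewrite m1K m1V.
  move=> w h; rewrite bosonisation_mulE act_twist_1r tliftE; last by lin.
  by rewrite mK1 mV1.
Qed.

Lemma linear_bosonisation_cop : linear (cop H).
Proof. by rewrite /= /stlift; lin. Qed.
Let lcopH := linear_bosonisation_cop.
#[local] Hint Extern 1 (GRing.linear_for _ (cop _)) => exact: lcopH : lin.

Lemma bosonisation_copE w h :
  cop H (w ⊗ h) =
  Sw (w1, w2) <- cop HK w; Sw (h1, h2) <- cop HV h; Sw (h', w') <- T w2 h1;
  (w1 ⊗ h') ⊗ (w' ⊗ h2).
Proof.
move: h; apply: (super_ind sV) => [|p h hh]; first by apply: lin_closed_eq; lin.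
move: w; apply: (super_ind sK) => [|q w hw]; first by apply: lin_closed_eq; lin.
rewrite /= (stliftE sK sV _ hw hh); last by rewrite /stlift; lin.
move: (cop HK w); apply: (stensor_ind sK sK).
  by apply: lin_closed_eq; rewrite /stlift; lin.
move=> r1 r2 w1 w2 h1 h2; rewrite (stliftE sK sK _ h1 h2); last by rewrite /stlift; lin.
rewrite tliftE; last by lin.
rewrite stlift_tlift //; last by rewrite /stlift; lin.
apply: eq_tlift => x y; rewrite stlift_ksignl //; last by lin.
rewrite (coact_twistE _ h2) tlift_tlift; last by lin.
by apply: eq_tlift => z z'; rewrite tliftE //; lin.
Qed.

Lemma bosonisation_epsE w h : eps H (w ⊗ h) = eps HK w * eps HV h.
Proof. by rewrite /= (tliftE (U := k^o)) //; lin. Qed.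

Lemma linear_bosonisation_eps : linear (eps H : tensor K V -> k^o).
Proof. by apply: tlift_linear; lin. Qed.
Let lepsH := linear_bosonisation_eps.
#[local] Hint Extern 1 (GRing.linear_for _ (eps _)) => exact: lepsH : lin.

(** Coassociativity is dual to associativity: the hexagons of [coact_twist] bring
    both sides to a sum in which [a_(3)] crosses [b_(1)] and [b_(2)] and [a_(2)]
    crosses [b_(1)]. *)
Lemma bosonisation_coalgebra : @super_coalgebra k (stensor K V) H.
Proof.
have [_ _ _ cuKl cuKr] := coalgK; have [_ _ _ cuVl cuVr] := coalgV.
split.
- split=> // p x hx; move: x hx; apply: (homog_stensor_ind sK sV).
    exact: (lin_closed_comp (lin_closed_homog p sHH) lcopH).
  move=> p1 p2 w h hw hh <-; rewrite bosonisation_copE.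
  apply: (homog_tlift (U := stensor (stensor K V) (stensor K V)) sK sK sHH _
    (scopK.2 _ _ hw)); first by lin.
  move=> q1 q2 w1 w2 h1 h2 <-.
  apply: (homog_tlift (U := stensor (stensor K V) (stensor K V)) sV sV sHH _
    (scopV.2 _ _ hh)); first by lin.
  move=> r1 r2 b1 b2 hb1 hb2 <-.
  apply: (homog_tlift (U := stensor (stensor K V) (stensor K V)) sV sK sHH _
    (super_bimap_coact_twist.2 _ _ _ _ h2 hb1)); first by lin.
  move=> s1 s2 b' w' hb' hw' e.
  have -> : q1 (+) q2 (+) (r1 (+) r2) = (q1 (+) s1) (+) (s2 (+) r2).
    by rewrite addbA -(addbA q1) -e !addbA.
  by apply: homog_tens => //; apply: homog_tens.
- split=> // p x hx; move: x hx; apply: (homog_stensor_ind sK sV).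
    apply: (lin_closed_comp (W := k^o) (P := @homog k (superk k) p)) => //.
    by split=> [|c u v]; rewrite /homog /=; case: p => // <- <-; rewrite scaler0 addr0.
  move=> p1 p2 w h hw hh <-; rewrite bosonisation_epsE.
  have := sepsV.2 _ _ hh; have := sepsK.2 _ _ hw; rewrite /homog /=.
  case: p1 {hw} => [<- _|_]; first by rewrite mul0r; case: (true (+) p2).
  by case: p2 {hh} => [<-|_] //=; rewrite mulr0.
- move=> v; move: v; apply: tensor_ext; [lin | lin | move=> a b].
  rewrite !bosonisation_copE !tlift_tlift; try by lin.
  lsw 1 (rewrite tlift_tlift; [|lin]); lsw 2 (rewrite tlift_tlift; [|lin]).
  lsw 3 (rewrite tliftE; [rewrite bosonisation_copE tlift_tlift; [|lin]|lin]).
  lsw 4 (rewrite tlift_tlift; [|lin]); lsw 5 (rewrite tlift_tlift; [|lin]).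
  lsw 6 (rewrite tliftE; [|lin]).
  rsw 1 (rewrite tlift_tlift; [|lin]); rsw 2 (rewrite tlift_tlift; [|lin]).
  rsw 3 (rewrite tliftE; [rewrite bosonisation_copE linear_tliftE; [|lin]|lin]).
  rsw 4 (rewrite linear_tliftE; [|lin]); rsw 5 (rewrite linear_tliftE; [|lin]).
  lsw 2 (rewrite tlift_exch); lsw 3 (rewrite coact_twist_copV; [|lin]).
  lsw 1 (rewrite tlift_exch); rewrite sw_coassoc; [|exact: coalgK|lin].
  lsw 2 (rewrite sw_coassoc; [|exact: coalgV|lin]).
  rsw 2 (rewrite coact_twist_copK; [|lin]); rsw 1 (rewrite tlift_exch).
  rsw 4 (rewrite tlift_exch); rsw 3 (rewrite tlift_exch); rsw 5 (rewrite tlift_exch).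
  by rsw 7 (rewrite tliftE; [|lin]).
- apply: tensor_ext; [lin | lin | move=> a b].
  rewrite bosonisation_copE !tlift_tlift; try by lin.
  lsw 1 (rewrite tlift_tlift; [|lin]); lsw 2 (rewrite tlift_tlift; [|lin]).
  lsw 3 (rewrite tliftE; [rewrite bosonisation_epsE -scalerA -tensZl|lin]).
  lsw 2 (rewrite -(linear_tliftE (f := fun x => eps HK _ *: (x ⊗ _))); [|lin]).
  lsw 2 (rewrite coact_twist_epsV).
  rewrite -[in RHS](cuKl a) -[in RHS](cuVl b).
  rewrite (linear_tliftE (f := fun x => x ⊗ _)); last by lin.
  apply: eq_tlift => a1 a2; rewrite linear_tliftE; last by lin.
  by apply: eq_tlift => b1 b2; rewrite tensZl tensZl tensZr.
- apply: tensor_ext; [lin | lin | move=> a b].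
  rewrite bosonisation_copE !tlift_tlift; try by lin.
  lsw 1 (rewrite tlift_tlift; [|lin]); lsw 2 (rewrite tlift_tlift; [|lin]).
  lsw 3 (rewrite tliftE; [rewrite bosonisation_epsE mulrC -scalerA -tensZr|lin]).
  lsw 2 (rewrite -(linear_tliftE (f := fun x => eps HV _ *: (_ ⊗ x))); [|lin]).
  lsw 2 (rewrite coact_twist_epsK).
  rewrite -[in RHS](cuKr a) -[in RHS](cuVr b).
  rewrite (linear_tliftE (f := fun x => x ⊗ _)); last by lin.
  apply: eq_tlift => a1 a2; rewrite linear_tliftE; last by lin.
  by apply: eq_tlift => b1 b2; rewrite tensZl !tensZr scalerA mulrC -scalerA.
Qed.

(** * Multiplicativity of the coproduct *)

Lemma bosonisation_eps_alg : @eps_alg_map k (stensor K V) H.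
Proof.
have [eMK e1K] : eps_alg_map HK by case: hK.
have [eMV e1V] : eps_alg_map HV by case: hV => _ _ _ [].
split; last by rewrite bosonisation_epsE e1K e1V mulr1.
move=> x y; move: x; apply: (tensor_ext (U := k^o)); [|by lin|move=> w h].
  exact: (linear_comp lepsH (bmH.1 y)).
move: y; apply: (tensor_ext (U := k^o)); [|by lin|move=> t g].
  exact: (linear_comp lepsH (bmH.2 _)).
rewrite bosonisation_mulE (linear_tliftE (U := tensor K V) (X := k^o) _ _ lepsH).
rewrite !bosonisation_epsE.
transitivity (eps HK w * (eps HV h * eps HK t) * eps HV g); last by rewrite !mulrA.
rewrite -act_twist_eps.
rewrite (linear_tliftE (f := fun z : k^o => (eps HK w * (z : k) * eps HV g : k^o))); last first.
  by move=> c x y; rewrite mulrDr mulrDl -[c *: x]/(c * x) (mulrCA _ c) -!mulrA.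
by apply: eq_tlift => x y; rewrite bosonisation_epsE eMK eMV !mulrA.
Qed.

Lemma coact_twist_1r a : T a (one HV) = one HV ⊗ a.
Proof.
move: a; apply: (super_ind sK) => [|p a ha]; first by apply: lin_closed_eq; lin.
have [_ c1] : alg_map HV (stensor_alg HV HK) (coact cV) by case: hV => -[].
by rewrite (coact_twistE _ ha) c1 tliftE ?mK1 ?(ksign_one _ algV) //; lin.
Qed.

Lemma coact_twist_1l b : T (one HK) b = coact cV b.
Proof.
have h1 : homog false (one HK) by case: algK.
rewrite (coact_twistE _ h1) -[RHS]tlift_id; apply: eq_tlift => x y.
by rewrite ksign0 // m1K.
Qed.

(** The two factors sit in the bosonisation as subalgebras.  A product with the
    factor of [K] on the left is a plain tensor, the other order is a value of
    [act_twist]. *)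
Local Notation jK w := (w ⊗ one HV).
Local Notation jV h := (one HK ⊗ h).

Lemma bosonisation_mul_jK w t g : mul H (jK w) (t ⊗ g) = mK w t ⊗ g.
Proof. by rewrite bosonisation_mulE act_twist_1l tliftE ?m1V //; lin. Qed.

Lemma bosonisation_mul_jV w h g : mul H (w ⊗ h) (jV g) = w ⊗ mV h g.
Proof. by rewrite bosonisation_mulE act_twist_1r tliftE ?mK1 //; lin. Qed.

Lemma bosonisation_mul_jVjK h t : mul H (jV h) (jK t) = R h t.
Proof.
rewrite bosonisation_mulE -[RHS]tlift_id; apply: eq_tlift => x y.
by rewrite m1K mV1.
Qed.

Lemma super_map_jK : super_map (fun w : K => jK w : stensor K V).
Proof.
split=> [|p w hw]; first by lin.
by rewrite -[p]addbF; apply: homog_tens => //; case: algV.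
Qed.
Lemma super_map_jV : super_map (fun h : V => jV h : stensor K V).
Proof.
split=> [|p h hh]; first by lin.
by rewrite -[p]/(false (+) p); apply: homog_tens => //; case: algK.
Qed.
Let super_jK := super_map_jK.
Let super_jV := super_map_jV.
Let jK_alg : alg_map HK H (fun w : K => jK w).
Proof. by split=> // x y; rewrite bosonisation_mul_jK. Qed.
Let jV_alg : alg_map HV H (fun h : V => jV h).
Proof. by split=> // x y; rewrite bosonisation_mul_jV. Qed.
Let jK_ksign p w : ksign p (jK w : stensor K V) = jK (ksign p w).
Proof. by rewrite ksign_tens // (ksign_one _ algV). Qed.
Let jV_ksign p h : ksign p (jV h : stensor K V) = jV (ksign p h).
Proof. by rewrite ksign_tens // (ksign_one _ algK). Qed.
Let linear_jK : linear (fun w : K => jK w : tensor K V). Proof. by lin. Qed.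
Let linear_jV : linear (fun h : V => jV h : tensor K V). Proof. by lin. Qed.

Local Notation HH := (@stensor_alg k (stensor K V) (stensor K V) H H).
Let algH := bosonisation_algebra.
Let algHH := stensor_alg_super algH algH.
Let bmHH : bilin (mul HH). Proof. exact: bilin_stensor_mul. Qed.
#[local] Hint Extern 1 (bilin (mul _)) => exact: bmHH : lin.
Let mHHA : associative (mul HH). Proof. by case: algHH. Qed.
Let mHA : associative (mul H). Proof. by case: algH. Qed.

(* [CC a] is the coproduct of an element of [K] and [DD b] the coaction on an
   element of [V], both inside the tensor square of the bosonisation. *)
Local Notation C := (tmap (fun w : K => jK w) (fun w : K => jK w)).
Local Notation D := (tmap (fun h : V => jV h) (fun w : K => jK w)).
Local Notation CC a := (C (cop HK a)).
Local Notation DD b := (D (coact cV b)).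
Local Notation i2 y := ((one HK ⊗ one HV) ⊗ y).

Lemma bosonisation_cop_jK a : cop H (jK a) = CC a.
Proof.
have c1 : cop HV (one HV) = one HV ⊗ one HV by case: hV => _ _ _ [].
rewrite bosonisation_copE; apply: eq_tlift => a1 a2.
by rewrite c1 tliftE ?coact_twist_1r ?tliftE //; lin.
Qed.

Lemma bosonisation_cop_jV b :
  cop H (jV b) = Sw (b1, b2) <- cop HV b; mul HH (DD b1) (i2 (jV b2)).
Proof.
have [_ c1] : alg_map HK (stensor_alg HK HK) (cop HK) by case: hK.
rewrite bosonisation_copE c1 tliftE; last by lin.
apply: eq_tlift => b1 b2; rewrite coact_twist_1l /tmap.
rewrite (linear_tliftE (f := fun u => mul HH u _)); last by lin.
apply: eq_tlift => x y; rewrite (stensor_mul_oner algH algH) bosonisation_mul_jK ?mK1 //.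
Qed.

(** The sign in the product of the tensor square, where [w_(2)] crosses the first
    coaction leg of [h_(1)], is the one of [coact_twist]. *)
Lemma bosonisation_copM_jKjV w h : cop H (w ⊗ h) = mul HH (CC w) (cop H (jV h)).
Proof.
rewrite bosonisation_copE /tmap (linear_tliftE (f := fun u => mul HH u _)); last by lin.
move: (cop HK w); apply: (stensor_ind sK sK).
  by apply: lin_closed_eq; lin.
move=> _ q w1 w2 _ h2; rewrite !tliftE; try by lin.
rewrite bosonisation_cop_jV (linear_tliftE (f := mul HH _)); last by lin.
apply: eq_tlift => h1 h1'; rewrite (coact_twistE _ h2) tlift_tlift; last by lin.
rewrite /tmap (linear_tliftE (f := fun u => mul HH _ (mul HH u _))); last by lin.
apply: eq_tlift => x y; rewrite tliftE; last by lin.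
rewrite (stensor_mul_oner algH algH) (stensor_mulE algH algH _ _ _ (super_jK.2 _ _ h2)).
by rewrite jV_ksign bosonisation_mul_jV m1V bosonisation_mul_jK ?bosonisation_mul_jK ?mK1.
Qed.

(** Coassociativity of the coaction: both sides are
    [± c^(0) ⊗ c^(1) (b ◁ c^(2))]. *)
Lemma jV_braids_coact b c :
  mul HH (i2 (jV b)) (DD c) =
  Sw (c', b') <- braiding cV cV (b ⊗ c); mul HH (DD c') (i2 (jV b')).
Proof.
have linb : linear (braiding cV cV) by rewrite /braiding /stlift; lin.
move: b; apply: (super_ind sV) => [|p b hb]; first by apply: lin_closed_eq; lin.
have -> : braiding cV cV (b ⊗ c) = Sw (c0, c1) <- coact cV c; ksign p c0 ⊗ b ◁ c1.
  move: c; apply: (super_ind sV) => [|q c hc]; first by apply: lin_closed_eq; lin.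
  rewrite /braiding (stliftE sV sV _ hb hc); last by rewrite /stlift; lin.
  by rewrite stlift_ksignl //; lin.
rewrite /tmap (linear_tliftE (f := mul HH _)); last by lin.
rewrite [RHS]tlift_tlift; last by lin.
rsw 1 (rewrite tliftE; [|lin]).
rsw 1 (rewrite tlift_coact_ksign; [|lin]).
rsw 1 (rewrite (linear_tliftE (f := fun u => mul HH u _)); [|lin]).
rsw 2 (rewrite (stensor_mul_oner algH algH) bosonisation_mul_jK mK1).
rewrite (sw_coact (F := fun x y z => jV (ksign p x) ⊗ (ksign p y ⊗ b ◁ z))); last by lin.
apply: eq_tlift => x y.
rewrite (stensor_mulE algH algH _ _ _ (super_jV.2 _ _ hb)) jV_ksign.
rewrite bosonisation_mul_jV m1V bosonisation_mul_jVjK (act_twistE _ hb).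
by rewrite (linear_tliftE (f := fun u => _ ⊗ u)) //; lin.
Qed.

(** The coproduct of [V] is braided multiplicative, and the coproduct of the
    bosonisation is built so that the braiding becomes a commutation. *)
Lemma bosonisation_copM_jV b c :
  cop H (jV (mV b c)) = mul HH (cop H (jV b)) (cop H (jV c)).
Proof.
have [_ _ _ [cM _ _] _] := hV; have [_ _ _ _ [DM _]] : crossed_algebra HK HV cV by case: hV.
have [DDM _] := alg_map_tmap algV algH algK algH super_jV super_jK jV_alg jK_alg.
rewrite !bosonisation_cop_jV cM tlift_tlift; last by lin.
rewrite (linear_tliftE (f := fun u => mul HH u _)); last by lin.
apply: eq_tlift => b1 b2; rewrite tlift_tlift; last by lin.
rewrite (linear_tliftE (f := mul HH _)); last by lin.
apply: eq_tlift => c1 c2; rewrite tlift_tlift; last by lin.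
rewrite mHHA -(mHHA (DD b1)) jV_braids_coact.
rewrite (linear_tliftE (f := fun u => mul HH (mul HH _ u) _)); last by lin.
apply: eq_tlift => x y; rewrite tliftE; last by lin.
rewrite DM DDM -!mHHA; congr (mul HH _ (mul HH _ _)).
by rewrite (stensor_mul_oner algH algH) bosonisation_mul_jV.
Qed.

(** Coassociativity of [K]: both sides are [± a_(1) ⊗ a_(2) (b ◁ a_(3))]. *)
Lemma jV_passes_cop b a :
  mul HH (i2 (jV b)) (CC a) = Sw (a', b') <- R b a; mul HH (CC a') (i2 (jV b')).
Proof.
move: b; apply: (super_ind sV) => [|p b hb]; first by apply: lin_closed_eq; lin.
rewrite (act_twistE _ hb) /tmap (linear_tliftE (f := mul HH _)); last by lin.
rewrite [RHS]tlift_tlift; last by lin.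
rsw 1 (rewrite tliftE; [|lin]).
rsw 1 (rewrite tlift_cop_ksign; [|lin]).
rsw 1 (rewrite (linear_tliftE (f := fun u => mul HH u _)); [|lin]).
rsw 2 (rewrite (stensor_mul_oner algH algH) bosonisation_mul_jK mK1).
rewrite (sw_coassoc (F := fun x y z => jK (ksign p x) ⊗ (ksign p y ⊗ b ◁ z)));
  [|exact: coalgK|by lin].
apply: eq_tlift => x y.
rewrite (stensor_mulE algH algH _ _ _ (super_jV.2 _ _ hb)) jK_ksign.
rewrite bosonisation_mul_jK m1K bosonisation_mul_jVjK (act_twistE _ hb).
by rewrite (linear_tliftE (f := fun u => _ ⊗ u)) //; lin.
Qed.

(** Multiplication of a coaction on the left and on the right by [K], the product
    being taken in the tensor square.  The right one leaves out the part of [a]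
    that has crossed [v]. *)
Definition left_mult (a : K) (t : tensor V K) : tensor V K :=
  \sum_(p : bool) Sw (v, z) <- t; ksign p v ⊗ mK (part p a) z.

Definition right_mult (t : tensor V K) (a : K) : tensor V K :=
  SSw (v : _, z : q) <- t; Sw (a1, a2) <- cop HK a; v ◁ ksign q a1 ⊗ mK z a2.

Lemma bilin_left_mult : bilin left_mult.
Proof. by rewrite /left_mult; lin. Qed.

Lemma bilin_right_mult : bilin right_mult.
Proof. by rewrite /right_mult /stlift; lin. Qed.
#[local] Hint Extern 1 (bilin left_mult) => exact: bilin_left_mult : lin.
#[local] Hint Extern 1 (bilin right_mult) => exact: bilin_right_mult : lin.

Lemma left_multE p a t : homog p a ->
  left_mult a t = Sw (v, z) <- t; ksign p v ⊗ mK a z.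
Proof.
move=> ha; rewrite /left_mult (bigD1 p) //= big1 ?addr0 => [|q nq].
  by rewrite ha.
rewrite (part_homog q sK ha) (negbTE nq).
by apply: tlift_eq0 => x y; rewrite bilin0l // tens0r.
Qed.

Lemma right_multE p q v z a : homog p v -> homog q z ->
  right_mult (v ⊗ z) a = Sw (a1, a2) <- cop HK a; v ◁ ksign q a1 ⊗ mK z a2.
Proof. by move=> hv hz; rewrite /right_mult (stliftE sV sK _ hv hz) //; lin. Qed.

Lemma left_multM a b t : left_mult a (left_mult b t) = left_mult (mK a b) t.
Proof.
move: a; apply: (super_ind sK) => [|p a ha]; first by apply: lin_closed_eq; lin.
move: b; apply: (super_ind sK) => [|q b hb]; first by apply: lin_closed_eq; lin.
have hab : homog (p (+) q) (mK a b) by case: algK => _ [_ m] _ _ _; apply: m.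
rewrite (left_multE _ ha) (left_multE _ hb) (left_multE _ hab) tlift_tlift; last by lin.
by apply: eq_tlift => x y; rewrite tliftE ?ksignK ?mKA //; lin.
Qed.

Lemma left_mult1 t : left_mult (one HK) t = t.
Proof.
have h1 : homog false (one HK) by case: algK.
rewrite (left_multE _ h1) -[RHS]tlift_id; apply: eq_tlift => x y.
by rewrite ksign0 // m1K.
Qed.

Let santK : super_map (ant HK : K -> K). Proof. by case: hK => _ _ _ _ []. Qed.
Let lantK : linear (ant HK). Proof. by case: santK. Qed.
Let santV : super_map (ant HV : V -> V). Proof. by case: hV => _ _ _ _ []. Qed.
Let lantV : linear (ant HV). Proof. by case: santV. Qed.
#[local] Hint Extern 1 (GRing.linear_for _ (ant _)) =>
  first [exact: lantK | exact: lantV] : lin.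

(** The crossed module condition, with its signs sorted into the two
    multiplications. *)
Lemma coact_act p v a : homog p v ->
  coact cV (v ◁ a) =
  Sw (a1, a2) <- cop HK a; left_mult (ant HK (ksign p a1)) (right_mult (coact cV v) a2).
Proof.
move=> hv; have [_ _ _ ->] := modV.
move: (coact cV v) (scoact.2 _ _ hv); apply: (homog_stensor_ind sV sK).
  by apply: lin_closed_eq; rewrite /stlift; lin.
move=> q1 q v0 v1 h0 h1 e; rewrite (stliftE sV sK _ h0 h1); last first.
  by rewrite /stlift; lin.
rsw 1 (rewrite (right_multE _ h0 h1)).
move: (cop HK a); apply: (stensor_ind sK sK).
  by apply: lin_closed_eq; rewrite /stlift; lin.
move=> p1 r a1 a' ha1 ha'; rewrite tliftE; last by lin.
rewrite (stliftE sK sK _ ha1 ha'); last by rewrite /stlift; lin.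
have hS : homog p1 (ant HK (ksign p a1)) by apply: santK.2; apply: homog_ksign.
rewrite (left_multE _ hS) tlift_tlift; last by lin.
rsw 1 (rewrite tliftE; [|lin]).
move: (cop HK a'); apply: (stensor_ind sK sK).
  by apply: lin_closed_eq; rewrite /stlift; lin.
move=> p2 r' a2 a3 h2 h3; rewrite (stliftE sK sK _ h2 h3); last by lin.
rewrite tliftE; last by lin.
rewrite (ksign_homog p sK ha1) (ksign_homog q sK h2) (bilinZr _ _ _ bact).
rewrite (ksign_homog _ sV (homogZ _ sV (sactV.2 _ _ _ _ h0 h2))).
rewrite (linear_Z _ _ lantK) !(bilinZl _ _ _ bmK) !tensZl tensZr !scalerA -!exprD mKA.
(* Both exponents are [q p1 + q p2 + p1 p2] modulo two, as [p = q1 + q]. *)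
congr (_ *: _); rewrite -signr_odd -[in RHS]signr_odd -e; congr (_ ^+ _); congr nat_of_bool.
by case: (p1); case: (p2); case: (q1); case: (q).
Qed.

(** The crossed module condition without antipode: multiplying [coact_act] on the
    left cancels [S(a_(1))]. *)
Lemma right_mult_coact b a :
  (Sw (a', b') <- R b a; T a' b') = right_mult (coact cV b) a.
Proof.
have [_ _ _ _ [_ _ aR]] := hK; have [_ _ _ cu _] := coalgK.
move: b; apply: (super_ind sV) => [|p b hb]; first by apply: lin_closed_eq; lin.
rewrite (act_twistE _ hb) tlift_tlift; last by lin.
lsw 1 (rewrite tliftE; [|lin]).
rewrite -[in RHS](cu a) (linear_tliftE (f := right_mult _)); last by lin.
transitivity (Sw (a1, a2) <- cop HK a; left_mult (ksign p a1) (coact cV (b ◁ a2))).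
  by [].
lsw 1 (rewrite (coact_act _ hb) (linear_tliftE (f := left_mult _)); [|lin]).
lsw 2 (rewrite left_multM).
rewrite -(sw_coassoc (F := fun x y z => left_mult (mK (ksign p x) (ant HK (ksign p y)))
  (right_mult (coact cV b) z))); [|exact: coalgK|lin].
apply: eq_tlift => a1 a2.
rewrite -(linear_tliftE (f := fun u => left_mult u _)); last by lin.
have := aR (ksign p a1); rewrite tlift_cop_ksign; last by lin.
move=> ->; rewrite (super_form_ksign _ _ sK sepsK) (bilinZl _ _ _ bilin_left_mult).
by rewrite left_mult1 (bilinZr _ _ _ bilin_right_mult).
Qed.

Lemma mul_C_D s t :
  mul HH (C s) (D t) = Sw (x, y) <- s; mul HH (jK x ⊗ (one HK ⊗ one HV)) (D (left_mult y t)).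
Proof.
move: s; apply: (stensor_ind sK sK); first by apply: lin_closed_eq; lin.
move=> _ p x y _ hy; rewrite tmapE // tliftE; last by lin.
move: t; apply: tensor_ext; [lin | lin | move=> v z].
rewrite (left_multE _ hy) tliftE; last by lin.
rewrite !tmapE //.
rewrite (stensor_mulE algH algH _ _ _ (super_jK.2 _ _ hy)) jV_ksign.
by rewrite !(stensor_mul_onel algH algH) !bosonisation_mul_jK.
Qed.

(** This is [right_mult_coact] with the component of [a] that crosses [b]
    multiplied back on the left. *)
Lemma coact_passes_cop b a :
  mul HH (DD b) (CC a) = Sw (a', b') <- R b a; mul HH (CC a') (DD b').
Proof.
rsw 1 (rewrite mul_C_D).
move: b; apply: (super_ind sV) => [|p b hb]; first by apply: lin_closed_eq; lin.
rewrite (act_twistE _ hb) [RHS]tlift_tlift; last by lin.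
rsw 1 (rewrite tliftE; [|lin]); rsw 1 (rewrite tlift_cop_ksign; [|lin]).
rewrite [RHS](sw_coassoc (F := fun x y z => mul HH (jK (ksign p x) ⊗ (one HK ⊗ one HV))
  (D (T (ksign p y) (b ◁ z))))); [|exact: coalgK|lin].
(* In both products [a_(1)] crosses to the left end of the first factor; what is
   left is [coact cV b] multiplied by [a_(2)] on the right. *)
transitivity (Sw (a1, a2) <- cop HK a; mul HH (jK (ksign p a1) ⊗ (one HK ⊗ one HV))
    (D (right_mult (coact cV b) a2))); last first.
  apply: eq_tlift => a1 a2; rewrite -right_mult_coact (act_twistE _ hb).
  rewrite tlift_tlift; last by lin.
  rewrite (linear_tliftE (f := fun u => mul HH _ (D u))); last by lin.
  by apply: eq_tlift => x y; rewrite tliftE //; lin.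
move: (coact cV b) (scoact.2 _ _ hb); apply: (homog_stensor_ind sV sK).
  by apply: lin_closed_eq; lin.
move=> q1 q v z hv hz <-; rewrite [D (v ⊗ z)]tmapE //.
rewrite {1}/tmap (linear_tliftE (f := mul HH _)); last by lin.
transitivity (Sw (a1, a2) <- cop HK a; Sw (x, y) <- cop HK a1;
  (ksign (q1 (+) q) x ⊗ v ◁ ksign q y) ⊗ jK (mK z a2)).
  apply: eq_tlift => a1 a2.
  rewrite (stensor_mulE algH algH _ _ _ (super_jK.2 _ _ hz)) jK_ksign.
  rewrite bosonisation_mul_jVjK bosonisation_mul_jK (act_twistE _ hv) tlift_cop_ksign; last by lin.
  rewrite (linear_tliftE (f := fun u => u ⊗ _)); last by lin.
  by apply: eq_tlift => x y; rewrite ksignK.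
rewrite (sw_coassoc (F := fun x y w => (ksign (q1 (+) q) x ⊗ v ◁ ksign q y) ⊗ jK (mK z w)));
  [|exact: coalgK|by lin].
apply: eq_tlift => a1 a2; rewrite (right_multE _ hv hz).
rewrite (linear_tliftE (f := fun u => mul HH _ (D u))); last by lin.
apply: eq_tlift => x y; rewrite tmapE //.
by rewrite (stensor_mul_onel algH algH) bosonisation_mul_jK mK1.
Qed.

(** The coproduct of [b] is a coaction times an element of the second factor; both
    pass the coproduct of [a], and the coproduct of [V] is a module map. *)
Lemma cop_jV_passes_cop b a :
  mul HH (cop H (jV b)) (CC a) = Sw (a', b') <- R b a; mul HH (CC a') (cop H (jV b')).
Proof.
rsw 1 (rewrite bosonisation_cop_jV (linear_tliftE (f := mul HH _)); [|lin]).
rewrite (act_twist_copV (F := fun x y z => mul HH (CC x) (mul HH (DD y) (i2 (jV z))))); last by lin.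
rewrite bosonisation_cop_jV (linear_tliftE (f := fun u => mul HH u _)); last by lin.
apply: eq_tlift => b1 b2; rewrite -mHHA jV_passes_cop (linear_tliftE (f := mul HH _)); last by lin.
apply: eq_tlift => a' b'; rewrite mHHA coact_passes_cop.
rewrite (linear_tliftE (f := fun u => mul HH u _)); last by lin.
by apply: eq_tlift => x y; rewrite mHHA.
Qed.

(** In [(w h) (t g)] only [h] and [t] have to be exchanged, and their coproducts are
    exchanged in the same way. *)
Lemma bosonisation_cop_alg : @alg_map k (stensor K V) _ H HH (cop H).
Proof.
have [cM c1] : alg_map HK (stensor_alg HK HK) (cop HK) by case: hK.
have [CM _] := alg_map_tmap algK algH algK algH super_jK super_jK jK_alg jK_alg.
split; last by rewrite bosonisation_cop_jK c1 tmapE.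
move=> x y; move: x; apply: tensor_ext; [lin | lin | move=> w h].
move: y; apply: tensor_ext; [lin | lin | move=> t g].
rewrite bosonisation_mulE (linear_tliftE _ _ lcopH).
rewrite (bosonisation_copM_jKjV w h) (bosonisation_copM_jKjV t g).
rewrite -mHHA (mHHA _ (CC t)) cop_jV_passes_cop.
rewrite (linear_tliftE (f := fun u => mul HH _ (mul HH u _))); last by lin.
apply: eq_tlift => t' h'.
by rewrite bosonisation_copM_jKjV cM CM bosonisation_copM_jV !mHHA.
Qed.

(** * The antipode *)

Lemma bosonisation_antipodeE a b :
  ant H (a ⊗ b) = Sw (b', a') <- T a b; R (ant HV b') (ant HK a').
Proof. by rewrite /= /bosonisation_antipode tliftE //; lin. Qed.

Lemma linear_bosonisation_antipode : linear (ant H).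
Proof. by rewrite /= /bosonisation_antipode; lin. Qed.
Let lantH := linear_bosonisation_antipode.
#[local] Hint Extern 1 (GRing.linear_for _ (ant _)) => exact: lantH : lin.

Lemma act_twist_mulr h s t g :
  mul H (R h s) (t ⊗ g) = mul H (jV h) (mK s t ⊗ g).
Proof. by rewrite -bosonisation_mul_jVjK -mHA bosonisation_mul_jK. Qed.

Lemma act_twist_mull w g h t :
  mul H (w ⊗ g) (R h t) = mul H (w ⊗ mV g h) (jK t).
Proof. by rewrite -bosonisation_mul_jVjK mHA bosonisation_mul_jV. Qed.

(** In the left identity the hexagon with the coproduct of [K] collects the two
    components of [a] behind those of [b], where the antipode of [K] cancels them;
    what remains is the left identity of [V].  In the right identity the roles of
    [K] and [V] are exchanged. *)
Lemma bosonisation_is_antipode : @is_antipode k (stensor K V) H.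
Proof.
have [_ _ _ _ [_ aKl aKr]] := hK; have [_ _ _ _ [_ aVl aVr]] := hV.
split.
- split=> // p x hx; move: x hx; apply: (homog_stensor_ind sK sV).
    exact: (lin_closed_comp (lin_closed_homog p sH) lantH).
  move=> p1 p2 a b ha hb <-; rewrite bosonisation_antipodeE.
  apply: (homog_tlift (U := stensor K V) sV sK sH _
    (super_bimap_coact_twist.2 _ _ _ _ ha hb)); first by lin.
  move=> q r x y hx hy <-; apply: super_bimap_act_twist.2.
    exact: santV.2.
  exact: santK.2.
- apply: tensor_ext; [lin | lin | move=> a b].
  rewrite bosonisation_copE bosonisation_epsE !tlift_tlift; try by lin.
  lsw 1 (rewrite tlift_tlift; [|lin]); lsw 2 (rewrite tlift_tlift; [|lin]).
  lsw 3 (rewrite tliftE; [|lin]).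
  lsw 3 (rewrite bosonisation_antipodeE (linear_tliftE (f := fun u => mul H u _)); [|lin]).
  lsw 4 (rewrite act_twist_mulr).
  rewrite tlift_exch.
  lsw 1 (rewrite -(coact_twist_copK (F := fun b'' a1 a2 =>
    mul H (jV (ant HV b'')) (mK (ant HK a1) a2 ⊗ _))); [|lin]).
  lsw 2 (rewrite -(linear_tliftE (f := fun u => mul H (jV _) (u ⊗ _))); [|lin]).
  lsw 2 (rewrite aKl tensZl (bilinZr _ _ _ bmH)).
  lsw 2 (rewrite bosonisation_mul_jV).
  transitivity (Sw (b1, b2) <- cop HV b;
    jV (mV (ant HV (Sw (b', a') <- T a b1; eps HK a' *: b')) b2)).
    apply: eq_tlift => b1 b2.
    rewrite (linear_tliftE (f := fun u => jV (mV (ant HV u) b2))); last by lin.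
    apply: eq_tlift => x y.
    by rewrite (linear_Z _ _ lantV) (bilinZl _ _ _ bmV) tensZr.
  lsw 1 (rewrite coact_twist_epsK (linear_Z _ _ lantV) (bilinZl _ _ _ bmV) tensZr).
  rewrite -(linear_tliftE (f := fun u => eps HK a *: jV u)); last by lin.
  by rewrite aVl tensZr scalerA.
- apply: tensor_ext; [lin | lin | move=> a b].
  rewrite bosonisation_copE bosonisation_epsE !tlift_tlift; try by lin.
  lsw 1 (rewrite tlift_tlift; [|lin]); lsw 2 (rewrite tlift_tlift; [|lin]).
  lsw 3 (rewrite tliftE; [|lin]).
  lsw 3 (rewrite bosonisation_antipodeE (linear_tliftE (f := mul H _)); [|lin]).
  lsw 4 (rewrite act_twist_mull).
  lsw 1 (rewrite -(coact_twist_copV (F := fun b1 b2 a'' =>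
    mul H (_ ⊗ mV b1 (ant HV b2)) (jK (ant HK a'')))); [|lin]).
  lsw 2 (rewrite -(linear_tliftE (f := fun u => mul H (_ ⊗ u) _)); [|lin]).
  lsw 2 (rewrite aVr tensZr (bilinZl _ _ _ bmH)).
  transitivity (Sw (a1, a2) <- cop HK a;
    jK (mK a1 (ant HK (Sw (b', a') <- T a2 b; eps HV b' *: a')))).
    apply: eq_tlift => a1 a2.
    rewrite (linear_tliftE (f := fun u => jK (mK a1 (ant HK u)))); last by lin.
    apply: eq_tlift => x y.
    by rewrite (linear_Z _ _ lantK) (bilinZr _ _ _ bmK) tensZl bosonisation_mul_jK.
  lsw 1 (rewrite coact_twist_epsV (linear_Z _ _ lantK) (bilinZr _ _ _ bmK) tensZl).
  rewrite -(linear_tliftE (f := fun u => eps HV b *: jK u)); last by lin.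
  by rewrite aKr tensZl scalerA mulrC.
Qed.

(** The biproduct theorem of Radford and Majid, in the category of super spaces. *)
Theorem bosonisation_super_hopf : @super_hopf k (stensor K V) H.
Proof.
split; [exact: algH | exact: bosonisation_coalgebra | exact: bosonisation_cop_alg
  | exact: bosonisation_eps_alg | exact: bosonisation_is_antipode].
Qed.
End Bosonisation.

(** * Purely even spaces and the ordinary biproduct *)

Section PurelyEven.
Variable k : fieldType.
Implicit Types A B W : lmodType k.

Lemma homog_even A (a : purely_even A) : homog false a.
Proof. by []. Qed.

Lemma super_space_even A : super_space (purely_even A).
Proof.
split=> [p|p q v|v]; last by rewrite /= addr0.
  by case: p; [exact: linear_cst0 | exact: linear_id].
by case: p; case: q.
Qed.

Lemma ksign_even A p (a : purely_even A) : ksign p a = a.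
Proof. by rewrite (ksign_homog _ (super_space_even A) (homog_even a)) muln0 scale1r. Qed.

(** The projections of the tensor product of purely even spaces are those of a
    purely even space, but not by definition. *)
Lemma stensor_part_even A B :
  @part k (stensor (purely_even A) (purely_even B)) = @part k (purely_even (tensor A B)).
Proof.
apply/funext => p; apply/funext => t; rewrite /=.
case: p; [apply: tlift_eq0 | rewrite -[RHS]tlift_id; apply: eq_tlift] => v w;
  by rewrite big_bool /= ?tens0l ?tens0r ?addr0 ?add0r.
Qed.

Lemma eq_part_super_hopf W (p q : bool -> W -> W) (H : hopf W) : p = q ->
  @super_hopf k (@SuperSpace k W p) H -> @super_hopf k (@SuperSpace k W q) H.
Proof. by move=> ->. Qed.

Lemma super_hopf_even A B (H : hopf (tensor A B)) :
  @super_hopf k (stensor (purely_even A) (purely_even B)) H -> hopf_algebra H.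
Proof. exact: (eq_part_super_hopf (stensor_part_even A B)). Qed.

Lemma sw_copM A (HA : hopf A) (U : lmodType k) (F : A -> A -> U) x y :
  hopf_algebra HA -> bilin F ->
  tlift F (cop HA (mul HA x y)) =
  Sw (x1, x2) <- cop HA x; Sw (y1, y2) <- cop HA y; F (mul HA x1 y1) (mul HA x2 y2).
Proof.
move=> hA bF; have aA : @super_algebra k (purely_even A) HA by case: hA.
have [-> _] : alg_map HA (@stensor_alg k (purely_even A) (purely_even A) HA HA) (cop HA).
  by case: hA.
have sA := super_space_even A; have bA := super_algebra_bilin aA.
have bAA := bilin_stensor_mul aA aA.
move: (cop HA x); apply: tensor_ext; [by lin | by lin | move=> x1 x2].
rewrite (stensor_mul_tlift aA aA _ _ (homog_even (x2 : purely_even A))).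
rewrite tlift_tlift // [in RHS]tliftE; last by lin.
by apply: eq_tlift => y1 y2; rewrite tliftE // ksign_even.
Qed.

Section Antipode.
Variables (A : lmodType k) (HA : hopf A).
Hypothesis hA : hopf_algebra HA.
Let aA : @super_algebra k (purely_even A) HA. Proof. by case: hA. Qed.
Let cA : @super_coalgebra k (purely_even A) HA. Proof. by case: hA. Qed.
Let bA : bilin (mul HA). Proof. exact: (super_algebra_bilin aA). Qed.
Let lcA : linear (cop HA). Proof. by case: cA => -[]. Qed.
Let lSA : linear (ant HA). Proof. by case: hA => _ _ _ _ [[]]. Qed.
Let leA : linear (eps HA : A -> k^o). Proof. by case: cA => _ []. Qed.
Let mA : associative (mul HA). Proof. by case: aA. Qed.
Let m1l : left_id (one HA) (mul HA). Proof. by case: aA => _ _ _ _ []. Qed.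
Let m1r : right_id (one HA) (mul HA). Proof. by case: aA => _ _ _ _ []. Qed.
Let Sl v : (Sw (x, y) <- cop HA v; mul HA (ant HA x) y) = eps HA v *: one HA.
Proof. by case: hA => _ _ _ _ []. Qed.
Let Sr v : (Sw (x, y) <- cop HA v; mul HA x (ant HA y)) = eps HA v *: one HA.
Proof. by case: hA => _ _ _ _ []. Qed.
Let cul v : (Sw (x, y) <- cop HA v; eps HA x *: y) = v. Proof. by case: cA. Qed.
Let cur v : (Sw (x, y) <- cop HA v; eps HA y *: x) = v. Proof. by case: cA. Qed.
Let coas (U : lmodType k) (F : A -> A -> A -> U) v : trilin F ->
  (Sw (x, y) <- cop HA v; Sw (x1, x2) <- cop HA x; F x1 x2 y) =
  (Sw (x, y) <- cop HA v; Sw (y1, y2) <- cop HA y; F x y1 y2).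
Proof. by move=> tF; exact: (@sw_coassoc k (purely_even A) HA U F v cA tF). Qed.
#[local] Hint Extern 1 (bilin (mul _)) => exact: bA : lin.
#[local] Hint Extern 1 (GRing.linear_for _ (cop _)) => exact: lcA : lin.
#[local] Hint Extern 1 (GRing.linear_for _ (ant _)) => exact: lSA : lin.
#[local] Hint Extern 1 (GRing.linear_for _ (eps _)) => exact: leA : lin.

Lemma antipode1 : ant HA (one HA) = one HA.
Proof.
have [_ c1] : alg_map HA (@stensor_alg k (purely_even A) (purely_even A) HA HA) (cop HA).
  by case: hA.
have [_ e1] : @eps_alg_map k (purely_even A) HA by case: hA.
have := Sl (one HA); rewrite c1 e1 scale1r (tliftE (V := A) (W := A)); last by lin.
by rewrite m1r.
Qed.

(** Both sides are obtained from
    [S(x_(1) y_(1)) x_(2) y_(2) S(y_(3)) S(x_(3))], by cancelling the last four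
    factors or the first three. *)
Lemma antipodeM x y : ant HA (mul HA x y) = mul HA (ant HA y) (ant HA x).
Proof.
have [eM _] : @eps_alg_map k (purely_even A) HA by case: hA.
pose E x1 y1 x2 y2 x3 y3 := mul HA (ant HA (mul HA x1 y1))
  (mul HA (mul HA x2 (mul HA y2 (ant HA y3))) (ant HA x3)).
transitivity (Sw (x1, x') <- cop HA x; Sw (x2, x3) <- cop HA x';
  Sw (y1, y') <- cop HA y; Sw (y2, y3) <- cop HA y'; E x1 y1 x2 y2 x3 y3); rewrite /E.
  symmetry.
  lsw 3 (rewrite -(linear_tliftE (f := fun u => mul HA (ant HA (mul HA _ _))
    (mul HA (mul HA _ u) (ant HA _)))); [rewrite Sr (bilinZr _ _ _ bA) m1r (bilinZl _ _ _ bA) (bilinZr _ _ _ bA) -(bilinZl _ _ _ bA) -(linear_Z _ _ lSA) -(bilinZr _ _ _ bA)|lin]).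
  lsw 2 (rewrite -(linear_tliftE (f := fun u => mul HA (ant HA (mul HA _ u)) _)); [rewrite cur|lin]).
  lsw 1 (rewrite -(linear_tliftE (f := mul HA _)); [rewrite Sr (bilinZr _ _ _ bA) m1r -(linear_Z _ _ lSA) -(bilinZl _ _ _ bA)|lin]).
  by rewrite -(linear_tliftE (f := fun u => ant HA (mul HA u _))); [rewrite cur|lin].
(* The sum over [E] is regrouped so that [x1, x2] and [y1, y2] stem from one
   coproduct each, that is, from the coproduct of one product. *)
rewrite -(coas (F := fun x1 x2 x3 => Sw (y1, y') <- cop HA y; Sw (y2, y3) <- cop HA y';
   mul HA (ant HA (mul HA x1 y1)) (mul HA (mul HA x2 (mul HA y2 (ant HA y3))) (ant HA x3))));
  last by lin.
lsw 2 (rewrite -(coas (F := fun y1 y2 y3 =>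
   mul HA (ant HA (mul HA _ y1)) (mul HA (mul HA _ (mul HA y2 (ant HA y3))) (ant HA _)))); [|lin]).
lsw 1 (rewrite tlift_exch).
transitivity (Sw (x', x3) <- cop HA x; Sw (y', y3) <- cop HA y;
  Sw (x1, x2) <- cop HA x'; Sw (y1, y2) <- cop HA y';
  mul HA (mul HA (ant HA (mul HA x1 y1)) (mul HA x2 y2)) (mul HA (ant HA y3) (ant HA x3))).
  by do 4 into_sw; rewrite !mA.
lsw 2 (rewrite -(sw_copM (F := fun u v => mul HA (mul HA (ant HA u) v) _)); [|exact: hA|lin]).
lsw 2 (rewrite -(linear_tliftE (f := fun u => mul HA u _)); [rewrite Sl eM (bilinZl _ _ _ bA) m1l -scalerA -(bilinZl _ _ _ bA) -(linear_Z _ _ lSA)|lin]).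
lsw 1 (rewrite -(linear_tliftE (f := fun u => eps HA _ *: mul HA (ant HA u) _)); [rewrite cul -(bilinZr _ _ _ bA) -(linear_Z _ _ lSA)|lin]).
by rewrite -(linear_tliftE (f := fun u => mul HA _ (ant HA u))); [rewrite cul|lin].
Qed.

Section InverseAntipode.
Variable Si : A -> A.
Hypotheses (SK : cancel (ant HA) Si) (KS : cancel Si (ant HA)).

(** The inverse antipode is an antipode for the opposite product: apply the
    antipode, which reverses products, to both sides. *)
Lemma antipode_inv_l v : (Sw (x, y) <- cop HA v; mul HA y (Si x)) = eps HA v *: one HA.
Proof.
apply: (can_inj SK); rewrite (linear_tliftE _ _ lSA) (linear_Z _ _ lSA) antipode1 -Sr.
by apply: eq_tlift => x y; rewrite antipodeM KS.
Qed.

Lemma antipode_inv_r v : (Sw (x, y) <- cop HA v; mul HA (Si y) x) = eps HA v *: one HA.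
Proof.
apply: (can_inj SK); rewrite (linear_tliftE _ _ lSA) (linear_Z _ _ lSA) antipode1 -Sl.
by apply: eq_tlift => x y; rewrite antipodeM KS.
Qed.
End InverseAntipode.
End Antipode.

Section Biproduct.
Variables (A B : lmodType k) (HA : hopf A) (HB : hopf B) (cB : crossed B A).
Hypotheses (hA : hopf_algebra HA) (hB : braided_hopf_algebra HA HB cB).
Local Notation EA := (purely_even A).
Local Notation EB := (purely_even B).
Let aA : @super_algebra k EA HA := @algK k EA HA hA.
Let aB : @super_algebra k EB HB := @algV k EA EB HA HB cB hB.
Let mB : @crossed_module k EA HA EB cB := @modV k EA EB HA HB cB hB.
Let bA : bilin (mul HA). Proof. exact: (super_algebra_bilin aA). Qed.
Let bB : bilin (mul HB). Proof. exact: (super_algebra_bilin aB). Qed.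
Let bact : bilin (act cB). Proof. by case: mB => _ [[]]. Qed.
Let actM v a b : act cB (act cB v a) b = act cB v (mul HA a b).
Proof. by case: mB => _ []. Qed.
Let act1 v : act cB v (one HA) = v. Proof. by case: mB => _ []. Qed.
Let lcA : linear (cop HA). Proof. by case: hA => _ [[]]. Qed.
Let lcB : linear (cop HB). Proof. by case: hB => _ [[]]. Qed.
Let lco : linear (coact cB). Proof. by case: mB => _ _ [[]]. Qed.
Let lSA : linear (ant HA). Proof. by case: hA => _ _ _ _ [[]]. Qed.
Let lSB : linear (ant HB). Proof. by case: hB => _ _ _ _ [[]]. Qed.
Let leA : linear (eps HA : A -> k^o). Proof. by case: hA => _ [_ []]. Qed.
Let leB : linear (eps HB : B -> k^o). Proof. by case: hB => _ [_ []]. Qed.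
Let mA : associative (mul HA). Proof. by case: aA. Qed.
Let m1r : right_id (one HA) (mul HA). Proof. by case: aA => _ _ _ _ []. Qed.
#[local] Hint Extern 1 (bilin (mul _)) => first [exact: bA | exact: bB] : lin.
#[local] Hint Extern 1 (bilin (act _)) => exact: bact : lin.
#[local] Hint Extern 1 (GRing.linear_for _ (cop _)) => first [exact: lcA | exact: lcB] : lin.
#[local] Hint Extern 1 (GRing.linear_for _ (coact _)) => exact: lco : lin.
#[local] Hint Extern 1 (GRing.linear_for _ (ant _)) => first [exact: lSA | exact: lSB] : lin.
#[local] Hint Extern 1 (GRing.linear_for _ (eps _)) => first [exact: leA | exact: leB] : lin.

Local Notation S := (@bosonisation_antipode k EA EB HA HB cB).

Let act_twist_even b a :
  @act_twist k EA EB HA cB b a = Sw (a1, a2) <- cop HA a; a1 ⊗ act cB b a2.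
Proof.
rewrite (@act_twistE k EA EB HA HB cB hB false b a (homog_even b)).
by apply: eq_tlift => x y; rewrite ksign_even.
Qed.

Let coact_twist_even a b :
  @coact_twist k EA EB HA cB a b = Sw (b0, b1) <- coact cB b; b0 ⊗ mul HA a b1.
Proof.
rewrite (@coact_twistE k EA EB HA cB hA false a b (homog_even a)).
by apply: eq_tlift => x y; rewrite ksign_even.
Qed.

Lemma biproduct_mulE S' w h t g : mul (biproduct HA HB cB S') (w ⊗ h) (t ⊗ g) =
  Sw (t1, t2) <- cop HA t; mul HA w t1 ⊗ mul HB (act cB h t2) g.
Proof. by rewrite /= tliftE; [rewrite tliftE //|]; lin. Qed.

Lemma biproduct_copE S' w h : cop (biproduct HA HB cB S') (w ⊗ h) =
  Sw (w1, w2) <- cop HA w; Sw (h1, h2) <- cop HB h; Sw (h10, h11) <- coact cB h1;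
  (w1 ⊗ h10) ⊗ (mul HA w2 h11 ⊗ h2).
Proof. by rewrite /= tliftE //; lin. Qed.

Lemma bilin_biproduct_mul S' : bilin (mul (biproduct HA HB cB S')).
Proof. by rewrite /=; lin. Qed.

Lemma linear_biproduct_cop S' : linear (cop (biproduct HA HB cB S')).
Proof. by rewrite /=; lin. Qed.

Lemma biproduct_bosonisation :
  biproduct HA HB cB S = @super_bosonisation k EA EB HA HB cB S.
Proof.
have bm := bilin_bosonisation_mul hA hB; have lc := linear_bosonisation_cop hA hB.
have bm' := bilin_biproduct_mul S; have lc' := linear_biproduct_cop S.
rewrite [LHS]/(biproduct _ _ _ _) [RHS]/(super_bosonisation _ _ _ _).
congr (Hopf (Alg _ _)); apply/funext => x.
  apply/funext => y; rewrite -[LHS]/(mul (biproduct HA HB cB S) x y).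
  rewrite -[RHS]/(mul (@super_bosonisation k EA EB HA HB cB S) x y).
  move: x; apply: tensor_ext; [by lin | by lin | move=> w h].
  move: y; apply: tensor_ext; [by lin | by lin | move=> t g].
  rewrite biproduct_mulE (bosonisation_mulE hA hB) act_twist_even tlift_tlift; last by lin.
  by apply: eq_tlift => u v; rewrite tliftE //; lin.
rewrite -[LHS]/(cop (biproduct HA HB cB S) x).
rewrite -[RHS]/(cop (@super_bosonisation k EA EB HA HB cB S) x).
move: x; apply: tensor_ext; [by lin | by lin | move=> w h].
rewrite biproduct_copE.
rewrite (bosonisation_copE hA hB); apply: eq_tlift => w1 w2; apply: eq_tlift => h1 h2.
rewrite coact_twist_even tlift_tlift; last by lin.
by apply: eq_tlift => u v; rewrite tliftE //; lin.
Qed.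

Lemma biproduct_hopf : hopf_algebra (biproduct HA HB cB S).
Proof.
by rewrite biproduct_bosonisation; apply: super_hopf_even; apply: bosonisation_super_hopf.
Qed.

Let coas (U : lmodType k) (F : A -> A -> A -> U) v : trilin F ->
  (Sw (x, y) <- cop HA v; Sw (x1, x2) <- cop HA x; F x1 x2 y) =
  (Sw (x, y) <- cop HA v; Sw (y1, y2) <- cop HA y; F x y1 y2).
Proof. by move=> tF; exact: (@sw_coassoc k EA HA U F v (coalgK hA) tF). Qed.

(** The inverse sends [a ⊗ b] to [b ◁ S^-1(a_(2)) ⊗ a_(1)]. *)
Let bijective_act_twist : bijective (ant HA) -> bijective (tlift (@act_twist k EA EB HA cB)).
Proof.
case=> Si SK KS; have lSi := can_linear lSA SK KS.
have bR := @bilin_act_twist k EA EB HA HB cB hA hB.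
have cul v : (Sw (x, y) <- cop HA v; eps HA y *: x) = v by case: hA => _ [].
pose g a b := Sw (a1, a2) <- cop HA a; act cB b (Si a2) ⊗ a1.
have bg : bilin g by rewrite /g; lin.
exists (tlift g); apply: tensor_ext; try (by lin).
  move=> b a; rewrite tliftE // act_twist_even tlift_tlift //.
  lsw 1 (rewrite (tliftE _ _ bg) /g); lsw 2 (rewrite actM).
  rewrite (coas (F := fun x y z => act cB b (mul HA z (Si y)) ⊗ x)); last by lin.
  rewrite -[in RHS](cul a) (linear_tliftE (f := tens b)); last by lin.
  apply: eq_tlift => x y.
  rewrite -(linear_tliftE (f := fun u => act cB b u ⊗ x)); last by lin.
  by rewrite (antipode_inv_l hA SK KS) (bilinZr _ _ _ bact) act1 tensZl tensZr.
move=> a b; rewrite tliftE // /g tlift_tlift //.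
lsw 1 (rewrite (tliftE _ _ bR) act_twist_even).
lsw 2 (rewrite actM).
rewrite (coas (F := fun x y z => x ⊗ act cB b (mul HA (Si z) y))); last by lin.
rewrite -[in RHS](cul a) (linear_tliftE (f := fun u => u ⊗ b)); last by lin.
apply: eq_tlift => x y.
rewrite -(linear_tliftE (f := fun u => x ⊗ act cB b u)); last by lin.
by rewrite (antipode_inv_r hA SK KS) (bilinZr _ _ _ bact) act1 tensZl tensZr.
Qed.

(** The inverse sends [b ⊗ c] to [c S^-1(b^(1)) ⊗ b^(0)]. *)
Let bijective_coact_twist :
  bijective (ant HA) -> bijective (tlift (@coact_twist k EA EB HA cB)).
Proof.
case=> Si SK KS; have lSi := can_linear lSA SK KS.
have bT := @bilin_coact_twist k EA EB HA HB cB hA hB.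
have cuc v : (Sw (x, y) <- coact cB v; eps HA y *: x) = v by case: mB => _ _ [].
have coac (U : lmodType k) (F : B -> A -> A -> U) v : trilin F ->
  (Sw (v0, v1) <- coact cB v; Sw (v00, v01) <- coact cB v0; F v00 v01 v1) =
  (Sw (v0, v1) <- coact cB v; Sw (x, y) <- cop HA v1; F v0 x y).
  exact: (@sw_coact k EA EB HA HB cB hB U F v).
pose g b c := Sw (b0, b1) <- coact cB b; mul HA c (Si b1) ⊗ b0.
have bg : bilin g by rewrite /g; lin.
exists (tlift g); apply: tensor_ext; try (by lin).
  move=> a b; rewrite tliftE // coact_twist_even tlift_tlift //.
  lsw 1 (rewrite (tliftE _ _ bg) /g).
  rewrite (coac _ (fun x y z => mul HA (mul HA a z) (Si y) ⊗ x)); last by lin.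
  rewrite -[in RHS](cuc b) (linear_tliftE (f := tens a)); last by lin.
  apply: eq_tlift => x y; lsw 1 (rewrite -mA).
  rewrite -(linear_tliftE (f := fun u => mul HA a u ⊗ x)); last by lin.
  by rewrite (antipode_inv_l hA SK KS) (bilinZr _ _ _ bA) m1r tensZl tensZr.
move=> b c; rewrite tliftE // /g tlift_tlift //.
lsw 1 (rewrite (tliftE _ _ bT) coact_twist_even).
rewrite (coac _ (fun x y z => x ⊗ mul HA (mul HA c (Si z)) y)); last by lin.
rewrite -[in RHS](cuc b) (linear_tliftE (f := fun u => u ⊗ c)); last by lin.
apply: eq_tlift => x y; lsw 1 (rewrite -mA).
rewrite -(linear_tliftE (f := fun u => x ⊗ mul HA c u)); last by lin.
by rewrite (antipode_inv_r hA SK KS) (bilinZr _ _ _ bA) m1r tensZl tensZr.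
Qed.

Lemma biproduct_antipode_bijective :
  bijective (ant HA) -> bijective (ant HB) -> bijective S.
Proof.
move=> bijA bijB; have bR := @bilin_act_twist k EA EB HA HB cB hA hB.
apply: (eq_bij (bij_comp (bij_comp (bijective_act_twist bijA)
  (bijective_tmap lSB lSA bijB bijA)) (bijective_coact_twist bijA))) => x /=.
rewrite tlift_tmap // /bosonisation_antipode tlift_tlift //; lin.
Qed.
End Biproduct.
End PurelyEven.

(** * Graded spaces *)

Section GradedSpaces.
Variable k : fieldType.
Implicit Types U V W : graded k.

Lemma graded_super V : graded_space V -> super_space V.
Proof. by case. Qed.

Lemma linear_gpart V n : graded_space V -> linear (@gpart k V n).
Proof. by case. Qed.

Lemma hdeg_gpart V n (v : V) : graded_space V -> hdeg n (gpart n v).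
Proof. by case=> _ _ pp _ _; rewrite /hdeg pp eqxx. Qed.

Lemma gpart_hdeg V m n (v : V) :
  graded_space V -> hdeg n v -> gpart m v = if m == n then v else 0.
Proof. by case=> _ _ pp _ _ hv; rewrite -hv pp. Qed.

Lemma hdeg_homog V n (v : V) : graded_space V -> hdeg n v -> homog (odd n) v.
Proof. by case=> _ _ _ _; apply. Qed.

Lemma lin_closed_hdeg V n : graded_space V -> lin_closed (@hdeg k V n).
Proof. by move=> gV; apply: lin_closed_eq; [apply: linear_gpart|]. Qed.

Lemma hdegD V n (u v : V) : graded_space V -> hdeg n u -> hdeg n v -> hdeg n (u + v).
Proof. by move=> gV; apply: lin_closedD; apply: lin_closed_hdeg. Qed.

Lemma hdegZ V n c (v : V) : graded_space V -> hdeg n v -> hdeg n (c *: v).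
Proof.
move=> gV hv; rewrite -[_ *: _]addr0.
by case: (lin_closed_hdeg n gV) => h0 h; apply: h.
Qed.

Lemma graded_ind V (P : V -> Prop) : graded_space V -> lin_closed P ->
  (forall n v, hdeg n v -> P v) -> forall v, P v.
Proof.
move=> gV cP h v; have [_ _ _ sum _] := gV; have [N ->] := sum v.
by apply: lin_closed_sum => // i _; apply: (h i); apply: hdeg_gpart.
Qed.

Lemma ksign_hdeg V p n (v : V) : graded_space V -> hdeg n v ->
  ksign p v = (-1) ^+ (p * n) *: v.
Proof.
move=> gV hv; rewrite (ksign_homog _ (graded_super gV) (hdeg_homog gV hv)).
by case: p; rewrite ?mul0n // !mul1n signr_odd.
Qed.

Lemma hdeg_ksign V p n (v : V) : graded_space V -> hdeg n v -> hdeg n (ksign p v).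
Proof. by move=> gV hv; rewrite (ksign_hdeg _ gV hv); apply: hdegZ. Qed.

Lemma linear_gtensor_part V W n : graded_space V -> graded_space W ->
  linear (@gpart k (gtensor V W) n).
Proof.
move=> gV gW; have lV n' := linear_gpart n' gV; have lW n' := linear_gpart n' gW.
by apply: tlift_linear; split=> x; apply: linear_bigsum => i;
  [apply: (bilin_linear_l _ (tens_bilin _ _)) | apply: (bilin_linear_r _ (tens_bilin _ _))].
Qed.

Lemma gtensor_part_hdeg V W n i j (v : V) (w : W) : graded_space V -> graded_space W ->
  hdeg i v -> hdeg j w ->
  @gpart k (gtensor V W) n (v ⊗ w) = if n == (i + j)%N then v ⊗ w else 0.
Proof.
move=> gV gW hv hw.
have lV n' := linear_gpart n' gV; have lW n' := linear_gpart n' gW.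
rewrite /= tliftE; last first.
  by split=> x; apply: linear_bigsum => l;
  [apply: (bilin_linear_l _ (tens_bilin _ _)) | apply: (bilin_linear_r _ (tens_bilin _ _))].
have e l : gpart l v ⊗ gpart (n - l) w = if l == i then
    (if (n - l == j)%N then v ⊗ w else 0) else 0.
  rewrite (gpart_hdeg _ gV hv) (gpart_hdeg _ gW hw).
  by case: eqP => _; rewrite ?tens0l //; case: eqP => _; rewrite ?tens0r.
under eq_bigr do rewrite e; rewrite -big_mkcond /=.
case: (ltnP i n.+1) => hi.
  rewrite (big_pred1 (Ordinal hi)) //=.
  by rewrite -(eqn_add2l i) subnKC.
rewrite big_pred0 => [|l]; last by apply/negbTE; rewrite neq_ltn (leq_trans (ltn_ord l)).
by case: eqP => // e'; move: hi; rewrite e' ltnNge leq_addr.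
Qed.

Lemma gtensor_ind V W (P : tensor V W -> Prop) :
  graded_space V -> graded_space W -> lin_closed P ->
  (forall i j v w, hdeg i v -> hdeg j w -> P (v ⊗ w)) -> forall t, P t.
Proof.
move=> gV gW cP h; apply: tensor_ind => // v w.
move: v; apply: (graded_ind gV); first by apply: lin_closed_comp => //; lin.
move=> i v hv; move: w; apply: (graded_ind gW).
  by apply: lin_closed_comp => //; lin.
by move=> j w hw; apply: h hv hw.
Qed.

Lemma hdeg_tens V W i j (v : V) (w : W) : graded_space V -> graded_space W ->
  hdeg i v -> hdeg j w -> @hdeg k (gtensor V W) (i + j) (v ⊗ w).
Proof. by move=> gV gW hv hw; rewrite /hdeg (gtensor_part_hdeg _ gV gW hv hw) eqxx. Qed.

Lemma hdeg_gtensor_ind V W n (P : tensor V W -> Prop) :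
  graded_space V -> graded_space W -> lin_closed P ->
  (forall i j v w, hdeg i v -> hdeg j w -> (i + j)%N = n -> P (v ⊗ w)) ->
  forall t : tensor V W, @hdeg k (gtensor V W) n t -> P t.
Proof.
move=> gV gW cP h t <- /=; apply: lin_closed_sum => // x _.
apply: lin_closed_sum => // i _; apply: (h i (n - i)%N); try exact: hdeg_gpart.
by rewrite subnKC // -ltnS.
Qed.

(** Finiteness of the sum of components is proved for all large bounds at once, so
    that it passes to linear combinations. *)
Lemma graded_space_gtensor V W :
  graded_space V -> graded_space W -> graded_space (gtensor V W).
Proof.
move=> gV gW; have lp n := linear_gtensor_part n gV gW.
have sV := graded_super gV; have sW := graded_super gW.
split; [exact: super_space_stensor | exact: lp | move=> m n | | move=> n].
- apply: (gtensor_ind gV gW).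
    apply: lin_closed_eq; first exact: linear_comp.
    by case: (m == n); [exact: lp | exact: linear_cst0].
  move=> i j v w hv hw; rewrite !(gtensor_part_hdeg _ gV gW hv hw).
  case: (n =P _) => [->|_]; first by rewrite (gtensor_part_hdeg _ gV gW hv hw).
  by rewrite (linear_0 (lp m)); case: ifP.
- move=> t; suff [N h] : exists N, forall M, (N <= M)%N ->
      t = \sum_(n < M) @gpart k (gtensor V W) n t by exists N; apply: h.
  move: t; apply: (gtensor_ind gV gW).
    split; first by exists 0%N => M _; rewrite big1 // => i _; rewrite (linear_0 (lp i)).
    move=> c u v [N1 h1] [N2 h2]; exists (maxn N1 N2) => M; rewrite geq_max => /andP[l1 l2].
    rewrite {1}(h1 M l1) {1}(h2 M l2) scaler_sumr -big_split; apply: eq_bigr => i _.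
    by rewrite lp.
  move=> i j v w hv hw; exists (i + j).+1 => M hM.
  rewrite (bigD1 (Ordinal hM)) // (gtensor_part_hdeg _ gV gW hv hw) eqxx big1 => [|l].
    by rewrite /= addr0.
  by rewrite -val_eqE (gtensor_part_hdeg _ gV gW hv hw) => /negbTE ->.
- apply: hdeg_gtensor_ind => //.
    exact: (lin_closed_homog _ (super_space_stensor sV sW)).
  move=> i j v w hv hw <-; rewrite oddD.
  by apply: homog_tens => //; apply: hdeg_homog.
Qed.

Lemma hdeg_tlift V W U m n (F : V -> W -> U) (t : tensor V W) :
  graded_space V -> graded_space W -> graded_space U -> bilin F ->
  @hdeg k (gtensor V W) m t ->
  (forall i j v w, hdeg i v -> hdeg j w -> (i + j)%N = m -> hdeg n (F v w)) ->
  hdeg n (tlift F t).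
Proof.
move=> gV gW gU bF ht h.
apply: (hdeg_gtensor_ind (P := fun t => hdeg n (tlift F t)) gV gW _ _ ht).
  by apply: lin_closed_comp; [apply: lin_closed_hdeg | lin].
by move=> i j v w hv hw ij; rewrite tliftE //; apply: h ij.
Qed.

(** The parity is the degree modulo two, so that the graded Leibniz rule is the
    Leibniz rule with the parity operator. *)
Lemma dga_odd_derivation V (aV : alg V) (d : V -> V) : dga aV d -> odd_derivation aV d.
Proof.
move=> [gV [[sV [bV _] _ _ _] _ _] [ld hd _] Ld].
have lk := linear_ksign true sV; have lp p := linear_part p sV.
split; last first.
  move=> v w; move: v; apply: (graded_ind gV); first by apply: lin_closed_eq; lin.
  by move=> n v hv; rewrite (Ld n) // (ksign_hdeg _ gV hv) mul1n bilinZl.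
split=> // p v hv; rewrite /homog -{2}hv; move: (v) => {hv}{}v.
move: v; apply: (graded_ind gV); first by apply: lin_closed_eq; lin.
move=> n v hv; rewrite (part_homog _ sV (hdeg_homog gV (hd _ _ hv))).
rewrite (part_homog _ sV (hdeg_homog gV hv)) /=.
by case: p; case: (odd n); rewrite //= (linear_0 ld).
Qed.

Lemma dga_one V (aV : alg V) d : dga aV d -> d (one aV) = 0.
Proof.
move=> [gV [[_ [bV _] _ _ [l1 r1]] _ h1] _ Ld].
have := Ld _ _ (one aV) h1; rewrite l1 l1 r1 expr0 scale1r => e.
by apply: (addrI (d (one aV))); rewrite addr0 -e.
Qed.

Lemma tdiff_tmap V V' W W' (dV : V -> V) (dV' : V' -> V') (dW : W -> W) (dW' : W' -> W')
    (f : V -> V') (g : W -> W') t :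
  super_space V -> super_space V' -> super_space W -> super_space W' ->
  odd_map dV -> odd_map dV' -> odd_map dW -> odd_map dW' -> super_map f -> super_map g ->
  (forall v, f (dV v) = dV' (f v)) -> (forall w, g (dW w) = dW' (g w)) ->
  tdiff dV' dW' (tmap f g t) = tmap f g (tdiff dV dW t).
Proof.
move=> sV sV' sW sW' oV oV' oW oW' sf [lg _] fd gd; have [lf _] := sf.
have l1 := linear_tdiff sV sW oV oW; have l2 := linear_tdiff sV' sW' oV' oW'.
move: t; apply: tensor_ext; [lin | lin | move=> v w].
rewrite tmapE // !tdiffE // (linear_D _ _ (linear_tmap lf lg)) !tmapE // fd gd.
by rewrite (super_map_ksign _ _ sV sV' sf).
Qed.

End GradedSpaces.

(** * The differential of the bosonisation *)

Section BosonisationDGA.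
Variables (k : fieldType) (OA OB : graded k).
Variables (HA : hopf OA) (HB : hopf OB) (cB : crossed OB OA) (dA : OA -> OA) (dB : OB -> OB).
Hypotheses (hA : super_hopf HA) (hB : braided_hopf HA HB cB).
Hypotheses (DA : dga HA dA) (DB : dga HB dB).
Hypotheses (gcA : gr_map (cop HA : OA -> gtensor OA OA))
  (gcB : gr_map (cop HB : OB -> gtensor OB OB))
  (gco : gr_map (coact cB : OB -> gtensor OB OA))
  (gact : gr_bimap (act cB : OB -> OA -> OB)).
Hypotheses (dcA : forall w, cop HA (dA w) = tdiff dA dA (cop HA w))
  (dcB : forall h, cop HB (dB h) = tdiff dB dB (cop HB h))
  (dco : forall h, coact cB (dB h) = tdiff dB dA (coact cB h))
  (dact : forall n h w, hdeg n h ->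
     dB (act cB h w) = act cB (dB h) w + (-1) ^+ n *: act cB h (dA w)).

Local Notation R := (act_twist HA cB).
Local Notation T := (coact_twist HA cB).
Local Notation H :=
  (@super_bosonisation k OA OB HA HB cB (bosonisation_antipode HA HB cB)).
Local Notation HH := (@stensor_alg k (stensor OA OB) (stensor OA OB) H H).
Local Notation jK w := (w ⊗ one HB).
Local Notation jV h := (one HA ⊗ h).
Local Notation d := (tdiff dA dB).
Local Notation dd := (@tdiff k (gtensor OA OB) (gtensor OA OB) d d).

Let gA : graded_space OA. Proof. by case: DA. Qed.
Let gB : graded_space OB. Proof. by case: DB. Qed.
Let gH : graded_space (gtensor OA OB). Proof. exact: graded_space_gtensor. Qed.
Let sA := graded_super gA.
Let sB := graded_super gB.
Let sH : super_space (stensor OA OB). Proof. exact: super_space_stensor. Qed.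
Let aA : super_algebra HA. Proof. by case: hA. Qed.
Let aB : super_algebra HB := algV hB.
Let aH : @super_algebra k (stensor OA OB) H := bosonisation_algebra hA hB.
Let aHH : @super_algebra k _ HH := stensor_alg_super aH aH.
Let bA := super_algebra_bilin aA.
Let bB := super_algebra_bilin aB.
Let bH : bilin (mul H) := super_algebra_bilin aH.
Let bHH : bilin (mul HH) := super_algebra_bilin aHH.
Let sact : super_bimap (act cB : OB -> OA -> OB). Proof. by case: (modV hB) => _ []. Qed.
Let bact : bilin (act cB). Proof. by case: sact. Qed.
Let lcA : linear (cop HA). Proof. by case: hA => _ [[]]. Qed.
Let lcB : linear (cop HB). Proof. by case: (coalgV hB) => -[]. Qed.
Let scoact : super_map (coact cB : OB -> stensor OB OA). Proof. by case: (modV hB) => _ _ []. Qed.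
Let lco : linear (coact cB). Proof. by case: scoact. Qed.
Let scH : super_map (cop H : stensor OA OB -> stensor (stensor OA OB) (stensor OA OB)).
Proof. by case: (bosonisation_coalgebra hA hB). Qed.
Let lcH : linear (cop H). Proof. by case: scH. Qed.
Let oA : odd_map dA := (dga_odd_derivation DA).1.
Let oB : odd_map dB := (dga_odd_derivation DB).1.
Let ldA : linear dA := oA.1.
Let ldB : linear dB := oB.1.
Let od : odd_map (d : stensor OA OB -> stensor OA OB) := odd_map_tdiff sA sB oA oB.
Let ld : linear d := od.1.
Let lddd : linear dd := @linear_tdiff k (gtensor OA OB) (gtensor OA OB) d d sH sH od od.
Let bR : bilin R := bilin_act_twist hA hB.
Let bT : bilin T := bilin_coact_twist hA hB.
#[local] Hint Extern 1 (bilin (mul _)) =>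
  first [exact: bA | exact: bB | exact: bH | exact: bHH] : lin.
#[local] Hint Extern 1 (bilin (act _)) => exact: bact : lin.
#[local] Hint Extern 1 (bilin (act_twist _ _)) => exact: bR : lin.
#[local] Hint Extern 1 (bilin (coact_twist _ _)) => exact: bT : lin.
#[local] Hint Extern 1 (GRing.linear_for _ (cop _)) =>
  first [exact: lcA | exact: lcB | exact: lcH] : lin.
#[local] Hint Extern 1 (GRing.linear_for _ (coact _)) => exact: lco : lin.
#[local] Hint Extern 1 (GRing.linear_for _ (tdiff _ _)) =>
  first [exact: ld | exact: lddd | apply: linear_tdiff] : lin.

(** The differential is a derivation of the action and a coderivation of the
    coproduct of [Omega(A)]. *)
Lemma diff_act_twist h t :
  d (R h t) = R (dB h) t + R (ksign true h) (dA t).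
Proof.
move: h; apply: (super_ind sB) => [|p h hh]; first by apply: lin_closed_eq; lin.
have dactE w : dB (act cB h w) = act cB (dB h) w + act cB (ksign true h) (dA w).
  move: (h); apply: (graded_ind gB); first by apply: lin_closed_eq; lin.
  by move=> n u hu; rewrite (dact _ hu) (ksign_hdeg _ gB hu) mul1n bilinZl.
rewrite (act_twistE hB _ hh) (act_twistE hB _ (oB.2 _ _ hh)).
rewrite (act_twistE hB _ (homog_ksign true sB hh)) dcA [in RHS]tdiff_tlift // [in RHS]tlift_tlift; last by lin.
rewrite -tlift_add (linear_tliftE _ _ ld); apply: eq_tlift => x y.
have bG : bilin (fun (u v : OA) => ksign p u ⊗ act cB (ksign true h) v) by lin.
rewrite (linear_D _ _ (tlift_linear bG)) !tliftE // tdiffE // dactE tensDr.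
rewrite (odd_map_ksign p x sA oA) !(ksign_homog true sB hh) !(bilinZl _ _ _ bact) mul1n.
rewrite !ksignK // addbT addTb tensZl !tensZr scalerA -exprD.
have -> : (-1) ^+ (p + p)%N = 1 :> k by rewrite addnn -signr_odd odd_double.
by rewrite scale1r addrCA.
Qed.

Lemma odd_derivation_bosonisation : @odd_derivation k (stensor OA OB) H d.
Proof.
split; first exact: od.
have DMA := (dga_odd_derivation DA).2; have DMB := (dga_odd_derivation DB).2.
have lk := linear_ksign true sH.
move=> x y; move: x; apply: tensor_ext; [lin | lin | move=> w h].
move: y; apply: tensor_ext; [lin | lin | move=> t g].
have mE := bosonisation_mulE hA hB.
rewrite mE (linear_tliftE _ _ ld) ksign_tens // !tdiffE //.
rewrite (bilinDl _ _ _ bH) (bilinDr _ _ _ bH) !mE.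
(* [P] and [Q] multiply by [± w] on the left and by [g] or [dB g] on the right;
   the two middle terms of the Leibniz rule are [P] of [diff_act_twist]. *)
pose P u := Sw (x, y) <- u; mul HA (ksign true w) x ⊗ mul HB y g.
pose Q u := Sw (x, y) <- u; mul HA (ksign true w) x ⊗ mul HB y (dB g).
have lP : linear P by rewrite /P; lin.
have e1 := congr1 P (diff_act_twist h t); rewrite (linear_D _ _ lP) in e1.
transitivity ((Sw (x, y) <- R h t; mul HA (dA w) x ⊗ mul HB y g) +
    (P (d (R h t)) + Q (@ksign k (stensor OA OB) true (R h t)))).
  rewrite [d (R h t)]tdiff_tlift // (linear_tliftE _ _ lP) /Q tlift_ksign //; last by lin.
  rewrite -!tlift_add; apply: eq_tlift => v u.
  rewrite (linear_D _ _ lP) /P !tliftE; try by lin.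
  by rewrite tdiffE // DMA DMB tensDl tensDr ksign_mul // -!addrA.
rewrite e1 -addrA -(super_bimap_ksign _ _ _ _ _ _ (super_bimap_act_twist hA hB)) //.
by rewrite -addrA.
Qed.

Let odH := odd_derivation_bosonisation.

Lemma odd_derivation_stensor_bosonisation :
  @odd_derivation k (stensor (stensor OA OB) (stensor OA OB)) HH dd.
Proof. exact: (@odd_derivation_tdiff k (gtensor OA OB) (gtensor OA OB) H H d d aH aH odH odH). Qed.
Let odHH := odd_derivation_stensor_bosonisation.

Let dA1 : dA (one HA) = 0. Proof. exact: dga_one DA. Qed.
Let dB1 : dB (one HB) = 0. Proof. exact: dga_one DB. Qed.

Let d_jK w : d (jK w) = jK (dA w).
Proof. by rewrite tdiffE // dB1 tens0r addr0. Qed.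

Let d_jV h : d (jV h) = jV (dB h).
Proof. by rewrite tdiffE // dA1 tens0l add0r (ksign_one _ aA). Qed.

Let h1A : homog false (one HA). Proof. by case: aA. Qed.
Let h1B : homog false (one HB). Proof. by case: aB. Qed.
Let super_jK : super_map (fun w : OA => jK w : stensor OA OB) := super_map_jK hA hB.
Let super_jV : super_map (fun h : OB => jV h : stensor OA OB) := super_map_jV hA hB.
Let ksign_jK p w : @ksign k (stensor OA OB) p (jK w) = jK (ksign p w).
Proof. by rewrite ksign_tens // (ksign_one _ aB). Qed.

Let cop_diff_jK w : cop H (d (jK w)) = dd (cop H (jK w)).
Proof.
rewrite d_jK !(bosonisation_cop_jK hA hB) dcA.
symmetry; exact: (@tdiff_tmap k OA (gtensor OA OB) OA (gtensor OA OB) dA d dA d).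
Qed.

Let cop_diff_jV h : cop H (d (jV h)) = dd (cop H (jV h)).
Proof.
pose DD : tensor OB OA -> tensor (tensor OA OB) (tensor OA OB) :=
  tmap (fun h : OB => jV h) (fun w : OA => jK w).
have lDD : linear DD by apply: linear_tmap; lin.
have sHH := super_space_stensor sH sH.
have sDD : super_map (DD \o coact cB : OB -> stensor (stensor OA OB) (stensor OA OB)).
  have [_ hD] := super_map_tmap sB sH sA sH super_jV super_jK.
  by split=> [|p v hv]; [exact: linear_comp | apply: hD; apply: scoact.2].
have bG : bilin (fun (x y : OB) => mul HH (DD (coact cB x)) ((one HA ⊗ one HB) ⊗ jV y)) by lin.
rewrite d_jV !(bosonisation_cop_jV hA hB) -/DD dcB [in LHS]tdiff_tlift // (linear_tliftE _ _ (tlift_linear bG)).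
rewrite (linear_tliftE _ _ lddd); apply: eq_tlift => x y.
rewrite (linear_D _ _ (tlift_linear bG)) !tliftE // odHH.2 dco.
rewrite -(super_map_ksign true x sB sHH sDD) /=; congr (mul HH _ _ + mul HH _ _).
  symmetry; exact: (@tdiff_tmap k OB (gtensor OA OB) OA (gtensor OA OB) dB d dA d).
have d1 : d (one HA ⊗ one HB) = 0 by rewrite d_jK dA1 tens0l.
have k1 : @ksign k (stensor OA OB) true (one HA ⊗ one HB) = one HA ⊗ one HB.
  by rewrite ksign_jK (ksign_one _ aA).
by rewrite (@tdiffE k (gtensor OA OB) (gtensor OA OB)) // d1 tens0l add0r k1 d_jV.
Qed.

(** Both sides are odd derivations along the algebra map given by the coproduct, and
    they agree on [Omega(A)] and on [Omega(B)].  On [Omega(B)] this combines the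
    coderivation property of the braided coproduct with the differentiability of
    the coaction. *)
Lemma bosonisation_cop_diff x : cop H (d x) = dd (cop H x).
Proof.
have [cM _] := bosonisation_cop_alg hA hB.
move: x; apply: tensor_ext; [lin | lin | move=> w h].
have -> : w ⊗ h = mul H (jK w) (jV h).
  by rewrite (bosonisation_mul_jK hA hB); case: aA aB => _ _ _ _ [_ ->].
rewrite odH.2 (linear_D _ _ lcH) !cM odHH.2 cop_diff_jK cop_diff_jV.
by rewrite (super_map_ksign true _ sH _ scH) //; apply: super_space_stensor.
Qed.

Let gmA : gr_bimap (mul HA). Proof. by case: DA => _ []. Qed.
Let gmB : gr_bimap (mul HB). Proof. by case: DB => _ []. Qed.

Let gr_act_twist m n h t : hdeg m h -> hdeg n t -> @hdeg k (gtensor OA OB) (m + n) (R h t).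
Proof.
move=> hh ht; rewrite (act_twistE hB _ (hdeg_homog gB hh)).
apply: (hdeg_tlift (U := gtensor OA OB) gA gA gH _ (gcA ht)); first by lin.
move=> i j x y hx hy <-; rewrite addnCA; apply: hdeg_tens => //; first exact: hdeg_ksign.
exact: gact.
Qed.

Let gr_coact_twist m n a b : hdeg m a -> hdeg n b -> @hdeg k (gtensor OB OA) (m + n) (T a b).
Proof.
move=> ha hb; rewrite (coact_twistE cB hA _ (hdeg_homog gA ha)).
apply: (hdeg_tlift (U := gtensor OB OA) gB gA _ _ (gco hb)).
- exact: graded_space_gtensor.
- by lin.
move=> i j x y hx hy <-; rewrite addnCA; apply: hdeg_tens => //; first exact: hdeg_ksign.
exact: gmA.
Qed.

Lemma bosonisation_dga : @dga k (gtensor OA OB) H d.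
Proof.
have [_ [_ _ h1]  [_ hdA dA2] _] := DA; have [_ [_ _ h1'] [_ hdB dB2] _] := DB.
split=> //.
- split=> //; last exact: (hdeg_tens gA gB h1 h1').
  move=> m n x y hx hy; move: x hx; apply: (hdeg_gtensor_ind gA gB).
    by apply: (lin_closed_comp (lin_closed_hdeg _ gH)); lin.
  move=> i j w h hw hh <-; move: y hy; apply: (hdeg_gtensor_ind gA gB).
    by apply: (lin_closed_comp (lin_closed_hdeg _ gH)); lin.
  move=> i' j' t g ht hg <-; rewrite (bosonisation_mulE hA hB).
  apply: (hdeg_tlift (U := gtensor OA OB) gA gB gH _ (gr_act_twist hh ht)); first by lin.
  move=> l l' x y hx hy e.
  have -> : (i + j + (i' + j') = (i + l) + (l' + j'))%N.
    by rewrite addnA -(addnA i) -e !addnA.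
  by apply: hdeg_tens => //; [apply: gmA | apply: gmB].
- split=> //; last exact: tdiff_tdiff.
  move=> n x hx; move: x hx; apply: (hdeg_gtensor_ind gA gB).
    by apply: (lin_closed_comp (lin_closed_hdeg _ gH)); lin.
  move=> i j w h hw hh <-; rewrite tdiffE //; apply: (hdegD gH).
    by rewrite -addSn; apply: hdeg_tens => //; apply: hdA.
  by rewrite -addnS; apply: hdeg_tens => //; [apply: hdeg_ksign | apply: hdB].
- move=> n x y hx; rewrite odH.2 (ksign_hdeg true gH hx) mul1n.
  by rewrite (bilinZl _ _ _ bH).
Qed.

Lemma bosonisation_gr_cop :
  @gr_map k (gtensor OA OB) (gtensor (gtensor OA OB) (gtensor OA OB)) (cop H).
Proof.
have gHH : graded_space (gtensor (gtensor OA OB) (gtensor OA OB)).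
  exact: graded_space_gtensor.
move=> n x hx; move: x hx; apply: (hdeg_gtensor_ind gA gB).
  by apply: (lin_closed_comp (lin_closed_hdeg _ gHH)); lin.
move=> i j w h hw hh <-; rewrite (bosonisation_copE hA hB).
apply: (hdeg_tlift (U := gtensor (gtensor OA OB) (gtensor OA OB)) gA gA gHH _ (gcA hw)).
  by lin.
move=> i1 i2 w1 w2 hw1 hw2 <-.
apply: (hdeg_tlift (U := gtensor (gtensor OA OB) (gtensor OA OB)) gB gB gHH _ (gcB hh)).
  by lin.
move=> j1 j2 h1 h2 hh1 hh2 <-.
apply: (hdeg_tlift (U := gtensor (gtensor OA OB) (gtensor OA OB)) gB gA gHH _
  (gr_coact_twist hw2 hh1)); first by lin.
move=> l l' x y hx hy e.
have -> : (i1 + i2 + (j1 + j2) = (i1 + l) + (l' + j2))%N.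
  by rewrite addnA -(addnA i1) -e !addnA.
by apply: hdeg_tens => //; apply: hdeg_tens.
Qed.

End BosonisationDGA.

(** * The exterior algebra of the biproduct *)

(** Over a field an injection has a retraction, but here it needs no basis: the
    projection onto degree zero lands in the image of the algebra. *)
Lemma exterior_retraction (k : fieldType) (A : lmodType k) (aA : alg A) (O : graded k)
    (aO : alg O) (d : O -> O) (emb : A -> O) : exterior_algebra aA aO d emb ->
  exists2 r : O -> A, linear r & forall a, r (emb a) = a.
Proof.
move=> [[gO _ _ _] [lemb iemb _ h0] _ _].
have /choice[r hr] w : exists a, gpart 0 w = emb a by apply/h0; apply: hdeg_gpart.
exists r => [c u v|a]; apply: iemb; rewrite -hr.
  by rewrite lemb -!hr (linear_gpart 0 gO).
by apply/h0; exists a.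
Qed.

Section BosonisationExterior.
Variables (k : fieldType) (A B : lmodType k) (HA : hopf A) (HB : hopf B) (cB : crossed B A).
Variables (OA OB : graded k) (HOA : hopf OA) (HOB : hopf OB) (cOB : crossed OB OA).
Variables (dA : OA -> OA) (dB : OB -> OB) (embA : A -> OA) (embB : B -> OB).
Hypotheses (hA : hopf_algebra HA) (hB : braided_hopf_algebra HA HB cB).
Hypotheses (hOA : super_hopf HOA) (hOB : braided_hopf HOA HOB cOB).
Hypotheses (EA : exterior_algebra HA HOA dA embA) (EB : exterior_algebra HB HOB dB embB).
Hypotheses (ecA : forall a, cop HOA (embA a) = tmap embA embA (cop HA a))
  (ecB : forall b, cop HOB (embB b) = tmap embB embB (cop HB b))
  (eco : forall b, coact cOB (embB b) = tmap embB embA (coact cB b))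
  (eact : forall b a, act cOB (embB b) (embA a) = embB (act cB b a)).

Local Notation H := (@super_bosonisation k OA OB HOA HOB cOB (bosonisation_antipode HOA HOB cOB)).
Local Notation d := (tdiff dA dB).
Hypothesis DH : @dga k (gtensor OA OB) H d.
Variable S : tensor A B -> tensor A B.
Local Notation bip := (biproduct HA HB cB S).
Local Notation emb := (tmap embA embB).

Let DA : dga HOA dA. Proof. by case: EA. Qed.
Let DB : dga HOB dB. Proof. by case: EB. Qed.
Let gA : graded_space OA. Proof. by case: DA. Qed.
Let gB : graded_space OB. Proof. by case: DB. Qed.
Let gH : graded_space (gtensor OA OB). Proof. by case: DH. Qed.
Let sA := graded_super gA.
Let sB := graded_super gB.
Let lA : linear embA. Proof. by case: EA => _ []. Qed.
Let lB : linear embB. Proof. by case: EB => _ []. Qed.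
Let embAM x y : embA (mul HA x y) = mul HOA (embA x) (embA y).
Proof. by case: EA => _ [_ _ []]. Qed.
Let embBM x y : embB (mul HB x y) = mul HOB (embB x) (embB y).
Proof. by case: EB => _ [_ _ []]. Qed.
Let embA1 : embA (one HA) = one HOA. Proof. by case: EA => _ [_ _ []]. Qed.
Let embB1 : embB (one HB) = one HOB. Proof. by case: EB => _ [_ _ []]. Qed.
Let hdegA w : hdeg 0 w <-> exists a, w = embA a. Proof. by case: EA => _ []. Qed.
Let hdegB w : hdeg 0 w <-> exists b, w = embB b. Proof. by case: EB => _ []. Qed.
Let embA0 a : hdeg 0 (embA a). Proof. by apply/hdegA; exists a. Qed.
Let embB0 b : hdeg 0 (embB b). Proof. by apply/hdegB; exists b. Qed.
Let oA : odd_map dA := (dga_odd_derivation DA).1.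
Let oB : odd_map dB := (dga_odd_derivation DB).1.
Let ldA : linear dA := oA.1.
Let ldB : linear dB := oB.1.
Let ld : linear d := linear_tdiff sA sB oA oB.
Let aA : super_algebra HOA. Proof. by case: hOA. Qed.
Let aB : super_algebra HOB := algV hOB.
Let bA := super_algebra_bilin aA.
Let bB := super_algebra_bilin aB.
Let bH : bilin (mul H) := bilin_bosonisation_mul hOA hOB.
Let bact : bilin (act cOB). Proof. by case: (modV hOB) => _ [[]]. Qed.
Let lcH : linear (cop H) := linear_bosonisation_cop hOA hOB.
Let bR := bilin_act_twist hOA hOB.
Let bT := bilin_coact_twist hOA hOB.
Let lemb : linear emb. Proof. exact: linear_tmap. Qed.
#[local] Hint Extern 1 (bilin (mul _)) =>
  first [exact: bA | exact: bB | exact: bH | exact: (bilin_biproduct_mul hA hB)] : lin.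
#[local] Hint Extern 1 (GRing.linear_for _ (cop _)) =>
  first [exact: lcH | exact: (linear_biproduct_cop hA hB)] : lin.
#[local] Hint Extern 1 (GRing.linear_for _ (tmap _ _)) => exact: lemb : lin.

#[local] Hint Extern 1 (bilin (act _)) => exact: bact : lin.
#[local] Hint Extern 1 (bilin (coact_twist _ _)) => exact: bT : lin.

Let embE a b : emb (a ⊗ b) = embA a ⊗ embB b.
Proof. exact: tmapE. Qed.

Lemma biproduct_emb_alg : @alg_map k (tensor A B) (tensor OA OB) bip H emb.
Proof.
split; last by rewrite embE embA1 embB1.
move=> x y; move: x; apply: tensor_ext; [lin | lin | move=> a b].
move: y; apply: tensor_ext; [lin | lin | move=> c e].
rewrite (biproduct_mulE hA hB) !embE (bosonisation_mulE hOA hOB).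
rewrite (act_twistE hOB _ (hdeg_homog gB (embB0 b))) ecA.
rewrite tlift_tlift; last by lin.
rewrite tlift_tmap //; last by lin.
rewrite (linear_tliftE _ _ lemb); apply: eq_tlift => x y.
by rewrite embE tliftE ?ksign0 ?embAM ?embBM ?eact //; lin.
Qed.

Lemma biproduct_emb_cop x : cop H (emb x) = tmap emb emb (cop bip x).
Proof.
have lee : linear (tmap emb emb) by apply: linear_tmap.
move: x; apply: tensor_ext; [lin | lin | move=> a b].
rewrite (biproduct_copE hA hB) embE (bosonisation_copE hOA hOB) ecA ecB.
rewrite tlift_tmap //; last by lin.
rewrite (linear_tliftE _ _ lee); apply: eq_tlift => a1 a2.
rewrite tlift_tmap //; last by lin.
rewrite (linear_tliftE _ _ lee); apply: eq_tlift => b1 b2.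
rewrite (coact_twistE cOB hOA _ (hdeg_homog gA (embA0 a2))) eco tlift_tlift; last by lin.
rewrite tlift_tmap //; last by lin.
rewrite (linear_tliftE _ _ lee); apply: eq_tlift => x y.
by rewrite tliftE ?tmapE ?embE ?ksign0 ?embAM //; lin.
Qed.

Lemma biproduct_emb_inj : injective emb.
Proof.
have [rA lrA rAK] := exterior_retraction EA; have [rB lrB rBK] := exterior_retraction EB.
apply: (can_inj (g := tmap rA rB)); apply: tensor_ext; [|by lin|move=> a b].
  by apply: linear_comp => //; apply: linear_tmap.
by rewrite embE tmapE // rAK rBK.
Qed.

Lemma hdeg0_gtensor (w : gtensor OA OB) : hdeg 0 w <-> exists x, w = emb x.
Proof.
split=> [hw|[x ->]].
  move: w hw; apply: (hdeg_gtensor_ind gA gB).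
    split; first by exists 0; rewrite (linear_0 lemb).
    by move=> c u v [x ->] [y ->]; exists (c *: x + y); rewrite lemb.
  move=> i j v w hv hw /eqP; rewrite addn_eq0 => /andP[/eqP ei /eqP ej].
  rewrite {}ei in hv; rewrite {}ej in hw.
  move/hdegA: hv => [a ->]; move/hdegB: hw => [b ->].
  by exists (a ⊗ b); rewrite embE.
move: x; apply: tensor_ind.
  by apply: (lin_closed_comp (lin_closed_hdeg _ gH)).
by move=> a b; rewrite embE; exact: (hdeg_tens gA gB (embA0 a) (embB0 b)).
Qed.

(** A product [a (db) ⊗ c] is not a single term [x dy] of the biproduct, but the
    difference of two. *)
Lemma hdeg1_gtensor (w : gtensor OA OB) : hdeg 1 w <->
  exists s : seq (tensor A B * tensor A B),
    w = \sum_(x <- s) mul H (emb x.1) (d (emb x.2)).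
Proof.
have [_ [_ gm _] [_ hd _] _] := DH.
split=> [hw|[s ->]]; last first.
  apply: lin_closed_sum => [|x _]; first exact: lin_closed_hdeg.
  rewrite -[1%N]/(0 + 1)%N; apply: gm; first by apply/hdeg0_gtensor; exists x.1.
  by apply: hd; apply/hdeg0_gtensor; exists x.2.
pose P (t : tensor OA OB) := exists s : seq (tensor A B * tensor A B),
    t = \sum_(x <- s) mul H (emb x.1) (d (emb x.2)).
have cP : lin_closed P.
  split; first by exists [::]; rewrite big_nil.
  move=> c u v [s1 ->] [s2 ->]; exists ([seq (c *: x.1, x.2) | x <- s1] ++ s2).
  rewrite big_cat big_map scaler_sumr; congr (_ + _); apply: eq_bigr => x _.
  by rewrite -(bilinZl c (emb x.1) (d (emb x.2)) bH) -(linear_Z c x.1 lemb).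
have P1 x y : P (mul H (emb x) (d (emb y))).
  by exists [:: (x, y)]; rewrite big_seq1.
have dE a b : d (embA a ⊗ embB b) = dA (embA a) ⊗ embB b + embA a ⊗ dB (embB b).
  by rewrite tdiffE // (ksign_hdeg _ gA (embA0 a)) muln0 scale1r.
have dA1 : dA (one HOA) = 0 := dga_one DA.
have mJK w t g := bosonisation_mul_jK hOA hOB w t g.
have mJV w h g := bosonisation_mul_jV hOA hOB w h g.
have r1A x : mul HOA x (one HOA) = x by case: aA => _ _ _ _ [_ ->].
rewrite -/(P w); move: w hw; apply: (hdeg_gtensor_ind gA gB) => // i j v w hv hw e.
(* The degree one part is [Omega^1(A) ⊗ B + A ⊗ Omega^1(B)]. *)
have [ei|ei] : (i = 1 /\ j = 0 \/ i = 0 /\ j = 1)%N.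
  by case: i e {hv} => [|[|i]] /=; rewrite ?add0n ?add1n => // e; [right | left; case: e].
- case: ei => ei ej; rewrite {}ei in hv; rewrite {}ej in hw.
  have [_ _ h1A _] := EA; move/h1A: hv => [s ->]; move/hdegB: hw => [b ->].
  rewrite (linear_sumE (f := fun v => v ⊗ embB b)); last by lin.
  apply: lin_closed_sum => // x _.
  have -> : mul HOA (embA x.1) (dA (embA x.2)) ⊗ embB b =
    (-1) *: mul H (emb (mul HA x.1 x.2 ⊗ one HB)) (d (emb (one HA ⊗ b))) +
    mul H (emb (x.1 ⊗ one HB)) (d (emb (x.2 ⊗ b))).
    rewrite !embE !dE embA1 embB1 dA1 tens0l add0r (bilinDr _ _ _ bH) !mJK embAM r1A.
    by rewrite scaleN1r addrCA addNr addr0.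
  by case: cP => _; apply.
- case: ei => ei ej; rewrite {}ei in hv; rewrite {}ej in hw.
  have [_ _ h1B _] := EB; move/h1B: hw => [s ->]; move/hdegA: hv => [a ->].
  rewrite (linear_sumE (f := tens (embA a))); last by lin.
  apply: lin_closed_sum => // x _.
  have -> : embA a ⊗ mul HOB (embB x.1) (dB (embB x.2)) =
    mul H (emb (a ⊗ x.1)) (d (emb (one HA ⊗ x.2))).
    by rewrite !embE dE embA1 dA1 tens0l add0r mJV.
  exact: P1.
Qed.

(** Generation is inherited from the two factors, every tensor being a product of
    elements of the two. *)
Lemma bosonisation_exterior_algebra :
  @exterior_algebra k (tensor A B) bip (gtensor OA OB) H d emb.
Proof.
split=> //.
- split=> //; [exact: biproduct_emb_inj | exact: biproduct_emb_alg | exact: hdeg0_gtensor].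
- exact: hdeg1_gtensor.
have [_ _ h1 _ [_ r1A]] := aA; have [_ _ h1' _ [l1B _]] := aB.
have [_ [_ _ o0A] _ _] := DA; have [_ [_ _ o0B] _ _] := DB.
have [_ _ _ genA] := EA; have [_ _ _ genB] := EB.
move=> P Po PL PM P0 P1 w.
have cP : lin_closed P.
  by split; [apply: P0; apply: linear_0; apply: linear_gpart | exact: PL].
move: w; apply: tensor_ind => // v w.
have -> : v ⊗ w = mul H (v ⊗ one HOB) (one HOA ⊗ w).
  by rewrite (bosonisation_mul_jK hOA hOB) r1A.
apply: (PM _ _).
- move: v; apply: genA => // [c x y Px Py|x y Px Py|u hu|u hu].
  + by rewrite tensDl tensZl; apply: PL.
  + by rewrite -(bosonisation_mul_jK hOA hOB); apply: PM.
  + by apply: P0; apply: (hdeg_tens gA gB hu o0B).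
  + by apply: P1; apply: (hdeg_tens gA gB hu o0B).
- move: w; apply: genB => // [c x y Px Py|x y Px Py|u hu|u hu].
  + by rewrite tensDr tensZr; apply: PL.
  + by rewrite -(bosonisation_mul_jV hOA hOB); apply: PM.
  + by apply: P0; apply: (hdeg_tens gA gB o0A hu).
  + by apply: P1; apply: (hdeg_tens gA gB o0A hu).
Qed.
End BosonisationExterior.

Theorem theorem4p1 (k : fieldType)
    (A : lmodType k) (HA : hopf A)
    (B : lmodType k) (HB : hopf B) (cB : crossed B A)
    (OA : graded k) (HOA : hopf OA) (dA : OA -> OA) (embA : A -> OA)
    (OB : graded k) (HOB : hopf OB) (cOB : crossed OB OA)
    (dB : OB -> OB) (embB : B -> OB) :
  hopf_algebra HA -> bijective (ant HA) ->
  braided_hopf_algebra HA HB cB ->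
  strongly_bicovariant HA HOA dA embA ->
  braided_strongly_bicovariant HA HOA dA embA HB cB HOB cOB dB embB ->
  exists S : tensor A B -> tensor A B,
    hopf_algebra (biproduct HA HB cB S) /\
    (bijective (ant HB) -> bijective S) /\
    exists SO : tensor OA OB -> tensor OA OB,
      @strongly_bicovariant k (tensor A B) (biproduct HA HB cB S)
        (gtensor OA OB) (super_bosonisation HOA HOB cOB SO)
        (tdiff dA dB) (tmap embA embB).
Proof.
move=> hA bijA hB [EA hOA gcA ecA dcA] [EB [eco [_ gco _ dco]] _ [eact gact dact]].
move=> [_ ecB gcB hOB dcB].
have DA : dga HOA dA by case: EA.
have DB : dga HOB dB by case: EB.
exists (@bosonisation_antipode k (purely_even A) (purely_even B) HA HB cB).
split; first exact: biproduct_hopf.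
split; first exact: biproduct_antipode_bijective.
exists (bosonisation_antipode HOA HOB cOB); split.
- apply: bosonisation_exterior_algebra => //.
  exact: bosonisation_dga.
- exact: bosonisation_super_hopf.
- exact: (bosonisation_gr_cop hOA hOB DA DB).
- exact: (biproduct_emb_cop hA hB hOA hOB EA EB).
- exact: (bosonisation_cop_diff hOA hOB DA DB).
Qed.
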